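(* Let $f:[0,\infty)\to[0,1]$ be nonincreasing with $0<\sup\{a: f(a)>0\}<\infty$, and let $\lambda>\lambda_f$. Let $\mathcal{C}$ be the (almost surely unique) infinite connected component of $RCM(\lambda,f)$. Then the critical probabilities for site and bond percolation on $\mathcal{C}$ satisfy $p_c^{\rm site}>p_c^{\rm bond}$.
   Context: For $\lambda>0$, $\mathscr{P}_\lambda$ is a homogeneous Poisson point process of intensity $\lambda$ in $\mathbb{R}^2$. Given a connection function $f:[0,\infty)\to[0,1]$, the random connection model $RCM(\lambda,f)$ is the random graph with vertex set $\mathscr{P}_\lambda$ in which each pair of vertices $x,y$ is joined by an edge with probability $f(|x-y|)$, independently of all other pairs. When $0<\int_0^\infty r f(r)\,dr<\infty$ there is a critical intensity $\lambda_f\in(0,\infty)$ such that for $\lambda>\lambda_f$ the graph $RCM(\lambda,f)$ a.s. has a unique infinite connected component $\mathcal{C}$, and for $\lambda<\lambda_f$ a.s. it has no infinite component. Site percolation on $\mathcal{C}$ with parameter $p$: each vertex of $\mathcal{C}$ is independently open with probability $p$; $p_c^{\rm site}$ is the critical value of $p$ above which the open-vertex induced subgraph a.s. has an infinite component and below which a.s. it does not. Bond percolation: each edge of $\mathcal{C}$ is independently open with probability $p$, and $p_c^{\rm bond}$ is the analogous critical value for the open-edge subgraph. *)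

(* Defs.v *)
From HB Require Import structures.
From mathcomp Require Import all_boot all_order all_algebra.
From mathcomp Require Import all_classical all_reals all_analysis.
From Stdlib Require Import Relation_Operators.
Set Implicit Arguments. Unset Strict Implicit. Unset Printing Implicit Defensive.
Import Order.TTheory GRing.Theory Num.Theory.
Import numFieldNormedType.Exports.
Local Open Scope classical_set_scope.
Local Open Scope ring_scope.

Section Graph.
Variable L : Type.
Definition gedge (Vt : set L) (E : L -> L -> Prop) (x y : L) : Prop :=
  Vt x /\ Vt y /\ E x y.
Definition cluster (Vt : set L) (E : L -> L -> Prop) (u : L) : set L :=
  [set v | Vt u /\ clos_refl_trans L (gedge Vt E) u v].
Definition has_infinite_cluster (Vt : set L) (E : L -> L -> Prop) : Prop :=
  exists u, Vt u /\ ~ finite_set (cluster Vt E u).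
End Graph.

(** * Labels and the index set of the underlying random variables.
   A vertex label is ((k1,k2), i): the i-th Poisson point in the unit box
   [k1,k1+1) x [k2,k2+1). *)
Definition Lab := ((int * int) * nat)%type.
Definition Idx :=
  ((int * int) + (Lab * bool) + (Lab * Lab) + Lab + (Lab * Lab))%type.
(* number of points in box k *)
Definition iN (k : int * int) : Idx := inl (inl (inl (inl k))).
(* coordinate c (false = x, true = y) of point a, relative to its box *)
Definition iX (a : Lab) (c : bool) : Idx := inl (inl (inl (inr (a, c)))).
(* uniform variable deciding the RCM edge between a and b *)
Definition iE (e : Lab * Lab) : Idx := inl (inl (inr e)).
(* uniform variable deciding whether site a is open *)
Definition iS (a : Lab) : Idx := inl (inr a).
(* uniform variable deciding whether bond {a,b} is open *)
Definition iB (e : Lab * Lab) : Idx := inr e.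

Definition epair (a b : Lab) : Lab * Lab :=
  if (pickle a < pickle b)%N then (a, b) else (b, a).

Definition mutually_independent {R : realType} {d : measure_display}
  {T : measurableType d} {I : eqType} (P : probability T R)
  (X : I -> {RV P >-> R}) : Prop :=
  forall (J : seq I) (B : I -> set R), uniq J ->
    (forall i, measurable (B i)) ->
    P (\big[setI/setT]_(i <- J) (X i @^-1` B i)) =
    (\prod_(i <- J) P (X i @^-1` B i))%E.

Definition is_poisson {R : realType} {d : measure_display}
  {T : measurableType d} (P : probability T R) (Y : {RV P >-> R}) (lam : R) :=
  forall n : nat, P (Y @^-1` [set n%:R]) = (poisson_pmf lam n)%:E.

Definition is_uniform01 {R : realType} {d : measure_display}
  {T : measurableType d} (P : probability T R) (Y : {RV P >-> R}) :=
  forall t : R, P (Y @^-1` [set x | x <= t]) = (Num.min (Num.max t 0) 1)%:E.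

Section RCM.
Context {R : realType} {d : measure_display} {T : measurableType d}.
Variables (f : R -> R) (P : probability T R) (X : Idx -> {RV P >-> R}).

(** The probability space realizes: a Poisson process of intensity lam in R^2
    (independent Poisson(lam) counts in unit boxes, each point uniform in its
    box), independent Uniform[0,1] edge variables for RCM(lam,f), and further
    independent Uniform[0,1] variables for site and bond percolation. *)
Definition rcm_model (lam : R) : Prop :=
  mutually_independent X /\
  (forall k, is_poisson (X (iN k)) lam) /\
  (forall a c, is_uniform01 (X (iX a c))) /\
  (forall e, is_uniform01 (X (iE e))) /\
  (forall a, is_uniform01 (X (iS a))) /\
  (forall e, is_uniform01 (X (iB e))).

(* a is a point of the Poisson process *)
Definition vert (w : T) : set Lab := [set a | (a.2)%:R < X (iN a.1) w].
Definition xpos (a : Lab) (w : T) : R := (a.1.1)%:~R + X (iX a false) w.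
Definition ypos (a : Lab) (w : T) : R := (a.1.2)%:~R + X (iX a true) w.
Definition dist (a b : Lab) (w : T) : R :=
  Num.sqrt ((xpos a w - xpos b w) ^+ 2 + (ypos a w - ypos b w) ^+ 2).
Definition adj (w : T) (a b : Lab) : Prop :=
  vert w a /\ vert w b /\ a <> b /\ X (iE (epair a b)) w < f (dist a b w).

(* the infinite component C (union of the infinite clusters; a.s. unique) *)
Definition Cinf (w : T) : set Lab :=
  [set a | vert w a /\ ~ finite_set (cluster (vert w) (adj w) a)].

Definition site_perc (p : R) : set T :=
  [set w | has_infinite_cluster
             [set a | Cinf w a /\ X (iS a) w < p] (adj w)].
Definition bond_perc (p : R) : set T :=
  [set w | has_infinite_cluster (Cinf w)
             (fun a b => adj w a b /\ X (iB (epair a b)) w < p)].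

Definition pc_site : R := sup [set p : R | 0 <= p <= 1 /\ P (site_perc p) = 0%E].
Definition pc_bond : R := sup [set p : R | 0 <= p <= 1 /\ P (bond_perc p) = 0%E].

Definition rcm_percolates : set T :=
  [set w | has_infinite_cluster (vert w) (adj w)].
End RCM.

Definition lambda_crit {R : realType} (f : R -> R) : R :=
  inf [set lam : R | 0 < lam /\
    exists (d : measure_display) (T : measurableType d) (P : probability T R)
           (X : Idx -> {RV P >-> R}),
      rcm_model X lam /\ (0 < P (rcm_percolates f X))%E].

(* Main.v *)
From HB Require Import structures.
From mathcomp Require Import all_boot all_order all_algebra.
From mathcomp Require Import all_classical all_reals all_analysis.
From mathcomp Require Import measurable_realfun intdiv.
From mathcomp Require Import zify lra ring.
From Stdlib Require Import Relation_Operators.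
Require Import Defs.
Set Implicit Arguments. Unset Strict Implicit. Unset Printing Implicit Defensive.
Import Order.TTheory GRing.Theory Num.Theory.
Import numFieldNormedType.Exports.
Local Open Scope classical_set_scope.
Local Open Scope ring_scope.

(** All comparisons are couplings on the space of configurations [Idx -> R],
    with no use of derivatives in [p].  Let [mu] be the critical intensity of
    the random connection model (it lies strictly between [0] and [lam]) and
    [p* = mu / lam].  Site percolation with parameter [p] on [RCM(lam, f)] is
    the model of intensity [lam p], hence [p* <= p_c(site)]; it remains to see
    that bonds percolate for some [p < p*].

    Revealing edges one by one from the active set shows that bond percolation
    dominates the growth in which a vertex is ordinary with probability [p] (it
    needs one active neighbour) and helping with probability at most
    [p (1 - p)] (it needs two).  Ordinary vertices alone give intensity
    [lam p].  With probability at least [c1 c2^K] the helping vertices around a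
    box form a gadget: a fine grid, densely linked, which becomes active as
    soon as two adjacent vertices near it are, and then activates all ordinary
    vertices near it.  Poisson tails beyond [K] are far smaller than [c2^K], so
    a box with a gadget makes up, box by box, both for the boxes with more than
    [K] points and for a slightly larger intensity [mu1 > mu].

    That the critical intensity is finite follows from a hierarchical
    renormalization of good boxes: a block of side [3^(n+1)] is good when at
    most one of its nine sub-blocks is bad, so the probabilities of bad blocks
    satisfy [q_(n+1) <= 81 q_n^2], and good adjacent blocks are connected. *)

(** * Cylinder sigma-algebras and discrete data *)

(** The bound [p (1 - p)] is the probability that the first edge revealed towards a vertex is closed
    and the second one open; site percolation at [p] has nothing to match such a vertex. The
    difficulty is to turn this surplus into extra intensity, independently in each box. Each helping
    vertex is reserved by its type for the gadget of one box, and each edge between two gadgets is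
    charged to one of them, so that gadgets of different boxes are independent. A gadget controls
    the edges from its helping vertices to ordinary ones but never those between ordinary vertices:
    the number of conditions is linear in [K], and [c1 c2^K] still exceeds a Poisson tail, which a
    cost of order [c^(K^2)] would not. An active gadget is linked to everything near it, hence does
    all that the points of an overfull box could do; an overfull box may thus count as a gadget in
    the model to be dominated and as empty in the dominating one. As [mu] is an infimum, percolation
    at [mu] itself is unknown: some [mu1 >= mu] that percolates is compared with bonds at a [p]
    slightly below [p*]. *)

Section Cylinders.
Variables (R : realType) (I : choiceType).

Definition box (s : seq I) (B : I -> set R) : set (I -> R) :=
  [set w | forall i, i \in s -> B i (w i)].

Definition cyl (J : set I) : set (set (I -> R)) :=
  [set A | exists s B, (forall i, i \in s -> J i) /\
     (forall i, measurable (B i)) /\ A = box s B].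

(** The events that depend only on the coordinates in [J]. Every independence statement below is the
    disjointness of two such index sets. *)
Definition sig (J : set I) : set (set (I -> R)) := <<s cyl J >>.

Definition Om := g_sigma_algebraType (cyl setT).

Lemma sigE J : sig J = <<s cyl J >>. Proof. by []. Qed.

Lemma cyl_setI J : setI_closed (cyl J).
Proof.
move=> A A' [s [B [sJ [mB ->]]]] [s' [B' [s'J [mB' ->]]]].
exists (s ++ s'), (fun i => (if i \in s then B i else setT) `&`
                     (if i \in s' then B' i else setT)); split; last split.
- by move=> i; rewrite mem_cat => /orP[/sJ|/s'J].
- by move=> i; apply: measurableI; case: ifP.
apply/seteqP; split=> w /=.
  move=> [ws ws'] i _; split; case: ifP => // Hi; [exact: ws|exact: ws'].
move=> H; split=> i Hi; have := H i; rewrite mem_cat Hi ?orbT => /(_ isT) [].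
  by [].
by [].
Qed.

Lemma cyl_sub J J' : J `<=` J' -> cyl J `<=` cyl J'.
Proof.
by move=> JJ' A [s [B [sJ H]]]; exists s, B; split=> // i /sJ /JJ'.
Qed.

Lemma sig_sub J J' : J `<=` J' -> sig J `<=` sig J'.
Proof.
move=> JJ'; apply: sub_smallest2r; last exact: cyl_sub.
exact: smallest_sigma_algebra.
Qed.

Lemma sigC J A : sig J A -> sig J (~` A).
Proof. by move=> sA; rewrite -setTD; exact: sigma_algebraCD. Qed.

Lemma sig_bigcup J (F : nat -> set (I -> R)) :
  (forall n, sig J (F n)) -> sig J (\bigcup_n F n).
Proof. exact: sigma_algebra_bigcup. Qed.

Lemma sig0 J : sig J set0. Proof. exact: sigma_algebra0. Qed.
Lemma sigT J : sig J setT. Proof. by rewrite -setC0; apply: sigC; exact: sig0. Qed.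

Lemma sigU J A B : sig J A -> sig J B -> sig J (A `|` B).
Proof.
move=> sA sB; rewrite -bigcup2E; apply: sig_bigcup => -[|[|n]] //=; exact: sigma_algebra0.
Qed.

Lemma sigI J A B : sig J A -> sig J B -> sig J (A `&` B).
Proof.
by move=> sA sB; rewrite -(setCK (_ `&` _)) setCI; apply: sigC; apply: sigU; exact: sigC.
Qed.

Lemma sig_cst J (b : Prop) : sig J [set _ | b].
Proof.
have [b1|b0] := pselect b.
  by rewrite (_ : mkset _ = setT); [exact: sigT|apply/seteqP; split].
by rewrite (_ : mkset _ = set0); [exact: sig0|apply/seteqP; split].
Qed.

Lemma sig_not J (A : (I -> R) -> Prop) : sig J [set w | A w] -> sig J [set w | ~ A w].
Proof. exact: sigC. Qed.

Lemma sig_and J (A B : (I -> R) -> Prop) :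
  sig J [set w | A w] -> sig J [set w | B w] -> sig J [set w | A w /\ B w].
Proof. exact: sigI. Qed.

Lemma sig_or J (A B : (I -> R) -> Prop) :
  sig J [set w | A w] -> sig J [set w | B w] -> sig J [set w | A w \/ B w].
Proof. exact: sigU. Qed.

Lemma sig_imp J (A B : (I -> R) -> Prop) :
  sig J [set w | A w] -> sig J [set w | B w] -> sig J [set w | A w -> B w].
Proof.
move=> sA sB; rewrite (_ : mkset _ = [set w | ~ A w \/ B w]).
  by apply: sig_or => //; exact: sig_not.
apply/seteqP; split=> w /=; last by case.
by have [a|] := pselect (A w); [move=> /(_ a); right|left].
Qed.

Lemma sig_ex J (C : countType) (A : C -> (I -> R) -> Prop) :
  (forall c, sig J [set w | A c w]) -> sig J [set w | exists c, A c w].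
Proof.
move=> sA; rewrite (_ : mkset _ = \bigcup_n
  (if pickle_inv n is Some c then [set w | A c w] else set0)).
  by apply: sig_bigcup => n; case: pickle_inv => // ; exact: sig0.
apply/seteqP; split=> w /=.
  by move=> [c Ac]; exists (pickle c) => //; rewrite pickleK_inv.
by move=> [n _]; case: pickle_inv => // c Ac; exists c.
Qed.

Lemma sig_all J (C : countType) (A : C -> (I -> R) -> Prop) :
  (forall c, sig J [set w | A c w]) -> sig J [set w | forall c, A c w].
Proof.
move=> sA; rewrite (_ : mkset _ = ~` [set w | exists c, ~ A c w]).
  by apply: sigC; apply: sig_ex => c; exact: sig_not.
apply/seteqP; split=> w /=; first by move=> H [c]; apply; exact: H.
by move=> H c; apply: contrapT => nA; apply: H; exists c.
Qed.

Lemma sig_ext J (A B : (I -> R) -> Prop) : (forall w, A w <-> B w) ->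
  sig J [set w | A w] -> sig J [set w | B w].
Proof.
by move=> AB; rewrite (_ : mkset A = mkset B) //; apply/seteqP; split=> w /AB.
Qed.

Lemma sig_triv J (A : (I -> R) -> Prop) : (forall w, A w) -> sig J [set w | A w].
Proof. by move=> H; apply: (@sig_ext J (fun=> True)); [move=> w; split|exact: sig_cst]. Qed.

Lemma sig_ex2 J (C : countType) (s : seq C) (F : C -> set (I -> R)) :
  (forall c, sig J (F c)) -> sig J [set w | exists2 c, c \in s & F c w].
Proof.
move=> sF; apply: (@sig_ext J (fun w => exists c, c \in s /\ F c w)).
  by move=> w; split=> [[c []]|[c]]; exists c.
by apply: sig_ex => c; apply: sig_and; [exact: sig_cst|exact: sF].
Qed.

Lemma sig_coord J i (B : set R) : J i -> measurable B -> sig J [set w | B (w i)].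
Proof.
move=> Ji mB; apply: sub_sigma_algebra; exists [:: i], (fun=> B); split.
  by move=> j; rewrite inE => /eqP ->.
split=> //; apply/seteqP; split=> w /=; first by move=> Bw j; rewrite inE => /eqP ->.
by apply; rewrite inE.
Qed.

(** Data with countably many values read from the coordinates in [J]. Conditioning on it means
    freezing it inside a countable sum, which takes the place of conditional expectation. *)
Definition disc J (C : Type) (D : (I -> R) -> C) :=
  forall c : C, sig J [set w | D w = c].

Lemma disc_pred J (C : countType) (D : (I -> R) -> C) (Q : C -> (I -> R) -> Prop) :
  disc J D -> (forall c, sig J [set w | Q c w]) -> sig J [set w | Q (D w) w].
Proof.
move=> dD sQ; apply: (@sig_ext J (fun w => exists c, D w = c /\ Q c w)).
  by move=> w; split=> [[c [-> ]]//|QD]; exists (D w).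
by apply: sig_ex => c; exact: sig_and.
Qed.

Lemma disc_comp J (C : countType) C' (D : (I -> R) -> C) (g : C -> C') :
  disc J D -> disc J (fun w => g (D w)).
Proof.
move=> dD c'; apply: (@disc_pred J _ D (fun c _ => g c = c')) => // c.
exact: sig_cst.
Qed.

Lemma disc_cst J C (c : C) : disc J (fun _ => c).
Proof. move=> c'; exact: sig_cst. Qed.

Lemma disc_pair J (C C' : countType) (D : (I -> R) -> C) (D' : (I -> R) -> C') :
  disc J D -> disc J D' -> disc J (fun w => (D w, D' w)).
Proof.
move=> dD dD' [c c'].
apply: (@sig_ext J (fun w => D w = c /\ D' w = c')).
  by move=> w; split=> [[-> ->]|[-> ->]].
exact: sig_and.
Qed.

Lemma disc_map J (K : eqType) (C : countType) (D : K -> (I -> R) -> C) (s : seq K) :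
  (forall k, k \in s -> disc J (D k)) -> disc J (fun w => [seq D k w | k <- s]).
Proof.
elim: s => [_|k s IH dD] /=; first exact: disc_cst.
apply: (@disc_comp J _ _ (fun w => (D k w, [seq D k w | k <- s]))
  (fun c => c.1 :: c.2) (disc_pair (dD k (mem_head _ _)) (IH _))) => j js.
by apply: dD; rewrite inE js orbT.
Qed.

Lemma disc_filter J (K : countType) (D : K -> (I -> R) -> bool) (s : seq K) :
  (forall k, k \in s -> disc J (D k)) -> disc J (fun w => [seq k <- s | D k w]).
Proof.
elim: s => [_|k s IH dD] /=; first exact: disc_cst.
apply: (@disc_comp J _ _ (fun w => (D k w, [seq k <- s | D k w]))
  (fun c => if c.1 then k :: c.2 else c.2) (disc_pair (dD k (mem_head _ _)) (IH _))) => j js.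
by apply: dD; rewrite inE js orbT.
Qed.

Lemma disc_asbool J (A : (I -> R) -> Prop) :
  sig J [set w | A w] -> disc J (fun w => `[< A w >]).
Proof.
move=> sA [].
  by apply: (@sig_ext J A) => // w; split=> /asboolP.
by apply: (@sig_ext J (fun w => ~ A w)); [move=> w; split=> [nA|/asboolP//]|exact: sig_not];
  apply/asboolP.
Qed.

Lemma disc_boolP J (D : (I -> R) -> bool) : sig J [set w | D w] -> disc J D.
Proof.
move=> sD [] //.
by apply: (@sig_ext J (fun w => ~ D w)); [move=> w; split=> [/negP/negbTE//|->]|exact: sig_not].
Qed.

Lemma disc_sub J J' C (D : (I -> R) -> C) : J `<=` J' -> disc J D -> disc J' D.
Proof. by move=> JJ' dD c; exact: (sig_sub JJ'). Qed.

End Cylinders.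

(** * Probability and independence of coordinates *)

Section ProbBasics.
Variables (R : realType) (I : choiceType).
Local Notation Om := (Om R I).
Local Notation sig := (@sig R I).
Implicit Types (Q : probability Om R) (A B : set (I -> R)).

Definition pr Q (A : set (I -> R)) : R := fine (Q (A : set Om)).

Lemma prE Q A : sig setT A -> Q (A : set Om) = (pr Q A)%:E.
Proof. by move=> sA; rewrite /pr fineK // fin_num_measure. Qed.

Lemma pr_ge0 Q A : 0 <= pr Q A.
Proof. by rewrite /pr fine_ge0. Qed.

Lemma pr_le Q A B : sig setT A -> sig setT B -> A `<=` B -> pr Q A <= pr Q B.
Proof. by move=> sA sB AB; rewrite -lee_fin -!prE //; apply: le_measure => //; rewrite inE. Qed.

Lemma prT Q : pr Q setT = 1.
Proof. by rewrite /pr probability_setT. Qed.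

Lemma pr0 Q : pr Q set0 = 0.
Proof. by rewrite /pr measure0. Qed.

Lemma pr_le1 Q A : sig setT A -> pr Q A <= 1.
Proof. by move=> sA; rewrite -(prT Q); apply: pr_le => //; exact: sigT. Qed.

Lemma prU Q A B : sig setT A -> sig setT B -> A `&` B = set0 ->
  pr Q (A `|` B) = pr Q A + pr Q B.
Proof.
move=> sA sB AB; apply: EFin_inj; rewrite EFinD -!prE //; last exact: sigU.
by rewrite measureU.
Qed.

Lemma prC Q A : sig setT A -> pr Q (~` A) = 1 - pr Q A.
Proof.
move=> sA; have := @prU Q A (~` A) sA (sigC sA) (setICr A).
by rewrite setUv prT => ->; rewrite addrAC subrr add0r.
Qed.

Lemma prD Q A B : sig setT A -> sig setT B ->
  pr Q A = pr Q (A `&` B) + pr Q (A `&` ~` B).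
Proof.
move=> sA sB; rewrite -prU.
- by rewrite -setIUr setUv setIT.
- exact: sigI.
- by apply: sigI => //; exact: sigC.
by rewrite setIACA setICr setI0.
Qed.

Lemma prU_le Q A B : sig setT A -> sig setT B -> pr Q (A `|` B) <= pr Q A + pr Q B.
Proof.
move=> sA sB; rewrite -lee_fin EFinD -!prE //; last exact: sigU.
exact: measureU2.
Qed.

Lemma pr_bigU_le Q (K : eqType) (s : seq K) (F : K -> set (I -> R)) :
  (forall k, sig setT (F k)) ->
  pr Q [set w | exists2 k, k \in s & F k w] <= \sum_(k <- s) pr Q (F k).
Proof.
move=> sF.
have H (t : seq K) : sig setT [set w | exists2 k, k \in t & F k w].
  elim: t => [|k t IH].
    rewrite (_ : mkset _ = set0); first exact: sig0.
    by apply/seteqP; split=> w // [].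
  rewrite (_ : mkset _ = F k `|` [set w | exists2 k, k \in t & F k w]).
    exact: sigU.
  apply/seteqP; split=> w /=.
    by move=> [j]; rewrite inE => /orP[/eqP->|jt] Fj; [left|right; exists j].
  move=> [Fk|[j jt Fj]]; first by exists k => //; rewrite inE eqxx.
  by exists j => //; rewrite inE jt orbT.
elim: s => [|k s IH].
  rewrite big_nil (_ : mkset _ = set0) ?pr0 //.
  by apply/seteqP; split=> w // [].
rewrite big_cons; apply: le_trans (lerD (lexx _) IH).
apply: le_trans (prU_le Q (sF k) (H s)).
apply: pr_le; [exact: H|exact: sigU|].
by move=> w /= [j]; rewrite inE => /orP[/eqP->|jt] Fj; [left|right; exists j].
Qed.

Lemma pr_bigcup_gt0 Q (C : countType) (F : C -> set (I -> R)) :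
  (forall c, sig setT (F c)) -> 0 < pr Q [set w | exists c, F c w] ->
  exists c, 0 < pr Q (F c).
Proof.
move=> sF H; apply: contrapT => nH.
have F0 c : pr Q (F c) = 0.
  apply/eqP; rewrite eq_le pr_ge0 andbT leNgt; apply/negP => Hc.
  by apply: nH; exists c.
move: H; rewrite ltNge => /negP; apply.
rewrite -lee_fin -prE; last exact: sig_ex.
pose G n : set Om := if pickle_inv n is Some c then F c else set0.
have -> : [set w | exists c, F c w] = \bigcup_n G n.
  apply/seteqP; split=> w /=.
    by move=> [c Ac]; exists (pickle c) => //; rewrite /G pickleK_inv.
  by move=> [n _]; rewrite /G; case: pickle_inv => // c Ac; exists c.
have mG n : measurable (G n).
  by rewrite /G; case: pickle_inv => // c; exact: sF.
apply: le_trans (measure_sigma_subadditive Q mG _ (@subset_refl _ _)) _.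
  exact: bigcupT_measurable.
rewrite eseries0 // => n _ _; rewrite /G; case: pickle_inv => [c|]; last exact: measure0.
by transitivity ((pr Q (F c))%:E); [exact: prE|rewrite F0].
Qed.

Lemma pr_bigcap_ge Q (F : nat -> set (I -> R)) (c : R) :
  (forall n, sig setT (F n)) -> (forall n, F n.+1 `<=` F n) ->
  (forall n, c <= pr Q (F n)) -> c <= pr Q [set w | forall n, F n w].
Proof.
move=> sF dF cF.
have dec : {homo F : n m / (n <= m)%N >-> m `<=` n}.
  move=> n m /subnK <-; elim: (m - n)%N => [|k IH] //.
  by rewrite addSn; apply: subset_trans (dF _) IH.
have := @nonincreasing_cvg_mu _ Om R Q F.
rewrite (_ : \bigcap_n F n = [set w | forall n, F n w]); last first.
  by apply/seteqP; split=> w /= H n //; apply: H.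
have sA : sig setT [set w | forall n, F n w] by exact: sig_all.
move=> /(_ _ sF sA) cv.
have {}cv : (Q \o F) @ \oo --> Q [set w | forall n, F n w].
  apply: cv; last by move=> n m nm; apply/subsetPset; exact: dec.
  by rewrite -ge0_fin_numE // fin_num_measure //; exact: sF.
rewrite -lee_fin -prE // -(cvg_lim _ cv) //.
apply: lime_ge; first by apply/cvg_ex; eexists; exact: cv.
by apply: nearW => n /=; rewrite prE // lee_fin.
Qed.

Lemma pr_as_le Q O A B : sig setT O -> sig setT A -> sig setT B ->
  pr Q O = 1 -> A `&` O `<=` B -> pr Q A <= pr Q B.
Proof.
move=> sO sA sB O1 AB; rewrite (prD Q sA sO).
have -> : pr Q (A `&` ~` O) = 0.
  apply/eqP; rewrite eq_le pr_ge0 andbT.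
  apply: (@le_trans _ _ (pr Q (~` O))); last by rewrite prC // O1 subrr.
  apply: pr_le; [|exact: sigC|by move=> w []].
  by apply: sigI => //; exact: sigC.
by rewrite addr0; apply: pr_le => //; exact: sigI.
Qed.

Lemma pr_all1 Q (C : countType) (F : C -> set (I -> R)) :
  (forall c, sig setT (F c)) -> (forall c, pr Q (F c) = 1) ->
  pr Q [set w | forall c, F c w] = 1.
Proof.
move=> sF F1; have sA : sig setT [set w | forall c, F c w] by exact: sig_all.
apply/eqP; rewrite eq_le pr_le1 //= leNgt; apply/negP => H.
have : 0 < pr Q [set w | exists c, (~` F c) w].
  rewrite (_ : mkset _ = ~` [set w | forall c, F c w]).
    by rewrite prC // subr_gt0.
  apply/seteqP; split=> w /=; first by move=> [c nF] /(_ c).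
  by move=> /existsNP.
move=> /pr_bigcup_gt0 [|c]; first by move=> c; exact: sigC.
by rewrite prC // F1 subrr ltxx.
Qed.

Lemma pr_series Q (F : nat -> set (I -> R)) : (forall n, sig setT (F n)) ->
  trivIset setT F ->
  ((pr Q (\bigcup_n F n))%:E = \sum_(n <oo) (pr Q (F n))%:E)%E.
Proof.
move=> sF tF; rewrite -prE; last exact: sig_bigcup.
have := @measure_semi_bigcup _ _ _ Q F sF tF.
move=> /(_ (sig_bigcup sF)) ->.
by apply: eq_eseriesr => n _; exact: prE.
Qed.

(** Boxes form a pi-system, and the events on which two probabilities agree form a Dynkin system. *)
Lemma sig_unique J (m1 m2 : probability Om R) :
  (forall A, cyl J A -> pr m1 A = pr m2 A) ->
  forall A, sig J A -> pr m1 A = pr m2 A.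
Proof.
move=> H A; rewrite sigE -setI_closed_g_dynkin_g_sigma_algebra; last exact: cyl_setI.
move=> dA.
suff [_ ->] : [set B | sig setT B /\ pr m1 B = pr m2 B] A by [].
move: A dA; apply: smallest_sub; last first.
  move=> B cB; split; last exact: H.
  by apply: (@sig_sub _ _ J) => //; exact: sub_sigma_algebra.
split.
- by split; [exact: sigT|rewrite !prT].
- by move=> B [sB eB]; split; [exact: sigC|rewrite !prC // eB].
- move=> F tF HF; have sF n : sig setT (F n) by case: (HF n).
  split; first exact: sig_bigcup.
  apply: EFin_inj; rewrite !pr_series //.
  by apply: eq_eseriesr => n _; case: (HF n) => _ ->.
Qed.

Definition indep Q := forall (s : seq I) (B : I -> set R), uniq s ->
  (forall i, measurable (B i)) ->
  pr Q (box s B) = \prod_(i <- s) pr Q [set w | B i (w i)].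

Lemma sig_box J s (B : I -> set R) : (forall i, i \in s -> J i) ->
  (forall i, measurable (B i)) -> sig J (box s B).
Proof. by move=> sJ mB; apply: sub_sigma_algebra; exists s, B. Qed.

Section Independence.
Variables (Q : probability Om R).
Hypothesis iQ : indep Q.

Lemma box_undup s (B : I -> set R) : box s B = box (undup s) B.
Proof. by apply/seteqP; split=> w /= H i Hi; apply: H; rewrite mem_undup in Hi *. Qed.

(** The Dynkin argument in one factor, the other being fixed; [indep_sig] applies it to each factor
    in turn. *)
Lemma indep_class J B : sig setT B ->
  (forall A, cyl J A -> pr Q (A `&` B) = pr Q A * pr Q B) ->
  forall A, sig J A -> pr Q (A `&` B) = pr Q A * pr Q B.
Proof.
move=> sB H A; rewrite sigE -setI_closed_g_dynkin_g_sigma_algebra; last exact: cyl_setI.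
move=> dA.
suff [_ ->] : [set A | sig setT A /\ pr Q (A `&` B) = pr Q A * pr Q B] A by [].
move: A dA; apply: smallest_sub; last first.
  move=> A cA; split; last exact: H.
  by apply: (@sig_sub _ _ J) => //; exact: sub_sigma_algebra.
split.
- by split; [exact: sigT|rewrite setTI prT mul1r].
- move=> A [sA eA]; split; first exact: sigC.
  rewrite prC // mulrBl mul1r -eA (prD Q sB sA) (setIC B A) (setIC B).
  by rewrite addrAC subrr add0r.
- move=> F tF HF; have sF n : sig setT (F n) by case: (HF n).
  split; first exact: sig_bigcup.
  apply: EFin_inj; rewrite EFinM setI_bigcupl !pr_series //; first last.
  + exact: trivIset_setIr.
  + by move=> n; apply: sigI => //; exact: sF.
  rewrite muleC -nneseriesZl ?lee_fin ?pr_ge0 //; last first.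
    by move=> n _; rewrite lee_fin pr_ge0.
  by apply: eq_eseriesr => n _; case: (HF n) => _ ->; rewrite mulrC.
Qed.

Lemma indep_sig J1 J2 A B : J1 `&` J2 = set0 -> sig J1 A -> sig J2 B ->
  pr Q (A `&` B) = pr Q A * pr Q B.
Proof.
move=> J12 sA sB.
have sBT := sig_sub (@subsetT _ J2) sB.
apply: (indep_class sBT _ sA) => {A sA} A [s [C [sJ [mC ->]]]].
have sAT : sig setT (box s C) by exact: sig_box.
rewrite setIC mulrC; apply: (indep_class sAT _ sB) => {B sB sBT} B [s' [C' [sJ' [mC' ->]]]].
rewrite (box_undup s) (box_undup s').
pose D i := if i \in s then C i else C' i.
have Es' : box (undup s') C' = box (undup s') D.
  apply/seteqP; split=> w /= H i Hi; move: (H i Hi); rewrite /D; case: ifP => // Hs.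
    exfalso; have : (J1 `&` J2) i by split; [exact: sJ|apply: sJ'; rewrite mem_undup in Hi].
    by rewrite J12.
  exfalso; have : (J1 `&` J2) i by split; [exact: sJ|apply: sJ'; rewrite mem_undup in Hi].
  by rewrite J12.
have Es : box (undup s) C = box (undup s) D.
  by apply/seteqP; split=> w /= H i Hi; move: (H i Hi); rewrite /D -mem_undup Hi.
have mD i : measurable (D i) by rewrite /D; case: ifP.
rewrite Es Es' [in RHS]iQ ?undup_uniq // [X in _ = _ * X]iQ ?undup_uniq //.
rewrite -big_cat /= -iQ //; last first.
  rewrite cat_uniq !undup_uniq /= andbT; apply/hasPn => i; rewrite !mem_undup => Hi.
  apply/negP => Hi'; have : (J1 `&` J2) i by split; [exact: sJ|exact: sJ'].
  by rewrite J12.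
congr pr; apply/seteqP; split=> w /=.
  by move=> [H' H] i; rewrite mem_cat => /orP[/H'|/H].
by move=> H; split=> i Hi; apply: H; rewrite mem_cat Hi ?orbT.
Qed.

Lemma indep_blocks (K : eqType) (s : seq K) (J : K -> set I) (A : K -> set (I -> R)) :
  uniq s -> (forall k k', k \in s -> k' \in s -> k != k' -> J k `&` J k' = set0) ->
  (forall k, k \in s -> sig (J k) (A k)) ->
  pr Q [set w | forall k, k \in s -> A k w] = \prod_(k <- s) pr Q (A k).
Proof.
move=> us; elim: s us => [|k s IH] /=.
  by move=> _ _ _; rewrite big_nil (_ : mkset _ = setT) ?prT //; apply/seteqP; split.
move=> /andP[ks us] JJ sA; rewrite big_cons -IH //; first last.
- by move=> l Hl; apply: sA; rewrite inE Hl orbT.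
- by move=> l l' Hl Hl'; apply: JJ; rewrite inE ?Hl ?Hl' orbT.
rewrite -(@indep_sig (J k) (\bigcup_(l in [set` s]) J l)).
- congr pr; apply/seteqP; split=> w /=.
    move=> H; split=> [|l Hl]; apply: H; rewrite inE ?eqxx // Hl orbT //.
  by move=> [Hk H] l; rewrite inE => /orP[/eqP->|/H].
- apply/seteqP; split=> // i [Jk [l /= ls Jl]].
  have kl : k != l by apply: contraNneq ks => ->.
  suff : (J k `&` J l) i by rewrite JJ // inE ?eqxx // ls orbT.
  by split.
- by apply: sA; rewrite inE eqxx.
have : forall k, k \in s -> sig (\bigcup_(l in [set` s]) J l) (A k).
  move=> l ls; apply: sig_sub (sA l _); last by rewrite inE ls orbT.
  exact: bigcup_sup.
set J' := \bigcup_(_ in _) _; move: J' => J'; elim: (s) => [_|l t IHt H].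
  rewrite (_ : mkset _ = setT); first exact: sigT.
  by apply/seteqP; split.
apply: (@sig_ext _ _ _ (fun w => A l w /\ forall k, k \in t -> A k w)).
  move=> w; split=> [[Al At] j|H']; first by rewrite inE => /orP[/eqP->|/At].
  by split=> [|j jt]; apply: H'; rewrite inE ?eqxx // jt orbT.
apply: sig_and; first by apply: H; rewrite inE eqxx.
by apply: IHt => j jt; apply: H; rewrite inE jt orbT.
Qed.

Lemma cond_sum (C : countType) J1 J2 (D : (I -> R) -> C) (A : C -> set (I -> R)) :
  J1 `&` J2 = set0 -> disc J1 D -> (forall c, sig J2 (A c)) ->
  ((pr Q [set w | A (D w) w])%:E =
  \sum_(n <oo) (if pickle_inv n is Some c then
    pr Q [set w | D w = c] * pr Q (A c) else 0)%:E)%E.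
Proof.
move=> J12 dD sA.
have sDA : sig setT [set w | A (D w) w].
  apply: (@disc_pred _ _ _ C D (fun c w => A c w)); first exact: disc_sub dD.
  by move=> c; exact: sig_sub (sA c).
pose F n : set (I -> R) := if pickle_inv n is Some c then [set w | D w = c] `&` A c else set0.
have -> : [set w | A (D w) w] = \bigcup_n F n.
  apply/seteqP; split=> w /=.
    by move=> H; exists (pickle (D w)) => //; rewrite /F pickleK_inv.
  by move=> [n _]; rewrite /F; case: pickle_inv => // c [/= ->].
have mF n : sig setT (F n).
  rewrite /F; case: pickle_inv => [c|]; last exact: sig0.
  apply: sigI; first exact: sig_sub (dD c).
  exact: sig_sub (sA c).
rewrite pr_series //; last first.
  apply/trivIsetP => n m _ _ nm; apply/seteqP; split=> // w [].
  rewrite /F; case En: (pickle_inv n) => [c|//]; case Em: (pickle_inv m) => [c'|//].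
  move=> [/= Dc _] [/= Dc' _]; move/eqP: nm; apply.
  have := @pickle_invK C n; have := @pickle_invK C m.
  by rewrite /oapp En Em -Dc -Dc' => -> ->.
apply: eq_eseriesr => n _; rewrite /F; case En: (pickle_inv n) => [c|]; last by rewrite pr0.
by rewrite (@indep_sig J1 J2).
Qed.

(** The device by which a comparison proved for a fixed graph, fixed counts or a fixed renaming is
    carried over to random ones: it is enough to prove it with [D] frozen. *)
Lemma cond_le (C : countType) J1 J2 J3 (D : (I -> R) -> C) (A B : C -> set (I -> R)) :
  J1 `&` J2 = set0 -> J1 `&` J3 = set0 -> disc J1 D ->
  (forall c, sig J2 (A c)) -> (forall c, sig J3 (B c)) ->
  (forall c, pr Q (A c) <= pr Q (B c)) ->
  pr Q [set w | A (D w) w] <= pr Q [set w | B (D w) w].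
Proof.
move=> J12 J13 dD sA sB AB; rewrite -lee_fin (cond_sum J12) // (cond_sum J13) //.
apply: lee_nneseries => n _ //.
  by move=> _; case: pickle_inv => [c|//]; rewrite lee_fin mulr_ge0 ?pr_ge0.
case: pickle_inv => [c|//]; rewrite lee_fin ler_wpM2l ?pr_ge0 //.
Qed.

Lemma cond_law (C : countType) J1 J1' J2 (D D' : (I -> R) -> C) (A : C -> set (I -> R)) :
  J1 `&` J2 = set0 -> J1' `&` J2 = set0 -> disc J1 D -> disc J1' D' ->
  (forall c, sig J2 (A c)) ->
  (forall c, pr Q [set w | D w = c] = pr Q [set w | D' w = c]) ->
  pr Q [set w | A (D w) w] = pr Q [set w | A (D' w) w].
Proof.
move=> J12 J12' dD dD' sA DD'; apply: EFin_inj; rewrite (cond_sum J12) // (cond_sum J12') //.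
by apply: eq_eseriesr => n _; case: pickle_inv => [c|//]; rewrite DD'.
Qed.

End Independence.
End ProbBasics.

(** * Change of coordinates *)

Section Transport.
Variables (R : realType) (I I' : choiceType).
Variables (tau : I -> I') (phi : I -> R -> R).
Hypothesis mphi : forall i, measurable_fun setT (phi i).

Definition transport (w : I' -> R) : I -> R := fun i => phi i (w (tau i)).

Lemma sig_transport (J : set I) (A : set (I -> R)) : sig J A ->
  sig (tau @` J) (transport @^-1` A).
Proof.
move: A; apply: smallest_sub; last first.
  move=> A [s [B [sJ [mB ->]]]].
  apply: (@sig_ext _ _ _ (fun w => forall i, i \in s -> B i (phi i (w (tau i))))) => //.
  elim: s sJ => [|i s IH] sJ.
    by rewrite (_ : mkset _ = setT); [exact: sigT|apply/seteqP; split].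
  apply: (@sig_ext _ _ _ (fun w => B i (phi i (w (tau i))) /\
      forall i, i \in s -> B i (phi i (w (tau i))))).
    move=> w; split=> [[Al At] j|H']; first by rewrite inE => /orP[/eqP->|/At].
    by split=> [|j jt]; apply: H'; rewrite inE ?eqxx // jt orbT.
  apply: sig_and; last by apply: IH => j js; apply: sJ; rewrite inE js orbT.
  apply: (@sig_coord _ _ _ (tau i) (phi i @^-1` B i)).
    by exists i => //; apply: sJ; rewrite inE eqxx.
  by rewrite -[X in measurable X]setTI; exact: mphi.
split.
- exact: sig0.
- by move=> A sA; rewrite setTD; exact: sigC.
- by move=> F sF; rewrite /preimage; apply: sig_bigcup.
Qed.

Lemma transport_measurable : measurable_fun setT (transport : Om R I' -> Om R I).
Proof.
move=> _ A sA; rewrite setTI; apply: sig_sub (sig_transport sA); exact: subsetT.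
Qed.

HB.instance Definition _ := isMeasurableFun.Build _ _ _ _
  (transport : Om R I' -> Om R I) transport_measurable.

Definition pushq (Q : probability (Om R I') R) : probability (Om R I) R :=
  distribution Q (transport : {mfun Om R I' >-> Om R I}).

Lemma pr_pushq (Q : probability (Om R I') R) (A : set (I -> R)) :
  pr (pushq Q) A = pr Q [set w | A (transport w)].
Proof. by []. Qed.

(** Injectivity of [tau] on [J] sends distinct coordinates to distinct, hence independent ones; both
    laws are then products with the same marginals on [J]. *)
Lemma law_transport (Q : probability (Om R I) R) (Q' : probability (Om R I') R) (J : set I) :
  indep Q -> indep Q' -> {in J &, injective tau} ->
  (forall i B, J i -> measurable B ->
    pr Q [set w | B (w i)] = pr Q' [set w | B (phi i (w (tau i)))]) ->
  forall A, sig J A -> pr Q A = pr Q' [set w | A (transport w)].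
Proof.
move=> iQ iQ' ti Heq A sA; rewrite -pr_pushq.
apply: (sig_unique _ sA) => {A sA} A [s [B [sJ [mB ->]]]].
rewrite box_undup; have us := undup_uniq s.
have {}sJ i : i \in undup s -> J i by rewrite mem_undup; exact: sJ.
move: (undup s) us sJ => {}s us sJ.
rewrite iQ // pr_pushq.
(* The condition of the unique index of [s] sent to [j], and no condition when there is none. *)
pose B' j : set R := if [seq i <- s | tau i == j] is i :: _ then phi i @^-1` B i else setT.
have B'E i : i \in s -> B' (tau i) = phi i @^-1` B i.
  move=> Hi; rewrite /B'; case E: [seq _ <- _ | _] => [|i' r].
    have : i \in [seq i0 <- s | tau i0 == tau i] by rewrite mem_filter eqxx.
    by rewrite E.
  have : i' \in [seq i0 <- s | tau i0 == tau i] by rewrite E inE eqxx.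
  rewrite mem_filter => /andP[/eqP Ht Hi'].
  by rewrite (ti i' i) // inE; exact: sJ.
have -> : [set w | box s B (transport w)] = box (map tau s) B'.
  apply/seteqP; split=> w /= H.
    by move=> _ /mapP[i Hi ->]; rewrite B'E //; exact: H.
  by move=> i Hi; have := H (tau i) (map_f _ Hi); rewrite B'E.
rewrite iQ' ?big_map; first last.
- move=> j; rewrite /B'; case: [seq _ <- _ | _] => [|i r] //.
  by rewrite -[X in measurable X]setTI; exact: mphi.
- rewrite map_inj_in_uniq // => i j Hi Hj; apply: ti; rewrite inE; exact: sJ.
rewrite !big_seq; apply: eq_bigr => i Hi; rewrite B'E //.
by apply: Heq => //; exact: sJ.
Qed.

Lemma indep_pushq (Q : probability (Om R I') R) : indep Q -> injective tau ->
  indep (pushq Q).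
Proof.
move=> iQ ti s B us mB; rewrite pr_pushq.
rewrite -[RHS](indep_blocks iQ (J := fun i => [set tau i])
  (A := fun i => [set w | B i (phi i (w (tau i)))])) //.
- by move=> i j _ _ ij; apply/seteqP; split=> // k /= [-> /ti]; move/eqP: ij.
- move=> i _; apply: (@sig_coord _ _ _ (tau i) (phi i @^-1` B i)) => //.
  by rewrite -[X in measurable X]setTI; exact: mphi.
Qed.

End Transport.

Section Marginals.
Variables (R : realType).

Lemma marg_unif (I I' : choiceType) (Q : probability (Om R I) R)
    (Q' : probability (Om R I') R) i i' :
  (forall t : R, pr Q [set w | w i <= t] = pr Q' [set w | w i' <= t]) ->
  forall B, measurable B -> pr Q [set w | B (w i)] = pr Q' [set w | B (w i')].
Proof.
move=> H B mB.
have mf (K : choiceType) (k : K) : measurable_fun setT ((fun w => w k) : Om R K -> R).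
  by move=> _ C mC; rewrite setTI; apply: sig_coord.
pose f : Om R I -> R := fun w => w i.
pose f' : Om R I' -> R := fun w => w i'.
pose F := isMeasurableFun.Build _ _ _ _ f (mf _ i).
pose F' := isMeasurableFun.Build _ _ _ _ f' (mf _ i').
pose g : {mfun Om R I >-> R} := HB.pack f F.
pose g' : {mfun Om R I' >-> R} := HB.pack f' F'.
suff : distribution Q g B = distribution Q' g' B.
  by rewrite /distribution /pushforward /pr /= => E; congr fine.
pose G := [set A : set R | exists x, A = `]x, +oo[%classic].
have H' (x : R) : distribution Q g `]x, +oo[%classic = distribution Q' g' `]x, +oo[%classic.
  have E (K : choiceType) (m : probability (Om R K) R) k :
      m [set w | `]x, +oo[%classic (w k)] = (1 - pr m [set w | w k <= x])%:E.
    have sx : sig setT [set w : K -> R | w k <= x].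
      by apply: (@sig_coord _ _ _ k [set y | y <= x]) => //; rewrite -set_itvNyc.
    rewrite -prC // -prE; last exact: sigC.
    congr (m _); apply/seteqP; split=> w /=; rewrite in_itv /= andbT ltNge; by move/negP.
  by rewrite /distribution /pushforward /= (E _ Q i) (E _ Q' i') H.
apply: (measure_unique G (fun n => `](- n%:R), +oo[%classic)) => //.
- exact: measurable_realfun.RGenOInfty.measurableE.
- move=> A A' [x ->] [y ->]; exists (Num.max x y).
  apply/seteqP; split=> z /=; rewrite !in_itv /= !andbT gt_max.
    by move=> [-> ->].
  by move=> /andP[].
- by move=> n; exists (- n%:R).
- apply/seteqP; split=> // x _; exists (Num.truncn `|x|).+1 => //=.
  by rewrite in_itv /= andbT ltrNl (le_lt_trans (ler_norm _)) // normrN truncnS_gt.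
- by move=> A [x ->]; exact: H'.
- by move=> k; rewrite -ge0_fin_numE // fin_num_measure.
Qed.

End Marginals.

(** * Poisson laws from uniform variables *)

Section Poisson.
Variables (R : realType) (lam : R).
Hypothesis lam0 : 0 < lam.

(** The probability that a Poisson variable is less than [n]. *)
Definition psum n : R := \sum_(i < n) poisson_pmf lam i.

Lemma psumS n : psum n.+1 = psum n + poisson_pmf lam n.
Proof. by rewrite /psum big_ord_recr. Qed.

Lemma psum0 : psum 0 = 0.
Proof. by rewrite /psum big_ord0. Qed.

Lemma pois_series : (\sum_(n <oo) (poisson_pmf lam n)%:E = 1)%E.
Proof.
have : poisson_prob lam 0%N setT = 1%E := probability_setT _.
rewrite /poisson_prob lam0 -nneseries_esumT //.
by move=> n; rewrite lee_fin poisson_pmf_ge0.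
Qed.

Lemma psum_cvg : psum @ \oo --> (1 : R).
Proof.
have H : (EFin \o psum) @ \oo --> 1%:E.
  have cv : cvgn (fun n => \sum_(0 <= i < n) (poisson_pmf lam i)%:E)%E.
    by apply: is_cvg_nneseries => n _ _; rewrite lee_fin poisson_pmf_ge0.
  have := pois_series => /= E; rewrite -E.
  apply: cvg_trans cv; apply: near_eq_cvg; near=> n.
  by rewrite /= /psum -sumEFin big_mkord.
by move/fine_cvg: H.
Unshelve. all: by end_near.
Qed.

Lemma psum_nd n m : (n <= m)%N -> psum n <= psum m.
Proof.
move=> /subnK <-; elim: (m - n)%N => // k IH; rewrite addSn psumS.
by apply: le_trans IH _; rewrite lerDl poisson_pmf_ge0.
Qed.

Lemma psum_le1 n : psum n <= 1.
Proof.
have <- : limn psum = 1 by apply/cvg_lim => //; exact: psum_cvg.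
apply: nondecreasing_cvgn_le; first by move=> i j; exact: psum_nd.
by apply/cvg_ex; exists (1 : R); exact: psum_cvg.
Qed.

Lemma psum_ge0 n : 0 <= psum n.
Proof. by rewrite -psum0; exact: psum_nd. Qed.

Lemma psum_eps (e : R) : 0 < e -> exists n, 1 - e < psum n.
Proof.
move=> e0; have /cvgrPdist_lt /(_ _ e0) [n _ Hn] := psum_cvg.
exists n; have := Hn n (leqnn n); rewrite /= ltr_norml ltrBlDr => /andP[_].
by rewrite ltrBlDr addrC.
Qed.

Lemma pmf0 : poisson_pmf lam 0 = expR (- lam).
Proof. by rewrite /poisson_pmf lam0 expr0 fact0 invr1 !mul1r. Qed.

Section DiscLaw.
Variables (I : choiceType) (Q : probability (Om R I) R) (g : (I -> R) -> R).
Hypothesis mg : forall B, measurable B -> sig setT [set w | B (g w)].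
Hypothesis pg : forall n : nat, pr Q [set w | g w = n%:R] = poisson_pmf lam n.

Lemma pois_law B : measurable B ->
  ((pr Q [set w | B (g w)])%:E =
   \sum_(n <oo) (if `[< B n%:R >] then poisson_pmf lam n else 0)%:E)%E.
Proof.
move=> mB.
have s1 n : sig setT [set w | g w = n%:R].
  exact: (mg (measurable_set1 (n%:R : R))).
have inj (n m : nat) w : g w = n%:R -> g w = m%:R -> n = m.
  by move=> -> /eqP; rewrite eqr_nat => /eqP.
pose O := \bigcup_n [set w | g w = n%:R].
have sO : sig setT O by exact: sig_bigcup.
have O1 : pr Q O = 1.
  apply: EFin_inj; rewrite pr_series //; last first.
    apply/trivIsetP => n m _ _ /eqP nm; apply/seteqP; split=> // w [/= a b].
    exact/nm/(inj _ _ _ a b).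
  by rewrite -pois_series; apply: eq_eseriesr => n _; rewrite pg.
pose F n := if `[< B n%:R >] then [set w | g w = n%:R] else set0.
have sF n : sig setT (F n) by rewrite /F; case: ifP => // _; exact: sig0.
transitivity ((pr Q (\bigcup_n F n))%:E).
  congr EFin; apply/eqP; rewrite eq_le; apply/andP; split.
    apply: (pr_as_le sO) => //; [exact: mg|exact: sig_bigcup|].
    by move=> w [/= Bg [n _ gn]]; exists n => //; rewrite /F asboolT // -gn.
  apply: pr_le; [exact: sig_bigcup|exact: mg|].
  by move=> w [n _]; rewrite /F; case: ifP => // /asboolP Bn /= ->.
rewrite pr_series //; last first.
  apply/trivIsetP => n m _ _ /eqP nm; apply/seteqP; split=> // w.
  rewrite /F; case: ifP => _; case: ifP => _; move=> [] //= a b.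
  exact/nm/(inj _ _ _ a b).
by apply: eq_eseriesr => n _; rewrite /F; case: ifP => _; rewrite ?pg ?pr0.
Qed.
End DiscLaw.

(** The quantile function of the Poisson law. A [u] that lies in no step of the distribution
    function gets the default [0]; the value [0] is therefore always treated through the complement
    of the positive values. *)
Definition qn (u : R) : nat :=
  xget 0%N [set n : nat | psum n < u <= psum n.+1].

Lemma psum_itv_inj u n m : psum n < u <= psum n.+1 -> psum m < u <= psum m.+1 -> n = m.
Proof.
move=> /andP[a b] /andP[c d].
apply/eqP; rewrite eqn_leq; apply/andP; split; rewrite leqNgt; apply/negP => H.
  by have := lt_le_trans a (le_trans d (psum_nd H)); rewrite ltxx.
by have := lt_le_trans c (le_trans b (psum_nd H)); rewrite ltxx.
Qed.

Lemma qnE u n : psum n < u <= psum n.+1 -> qn u = n.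
Proof.
rewrite /qn; case: xgetP => [m _ /= H1 H2|H H2]; first exact: psum_itv_inj H1 H2.
by have := H n.
Qed.

Lemma qnP u n : (0 < n)%N -> qn u = n -> psum n < u <= psum n.+1.
Proof. by rewrite /qn; case: xgetP => [m _ /= H _ <-|_ n0 E] //; rewrite -E in n0. Qed.

Lemma qn_preimS n : [set u | qn u = n.+1] = `]psum n.+1, psum n.+2]%classic.
Proof.
apply/seteqP; split=> u /=; rewrite in_itv /=; first exact: qnP.
exact: qnE.
Qed.

Lemma qn_preim0 : [set u | qn u = 0%N] = ~` \bigcup_n [set u | qn u = n.+1].
Proof.
apply/seteqP; split=> u /=; first by move=> E [n _ /=]; rewrite E.
by case E: (qn u) => [//|n] H; exfalso; apply: H; exists n.
Qed.

Lemma qn_meas n : measurable [set u | qn u = n].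
Proof.
have H m : measurable [set u | qn u = m.+1] by rewrite qn_preimS; exact: measurable_itv.
case: n => [|n] //; rewrite qn_preim0; apply: measurableC.
exact: bigcupT_measurable.
Qed.

Definition qnt (u : R) : R := (qn u)%:R.

Lemma qnt_meas : measurable_fun setT qnt.
Proof.
move=> _ B mB; rewrite setTI.
rewrite (_ : _ @^-1` _ = \bigcup_n (if `[< B n%:R >] then [set u | qn u = n] else set0)).
  apply: bigcupT_measurable => n; case: ifP => // _; exact: qn_meas.
apply/seteqP; split=> u /=.
  by move=> Bu; exists (qn u) => //; rewrite asboolT.
by move=> [n _]; case: ifP => // /asboolP Bn /= E; rewrite /qnt E.
Qed.

End Poisson.

Section Uniform.
Variables (R : realType) (I : choiceType) (Q : probability (Om R I) R) (i : I).
Hypothesis uQ : forall t, pr Q [set w | w i <= t] = Num.min (Num.max t 0) 1.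

Let sl t : sig setT [set w : I -> R | w i <= t].
Proof. by apply: (@sig_coord _ _ _ i [set y | y <= t]) => //; rewrite -set_itvNyc. Qed.

Lemma unif_le t : 0 <= t <= 1 -> pr Q [set w | w i <= t] = t.
Proof. by move=> /andP[t0 t1]; rewrite uQ (max_idPl t0) (min_idPl t1). Qed.

Lemma unif_itv a b : 0 <= a -> a <= b -> b <= 1 ->
  pr Q [set w | a < w i <= b] = b - a.
Proof.
move=> a0 ab b1.
have -> : [set w : I -> R | a < w i <= b] = [set w | w i <= b] `&` ~` [set w | w i <= a].
  apply/seteqP; split=> w /=; first by move=> /andP[h ->]; split=> //; rewrite leNgt h.
  by move=> [-> /negP]; rewrite -ltNge => ->.
have := prD Q (sl b) (sl a).
have -> : [set w : I -> R | w i <= b] `&` [set w | w i <= a] = [set w | w i <= a].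
  by apply/seteqP; split=> w /=; [case|move=> h; split=> //; exact: le_trans h ab].
rewrite !unif_le ?a0 ?b1 ?(le_trans a0) ?(le_trans ab) //.
by move/eqP; rewrite addrC -subr_eq eq_sym => /eqP.
Qed.

Lemma unif_lt t : 0 <= t <= 1 -> pr Q [set w | w i < t] = t.
Proof.
move=> /andP[t0 t1].
have st : sig setT [set w : I -> R | w i < t].
  by apply: (@sig_coord _ _ _ i [set y | y < t]) => //; rewrite -set_itvNyo.
apply/eqP; rewrite eq_le; apply/andP; split.
  rewrite -[leRHS]unif_le ?t0 //; apply: pr_le => // w /=; exact: ltW.
apply/ler_addgt0Pr => e e0; have [te|te] := leP t e.
  by apply: le_trans te _; rewrite lerDr pr_ge0.
rewrite -lerBlDr -[leLHS]unif_le; last first.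
  by rewrite subr_ge0 ltW //= (le_trans _ t1) // lerBlDr lerDl ltW.
apply: pr_le => // w /= h; apply: le_lt_trans h _.
by rewrite ltrBlDr ltrDl.
Qed.

Lemma unif_01 : pr Q [set w | 0 <= w i <= 1] = 1.
Proof.
have s0 : sig setT [set w : I -> R | w i < 0].
  by apply: (@sig_coord _ _ _ i [set y | y < 0]) => //; rewrite -set_itvNyo.
have := prD Q (sl 1) s0.
rewrite unif_le ?ler01 ?lexx //.
have -> : pr Q ([set w : I -> R | w i <= 1] `&` [set w | w i < 0]) = 0.
  apply/eqP; rewrite eq_le pr_ge0 andbT -[leRHS](@unif_lt 0) ?lexx ?ler01 //.
  by apply: pr_le => //; exact: sigI.
rewrite add0r => E; rewrite [RHS]E; congr (pr Q _); apply/seteqP; split=> w /=.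
  by move=> /andP[h ->]; split=> //; rewrite ltNge h.
by move=> [-> /negP]; rewrite -leNgt => ->.
Qed.

Lemma pois_of_unif lam (lam0 : 0 < lam) n :
  pr Q [set w | qnt lam (w i) = n%:R] = poisson_pmf lam n.
Proof.
have E (m : nat) : [set w : I -> R | qnt lam (w i) = m%:R] = [set w | qn lam (w i) = m].
  apply/seteqP; split=> w /=; last by rewrite /qnt => ->.
  by rewrite /qnt => /eqP; rewrite eqr_nat => /eqP.
have P (m : nat) : pr Q [set w | qn lam (w i) = m.+1] = poisson_pmf lam m.+1.
  have -> : [set w : I -> R | qn lam (w i) = m.+1] =
            [set w | psum lam m.+1 < w i <= psum lam m.+2].
    apply/seteqP; split=> w /=; first exact: qnP.
    exact: qnE.
  rewrite unif_itv ?psum_ge0 ?psum_le1 ?psum_nd // (psumS _ m.+1).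
  by rewrite addrAC subrr add0r.
have sm m : sig setT [set w : I -> R | qn lam (w i) = m].
  by apply: (@sig_coord _ _ _ i [set u | qn lam u = m]) => //; exact: qn_meas.
rewrite E; case: n => [|n] //.
have -> : [set w : I -> R | qn lam (w i) = 0%N] = ~` (\bigcup_n [set w | qn lam (w i) = n.+1]).
  apply/seteqP; split=> w /=; first by move=> e [n _ /=]; rewrite e.
  by case e: (qn lam (w i)) => [//|n] H; exfalso; apply: H; exists n.
rewrite prC; last exact: sig_bigcup.
have : (pr Q (\bigcup_n [set w | qn lam (w i) = n.+1]))%:E = (1 - poisson_pmf lam 0)%:E.
  rewrite pr_series //; last first.
    apply/trivIsetP => k m _ _ /eqP km; apply/seteqP; split=> // w [/= a b].
    by apply: km; move: a; rewrite b => -[].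
  rewrite (eq_eseriesr (g := fun n => (poisson_pmf lam n.+1)%:E)); last by move=> m _; rewrite P.
  rewrite EFinB -(pois_series lam0) [in RHS]nneseries_recl //; last first.
    by move=> k _; rewrite lee_fin poisson_pmf_ge0.
  rewrite [X in (X - _)%E]addeC addeK // -nneseries_addn; last first.
    by move=> k; rewrite lee_fin poisson_pmf_ge0.
  by apply: eq_eseriesr => k _; rewrite addn1.
by move=> [->]; rewrite opprB addrCA subrr addr0.
Qed.

End Uniform.

(** * The model on configuration space *)

Definition isU (i : Idx) : bool :=
  if i is inl (inl (inl (inl _))) then false else true.

Section Model.
Variable R : realType.
Local Notation Om := (Om R Idx).
Implicit Types (Q : probability Om R) (lam mu : R).

Definition model Q lam := [/\ indep Q,
  forall k (n : nat), pr Q [set w | w (iN k) = n%:R] = poisson_pmf lam n &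
  forall i t, isU i -> pr Q [set w | w i <= t] = Num.min (Num.max t 0) 1].

(** The counts are specified on the naturals only, but the Poisson masses add up to 1, so [pois_law]
    recovers the whole marginal. *)
Lemma model_unique Q Q' lam : 0 < lam -> model Q lam -> model Q' lam ->
  forall A, sig setT A -> pr Q A = pr Q' A.
Proof.
move=> l0 [iQ pQ uQ] [iQ' pQ' uQ'].
have mid (i : Idx) : measurable_fun setT ((fun _ => id) i : R -> R) by exact: measurable_id.
have := @law_transport R Idx Idx id (fun _ => id) mid Q Q' setT iQ iQ'.
move=> H A sA; rewrite (H _ _ A sA) // => {A sA} i B _ mB.
case Ui: (isU i); first by apply: marg_unif => // t; rewrite uQ ?uQ'.
case: i Ui => [[[[k|]|]|]|] // _.
have mc (C : set R) : measurable C -> sig setT [set w | C (w (iN k))].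
  by move=> mC; exact: sig_coord.
apply: EFin_inj; rewrite (pois_law l0 mc (pQ k) mB).
by rewrite (pois_law l0 mc (pQ' k) mB).
Qed.

(* Fresh counts of intensity [mu] are quantiles of [iB] variables; [tauY] moves
   the remaining [iB] variables out of their way. *)
Definition cN (k : int * int) : Idx := iB ((k, 0%N), (k, 0%N)).

Definition tauY (i : Idx) : Idx :=
  match i with
  | inl (inl (inl (inl k))) => cN k
  | inr (a, b) => iB ((a.1, a.2.+1), b)
  | _ => i
  end.

Lemma tauY_inj : injective tauY.
Proof.
move=> [[[[k|a]|e]|a]|[[a n] b]] [[[[k'|a']|e']|a']|[[a' n'] b']] //= [];
  by [move=> -> | move=> -> -> ->].
Qed.

Lemma tauY_U i : isU (tauY i).
Proof. by case: i => [[[[k|a]|e]|a]|[a b]]. Qed.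

Definition phiY mu (i : Idx) : R -> R := if isU i then id else qnt mu.

Lemma phiY_meas mu : 0 < mu -> forall i, measurable_fun setT (phiY mu i).
Proof.
by move=> m0 i; rewrite /phiY; case: isU; [exact: measurable_id|exact: qnt_meas].
Qed.

Definition Y mu (w : Idx -> R) : Idx -> R := transport tauY (phiY mu) w.

Lemma model_Y Q lam mu : model Q lam -> 0 < mu -> forall m0 : (forall i, measurable_fun setT (phiY mu i)),
  model (pushq tauY m0 Q) mu.
Proof.
move=> [iQ pQ uQ] mu0 m0; split.
- by apply: indep_pushq => //; exact: tauY_inj.
- move=> k n; rewrite pr_pushq /=.
  have u t : pr Q [set w | w (cN k) <= t] = Num.min (Num.max t 0) 1 by exact: uQ.
  by rewrite -(pois_of_unif u mu0).
- move=> i t Ui; rewrite pr_pushq -(uQ (tauY i)) ?tauY_U //; congr (pr Q _).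
  by apply/seteqP; split=> w /=; rewrite /transport /phiY Ui.
Qed.

(** Every intensity is realized over the same configurations, with the same positions and RCM edge
    variables; this is the coupling used throughout. *)
Lemma pr_Y Q lam Q' mu : model Q lam -> 0 < mu -> model Q' mu ->
  forall A, sig setT A -> pr Q' A = pr Q [set w | A (Y mu w)].
Proof.
move=> mQ mu0 mQ' A sA; rewrite -(pr_pushq tauY (phiY_meas mu0)).
exact: (model_unique mu0 mQ' (model_Y mQ mu0 _)).
Qed.

Lemma sig_Y mu J A : 0 < mu -> sig J A -> sig (tauY @` J) [set w | A (Y mu w)].
Proof. by move=> mu0; apply: sig_transport => i; exact: phiY_meas. Qed.

(* Only the edge variables of pairs normalized by [epair] are ever read. *)
Definition JG : set Idx := [set i | match i with
  | inl (inl (inl (inr _))) => True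
  | inl (inl (inr e)) => (pickle e.1 < pickle e.2)%N
  | _ => False end].

Definition tauR (s : Lab -> Lab) (i : Idx) : Idx :=
  match i with
  | inl (inl (inl (inr (a, c)))) => iX (s a) c
  | inl (inl (inr e)) => iE (epair (s e.1) (s e.2))
  | _ => i
  end.

Definition relab (s : Lab -> Lab) (w : Idx -> R) : Idx -> R := fun i => w (tauR s i).

Lemma epairC a b : epair a b = epair b a.
Proof.
rewrite /epair; case: (ltngtP (pickle a) (pickle b)) => [//|//|h].
by have -> : a = b by exact: (pcan_inj pickleK).
Qed.

Lemma epair_cases a b : epair a b = (a, b) \/ epair a b = (b, a).
Proof. by rewrite /epair; case: ifP; [left|right]. Qed.

Lemma epair_lt a b : a != b -> (pickle (epair a b).1 < pickle (epair a b).2)%N.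
Proof.
move=> ab; rewrite /epair; case: (ltngtP (pickle a) (pickle b)) => [//|//|h].
by have E : a = b by [exact: (pcan_inj pickleK)]; rewrite E eqxx in ab.
Qed.

Lemma epair_eq a b a' b' : epair a b = epair a' b' -> (a = a' /\ b = b') \/ (a = b' /\ b = a').
Proof.
case: (epair_cases a b) => ->; case: (epair_cases a' b') => -> [-> ->]; by [left|right].
Qed.

(** Relative positions and normalized edge variables are i.i.d. uniform, so an injective renaming of
    labels, even across boxes, leaves their joint law unchanged. Layers by type and the swaps in
    dense boxes both rest on this. *)
Lemma relab_law Q lam s : model Q lam -> injective s -> forall A, sig JG A ->
  pr Q A = pr Q [set w | A (relab s w)].
Proof.
move=> [iQ pQ uQ] si A sA.
have mid (i : Idx) : measurable_fun setT ((fun _ => id) i : R -> R) by exact: measurable_id.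
rewrite (@law_transport R Idx Idx (tauR s) (fun _ => id) mid Q Q JG iQ iQ) //.
- move=> i j; rewrite !inE.
  move: i j => [[[[k|[a c]]|e]|a]|e] [[[[k'|[a' c']]|e']|a']|e'] //=.
    by move=> _ _ [/si -> ->].
  move: e e' => [a b] [a' b'] /= ab ab' [/epair_eq [] [/si Ea /si Eb]].
    by rewrite Ea Eb.
  by move: ab'; rewrite -Ea -Eb ltnNge ltnW.
- move=> i B Ji mB; apply: marg_unif => // t; rewrite !uQ //.
    by move: i Ji => [[[[k|[a c]]|e]|a]|e].
  by move: i Ji => [[[[k|[a c]]|e]|a]|e].
Qed.

End Model.

(** * Between random variables and laws on configurations *)

Section FromRV.
Variables (R : realType) (d : measure_display) (T : measurableType d).
Variables (P : probability T R) (X : Idx -> {RV P >-> R}).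

Definition Xv (t : T) : Om R Idx := fun i => X i t.

Lemma Xv_meas : measurable_fun setT Xv.
Proof.
move=> _ A sA; rewrite setTI; move: A sA; apply: smallest_sub.
  split.
  - by rewrite preimage_set0.
  - by move=> A mA; rewrite setTD; exact: measurableC.
  - by move=> F mF; rewrite preimage_bigcup; exact: bigcupT_measurable.
move=> A [s [B [_ [mB ->]]]].
rewrite (_ : _ @^-1` _ = \bigcap_(i in [set` s]) (X i @^-1` B i)).
  apply: fin_bigcap_measurable => // i _; rewrite -[X in measurable X]setTI.
  exact: measurable_funP.
by apply/seteqP; split=> t /= H i; exact: H.
Qed.

HB.instance Definition _ := isMeasurableFun.Build _ _ _ _ Xv Xv_meas.

Definition lawX : probability (Om R Idx) R := distribution P (Xv : {mfun T >-> Om R Idx}).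

Lemma lawXE A : sig setT A -> P [set t | A (fun i => X i t)] = (pr lawX A)%:E.
Proof. by move=> sA; rewrite -prE. Qed.

Lemma pr_lawX A : pr lawX A = fine (P [set t | A (fun i => X i t)]).
Proof. by []. Qed.

Lemma rcm_model_law lam : rcm_model X lam -> model lawX lam.
Proof.
move=> [iX' [pX [uXx [uE [uS uB]]]]]; split.
- move=> s B us mB; rewrite pr_lawX.
  have -> : [set t | box s B (fun i => X i t)] =
            \big[setI/setT]_(i <- s) (X i @^-1` B i).
    rewrite -bigcap_seq; apply/seteqP; split=> t /= H i; exact: H.
  rewrite iX' //; elim: s us => [|i s IH] us; first by rewrite !big_nil.
  rewrite !big_cons fineM ?IH //; last first.
  + rewrite -iX' //; last by move: us => /= /andP[].
    by rewrite fin_num_measure //; apply: bigsetI_measurable => j _;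
      rewrite -[X in measurable X]setTI; exact: measurable_funP.
  + by rewrite fin_num_measure // -[X in measurable X]setTI; exact: measurable_funP.
  by move: us => /= /andP[].
- by move=> k n; rewrite pr_lawX -[RHS]/(fine (poisson_pmf lam n)%:E) -(pX k n).
- move=> i t; rewrite pr_lawX.
  move: i => [[[[k|[a c]]|e]|a]|e] // _.
  + by have := uXx a c t; rewrite /preimage /= => ->.
  + by have := uE e t; rewrite /preimage /= => ->.
  + by have := uS a t; rewrite /preimage /= => ->.
  + by have := uB e t; rewrite /preimage /= => ->.
Qed.

Lemma rcm_model_of lam : model lawX lam -> rcm_model X lam.
Proof.
move=> [iQ pQ uQ].
have sl (i : Idx) (B : set R) : measurable B -> P (X i @^-1` B) = (pr lawX [set w | B (w i)])%:E.
  by move=> mB; rewrite -lawXE //; exact: sig_coord.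
have su i (t : R) : isU i -> P (X i @^-1` [set x | x <= t]) = (Num.min (Num.max t 0) 1)%:E.
  by move=> Ui; rewrite sl ?uQ // -set_itvNyc.
split; last first.
  split; first by move=> k n; rewrite sl ?pQ.
  split; first by move=> a c t; exact: su.
  split; first by move=> e t; exact: su.
  by split=> [a|e] t; exact: su.
move=> s B us mB.
have -> : \big[setI/setT]_(i <- s) (X i @^-1` B i) = [set t | box s B (fun i => X i t)].
  rewrite -bigcap_seq; apply/seteqP; split=> t /= H i; exact: H.
rewrite lawXE ?iQ //; last exact: sig_box.
elim: s {us} => [|i s IH]; first by rewrite !big_nil.
by rewrite !big_cons -IH EFinM sl.
Qed.

End FromRV.

Section BuildModel.
Variables (R : realType) (d : measure_display) (T : measurableType d).
Variables (P : probability T R) (X : Idx -> {RV P >-> R}).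

(** Puts a model of intensity [mu] on the given probability space, which answers the existential
    quantifiers in [lambda_crit]. *)
Lemma build_model lam mu : rcm_model X lam -> 0 < mu ->
  exists Z : Idx -> {RV P >-> R}, rcm_model Z mu /\
    forall t, (fun i => Z i t) = Y mu (fun i => X i t).
Proof.
move=> rX mu0.
have mZ i : measurable_fun setT (phiY mu i \o X (tauY i)).
  by apply: measurableT_comp => //; exact: phiY_meas.
pose Z i : {RV P >-> R} := HB.pack (phiY mu i \o X (tauY i))
   (isMeasurableFun.Build _ _ _ _ (phiY mu i \o X (tauY i)) (mZ i)).
exists Z; split=> [|t]; last by apply/funext.
apply: rcm_model_of.
have [iQ pQ uQ] := model_Y (rcm_model_law rX) mu0 (phiY_meas mu0).
have E A : pr (lawX Z) A = pr (pushq tauY (phiY_meas mu0) (lawX X)) A by [].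
by split.
Qed.

End BuildModel.

(** * Reaching far boxes *)

Local Notation crt := (clos_refl_trans Lab).

Definition bdist (k k' : int * int) : nat :=
  maxn `|k.1 - k'.1|%N `|k.2 - k'.2|%N.

Lemma bdistC k k' : bdist k k' = bdist k' k.
Proof. by rewrite /bdist; lia. Qed.

Lemma bdist_tri k k' k'' : (bdist k k'' <= bdist k k' + bdist k' k'')%N.
Proof. rewrite /bdist; lia. Qed.

Lemma bdistxx k : bdist k k = 0%N.
Proof. rewrite /bdist; lia. Qed.

Definition irange (n : nat) : seq int := [seq i%:Z - n%:Z | i <- iota 0 n.*2.+1].

Lemma mem_irange n (x : int) : (x \in irange n) = (`|x| <= n)%N.
Proof.
apply/mapP/idP => [[i]|H].
  by rewrite mem_iota => Hi ->; lia.
exists (absz (x + n%:Z)); last by lia.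
by rewrite mem_iota; lia.
Qed.

Lemma irange_uniq n : uniq (irange n).
Proof. by rewrite map_inj_uniq ?iota_uniq // => i j; lia. Qed.

Definition window (k : int * int) (n : nat) : seq (int * int) :=
  [seq (k.1 + p.1, k.2 + p.2) | p <- [seq (i, j) | i <- irange n, j <- irange n]].

Lemma mem_window k n k' : (k' \in window k n) = (bdist k k' <= n)%N.
Proof.
apply/mapP/idP => [[p]|H].
  case/allpairsP => -[i j] [/=]; rewrite !mem_irange => Hi Hj -> ->.
  by rewrite /bdist /=; lia.
exists (k'.1 - k.1, k'.2 - k.2); last by case: k' {H} => a b /=; congr pair; lia.
apply/allpairsP; exists (k'.1 - k.1, k'.2 - k.2); rewrite !mem_irange /=.
by move: H; rewrite /bdist; split=> //; lia.
Qed.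

Lemma window_uniq k n : uniq (window k n).
Proof.
rewrite map_inj_uniq; first by apply: allpairs_uniq; rewrite ?irange_uniq // => -[a b] [c e].
by move=> [a b] [c e] /= [] ? ?; congr pair; lia.
Qed.

Lemma size_window k n : size (window k n) = (n.*2.+1 ^ 2)%N.
Proof. by rewrite size_map size_allpairs size_map size_iota mulnn. Qed.

Section Chains.
Variable L : Type.
Fixpoint chain (r : L -> L -> Prop) (a : L) (p : seq L) : Prop :=
  if p is x :: q then r a x /\ chain r x q else True.

Lemma crt_chain r a b : clos_refl_trans L r a b <->
  exists p, chain r a p /\ last a p = b.
Proof.
split.
  elim=> {a b} [a b ab|a|a b c _ [p [cp lp]] _ [q [cq lq]]].
  - by exists [:: b].
  - by exists [::].
  - exists (p ++ q); rewrite last_cat lp; split=> //.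
    elim: p a cp lp => [a _ /= ->//|x p IH a /= [ax cp] lp]; split=> //.
    exact: IH.
move=> [p [cp <-]]; elim: p a cp => [a _|x p IH a /= [ax cp]]; first exact: rt_refl.
by apply: (rt_trans _ _ _ x); [exact: rt_step|exact: IH].
Qed.

Lemma crt_sub (r r' : L -> L -> Prop) a b : (forall x y, r x y -> r' x y) ->
  clos_refl_trans L r a b -> clos_refl_trans L r' a b.
Proof.
move=> rr'; elim=> {a b} [a b /rr'|a|a b c _ H _ H']; first exact: rt_step.
  exact: rt_refl.
exact: rt_trans H H'.
Qed.

Lemma crt_sym (r : L -> L -> Prop) a b : (forall x y, r x y -> r y x) ->
  clos_refl_trans L r a b -> clos_refl_trans L r b a.
Proof.
move=> rr; elim=> {a b} [a b /rr|a|a b c _ H _ H']; first exact: rt_step.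
  exact: rt_refl.
exact: rt_trans H' H.
Qed.

Lemma crt_ind_l (r : L -> L -> Prop) (S : L -> Prop) a b : S a ->
  (forall x y, S x -> r x y -> S y) -> clos_refl_trans L r a b -> S b.
Proof.
move=> Sa St H; elim: H Sa => {a b} [a b ab Sa|//|a b c _ H1 _ H2 Sa]; first exact: St ab.
exact/H2/H1.
Qed.
End Chains.

Definition reach (V : set Lab) (E : Lab -> Lab -> Prop) (A B : set Lab) : Prop :=
  exists a b, [/\ A a, V a, B b & crt (gedge V E) a b].

Definition inbox (k : int * int) : set Lab := [set a | a.1 = k].
Definition far (k : int * int) (n : nat) : set Lab := [set a | (n <= bdist k a.1)%N].

Lemma reach_sub V E V' E' A B B' : V `<=` V' ->
  (forall a b, V a -> V b -> E a b -> E' a b) -> B `<=` B' ->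
  reach V E A B -> reach V' E' A B'.
Proof.
move=> VV EE BB [a [b [Aa Va Bb H]]]; exists a, b; split; [by []|exact: VV|exact: BB|].
apply: crt_sub H => x y [Vx [Vy Exy]]; split; first exact: VV.
by split; [exact: VV|exact: EE].
Qed.

Lemma gedge_V (V : set Lab) E a b : V a -> crt (gedge V E) a b -> V b.
Proof. by move=> Va; apply: crt_ind_l => // x y _ [_ [Vy _]]. Qed.

Section Config.
Variables (R : realType) (f : R -> R).
Implicit Types (w : Idx -> R) (a b : Lab).

Definition vertw w : set Lab := [set a | (a.2)%:R < w (iN a.1)].
Definition xw a w : R := (a.1.1)%:~R + w (iX a false).
Definition yw a w : R := (a.1.2)%:~R + w (iX a true).
Definition distw a b w : R :=
  Num.sqrt ((xw a w - xw b w) ^+ 2 + (yw a w - yw b w) ^+ 2).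
Definition geo w a b : Prop := a <> b /\ w (iE (epair a b)) < f (distw a b w).
Definition adjw w a b : Prop := vertw w a /\ vertw w b /\ geo w a b.

Lemma distwC a b w : distw a b w = distw b a w.
Proof. by rewrite /distw -sqrrN opprB -[(yw a w - _) ^+ 2]sqrrN opprB. Qed.

Lemma geoC w a b : geo w a b -> geo w b a.
Proof. by move=> [ab H]; split=> [/esym//|]; rewrite epairC distwC. Qed.

Lemma ex_nN (x : R) : exists n : nat, x <= n%:R.
Proof. by exists (Num.truncn x).+1; apply/ltW; exact: truncnS_gt. Qed.

(** The number of naturals below [x], meaningful for every real [x]: the count variables are
    integers only almost surely. *)
Definition nNx (x : R) : nat := ex_minn (ex_nN x).
Definition nN w k : nat := nNx (w (iN k)).

Lemma nNxP x i : (i < nNx x)%N = (i%:R < x).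
Proof.
rewrite /nNx; case: ex_minnP => m Hm min; apply/idP/idP => H.
  by rewrite ltNge; apply/negP => /min; rewrite leqNgt H.
by rewrite -(ltr_nat R); exact: lt_le_trans H Hm.
Qed.

Lemma vertwE w a : vertw w a <-> (a.2 < nN w a.1)%N.
Proof. by rewrite /vertw /= -nNxP. Qed.

Lemma nNx_nat n : nNx n%:R = n.
Proof.
by apply/eqP; rewrite eqn_leq leqNgt nNxP ltxx /= leqNgt; apply/negP;
  rewrite -(ltr_nat R) => H; have := ltnn (nNx n%:R); rewrite nNxP H.
Qed.

Lemma nNx_meas n : measurable [set x | nNx x = n].
Proof.
have E m : [set x : R | (m < nNx x)%N] = `]m%:R, +oo[%classic.
  by apply/seteqP; split=> x /=; rewrite in_itv /= andbT nNxP.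
have H m : measurable [set x : R | (m < nNx x)%N] by rewrite E; exact: measurable_itv.
case: n => [|n].
  rewrite (_ : mkset _ = ~` [set x | (0 < nNx x)%N]); first exact: measurableC.
  by apply/seteqP; split=> x /=; lia.
rewrite (_ : mkset _ = [set x | (n < nNx x)%N] `&` ~` [set x | (n.+1 < nNx x)%N]).
  by apply: measurableI => //; exact: measurableC.
by apply/seteqP; split=> x /=; lia.
Qed.

Lemma disc_nN (J : set Idx) k : J (iN k) -> disc J (fun w => nN w k).
Proof. by move=> Jk n; apply: (@sig_coord _ _ _ (iN k) [set x | nNx x = n]) => //; exact: nNx_meas. Qed.

Lemma pr_nN (Q : probability (Om R Idx) R) lam (lam0 : 0 < lam) : model Q lam -> forall k n,
  pr Q [set w | nN w k = n] = poisson_pmf lam n.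
Proof.
move=> [_ pQ _] k n; apply: EFin_inj.
have mc (C : set R) : measurable C -> sig setT [set w : Idx -> R | C (w (iN k))].
  by move=> mC; exact: sig_coord.
rewrite (pois_law lam0 mc (pQ k) (nNx_meas n)).
rewrite (nneseriesD1 (n := n)) //; last first.
  by move=> m _; rewrite lee_fin; case: ifP => // _; exact: poisson_pmf_ge0.
rewrite /= asboolT ?nNx_nat // eseries0 ?adde0 // => m _ /= mn.
by rewrite asboolF // nNx_nat; move/eqP: mn.
Qed.

Lemma sig_vert (J : set Idx) a : J (iN a.1) -> sig J [set w | vertw w a].
Proof.
move=> Ja; apply: (@sig_ext _ _ _ (fun w => (a.2 < nN w a.1)%N)).
  by move=> w; rewrite vertwE.
by apply: (disc_pred (Q := fun n _ => (a.2 < n)%N) (disc_nN Ja)) => n; exact: sig_cst.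
Qed.

Hypothesis fdec : forall s t : R, 0 <= s -> s <= t -> f t <= f s.

Lemma sig_geo_gen (J : set Idx) a b : (forall c, J (iX a c)) -> (forall c, J (iX b c)) ->
  (a != b -> J (iE (epair a b))) -> sig J [set w | geo w a b].
Proof.
move=> Ja Jb Jab; have [->|ab] := eqVneq a b.
  by apply: (@sig_ext _ _ _ (fun _ => False)); [move=> w; split=> // -[]|exact: sig_cst].
pose TJ := g_sigma_algebraType (@cyl R Idx J).
have mc i : J i -> measurable_fun setT ((fun w => w i) : TJ -> R).
  by move=> Ji _ B mB; rewrite setTI; exact: sig_coord.
(* Monotonicity of [f] is known on nonnegative reals only. Since [Num.sqrt] is [0] on negative
   reals, [h] is monotone on the whole line, hence measurable. *)
pose h (s : R) := f (Num.sqrt s).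
have mh : measurable_fun setT h.
  apply: nonincreasing_measurable => // s t st.
  by apply: fdec; rewrite ?sqrtr_ge0 // ler_wsqrtr.
pose S (w : TJ) := (xw a w - xw b w) ^+ 2 + (yw a w - yw b w) ^+ 2.
have mS : measurable_fun setT S.
  by apply: measurable_funD; apply: measurable_funX; apply: measurable_funB;
    apply: measurable_funD; do ?exact: measurable_cst; exact: mc.
have me : measurable_fun setT ((fun w => w (iE (epair a b))) : TJ -> R).
  by apply: mc; exact: Jab.
have mhS : measurable_fun setT (h \o S) by exact: measurableT_comp.
have : measurable [set w : TJ | w (iE (epair a b)) < (h \o S) w].
  have := measurable_fun_ltr me mhS => /(_ measurableT [set true]).
  by rewrite setTI; apply.
by apply: sig_ext => w; split=> [H|[]] //; split=> //; exact/eqP.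
Qed.

Lemma sig_geo a b : sig JG [set w | geo w a b].
Proof. by apply: sig_geo_gen => // ab; exact: epair_lt. Qed.

Lemma sig_crt (L : countType) (J : set Idx) (r : (Idx -> R) -> L -> L -> Prop) (a b : L) :
  (forall x y, sig J [set w | r w x y]) -> sig J [set w | clos_refl_trans L (r w) a b].
Proof.
move=> sr; apply: (@sig_ext _ _ _ (fun w => exists p, chain (r w) a p /\ last a p = b)).
  by move=> w; rewrite crt_chain.
apply: sig_ex => p; apply: sig_and; last exact: sig_cst.
by elim: p a => [a|x p IH a] /=; [exact: sig_cst|apply: sig_and].
Qed.

Lemma sig_reach (J : set Idx) (V : (Idx -> R) -> set Lab) E A B :
  (forall x, sig J [set w | V w x]) -> (forall x y, sig J [set w | E w x y]) ->
  sig J [set w | reach (V w) (E w) A B].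
Proof.
move=> sV sE; apply: sig_ex => a; apply: sig_ex => b.
apply: (@sig_ext _ _ _ (fun w => (A a /\ V w a) /\ (B b /\ crt (gedge (V w) (E w)) a b))).
  by move=> w; split=> [[[? ?] [? ?]]|[? ? ? ?]].
apply: sig_and; apply: sig_and => //; do ?exact: sig_cst.
by apply: sig_crt => x y; rewrite /gedge; do !apply: sig_and.
Qed.

Definition labs w (k : int * int) : seq Lab := [seq (k, i) | i <- iota 0 (nN w k)].

Lemma mem_labs w k a : a \in labs w k <-> a.1 = k /\ vertw w a.
Proof.
rewrite vertwE; split=> [/mapP[i]|].
  by rewrite mem_iota => Hi ->.
case: a => k' i /= [<- Hi]; apply/mapP; exists i => //; by rewrite mem_iota.
Qed.

(** A box holds finitely many vertices. An infinite cluster therefore leaves every window;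
    conversely, if all clusters were finite, those meeting box [k] would have a common bound. *)
Lemma inf_reach w (V : set Lab) E : V `<=` vertw w ->
  (has_infinite_cluster V E <->
   exists k, forall n, reach V E (inbox k) (far k n)).
Proof.
move=> Vv; split.
  move=> [u [Vu inf]]; exists u.1 => n; apply: contrapT => nr; apply: inf.
  apply: (@sub_finite_set _ _ [set` flatten [seq labs w k | k <- window u.1 n]]); last exact: finite_seq.
  move=> b [_ ub]; suff : b \in flatten [seq labs w k | k <- window u.1 n] by [].
  apply/flattenP; exists (labs w b.1); last first.
    by apply/mem_labs; split=> //; apply: Vv; exact: gedge_V ub.
  apply: map_f; rewrite mem_window leqNgt; apply/negP => H; apply: nr.
  by exists u, b; split=> //; rewrite /far /=; exact: ltnW.
move=> [k H]; apply: contrapT => nI.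
have bnd a : exists n : nat, forall b, V a -> crt (gedge V E) a b -> (bdist k b.1 < n)%N.
  have [Va|nV] := pselect (V a); last by exists 0%N => b /nV.
  have fin : finite_set (cluster V E a) by apply: contrapT => nf; apply: nI; exists a.
  have /finite_seqP[s Hs] := fin.
  exists (\max_(b <- s) bdist k b.1).+1 => b _ ab; rewrite ltnS.
  have bs : b \in s.
    have : (cluster V E a) b by [].
    by rewrite Hs.
  by rewrite (big_rem b bs) /= leq_maxl.
have [g Hg] := choice bnd.
have [a [b [ka Va fb ab]]] := H (\max_(a <- labs w k) g a).
have aL : a \in labs w k by apply/mem_labs; split=> //; exact: Vv.
have := Hg a b Va ab; rewrite ltnNge => /negP; apply.
by apply: leq_trans fb; rewrite (big_rem a aL) /= leq_maxl.
Qed.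

Definition Cinfw w : set Lab :=
  [set a | vertw w a /\ ~ finite_set (cluster (vertw w) (adjw w) a)].

Lemma adjwC w a b : adjw w a b -> adjw w b a.
Proof. by move=> [va [vb g]]; split=> //; split=> //; exact: geoC. Qed.

Lemma adjw_geo w a b : vertw w a -> vertw w b -> adjw w a b <-> geo w a b.
Proof. by move=> va vb; split=> [[_ []]|]. Qed.

(** An infinite cluster of the subgraph lies inside an infinite cluster of the whole graph, so
    restricting to [Cinfw] removes none of its vertices. Percolation on the infinite component thus
    becomes percolation on all Poisson points. *)
Lemma inf_Cinf w (V : set Lab) E : V `<=` vertw w -> (forall a b, E a b -> adjw w a b) ->
  (has_infinite_cluster [set a | Cinfw w a /\ V a] E <-> has_infinite_cluster V E).
Proof.
move=> Vv Ea; split=> -[u [Vu inf]].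
  exists u; split; first by case: Vu.
  move=> fin; apply: inf; apply: sub_finite_set fin => b [[_ Vu'] H]; split=> //.
  by apply: crt_sub H => x y [[_ ?] [[_ ?] ?]].
have up x y : crt (gedge V E) x y -> crt (gedge (vertw w) (adjw w)) x y.
  by apply: crt_sub => ? ? [? [? /Ea ?]]; split; [exact: Vv|split=> //; exact: Vv].
have C b : crt (gedge V E) u b -> Cinfw w b /\ V b.
  move=> ub; have Vb := gedge_V Vu ub; split=> //; split; first exact: Vv.
  move=> fin; apply: inf; apply: sub_finite_set fin => c [_ uc]; split; first exact: Vv.
  apply: rt_trans (up _ _ uc); apply: crt_sym (up _ _ ub) => x y [? [? ?]].
  by split=> //; split=> //; exact: adjwC.
have Cu := C u (rt_refl _ _ _).
exists u; split=> // fin; apply: inf; apply: sub_finite_set fin => b [_ ub]; split=> //.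
move/crt_chain: ub => [p [cp lp]]; apply/crt_chain; exists p; split=> //.
suff G v q : crt (gedge V E) u v -> chain (gedge V E) v q ->
    chain (gedge [set a | Cinfw w a /\ V a] E) v q by apply: G cp; exact: rt_refl.
elim: q v {cp lp} => [//|x q IH v uv /= [vx cp]].
have ux : crt (gedge V E) u x by apply: rt_trans uv _; exact: rt_step.
split; last exact: IH.
by case: vx => [_ [_ Evx]]; split; [exact: C|split=> //; exact: C].
Qed.

Definition Rc w k n := reach (vertw w) (geo w) (inbox k) (far k n).
Definition Rs p w k n :=
  reach [set a | vertw w a /\ w (iS a) < p] (geo w) (inbox k) (far k n).
Definition Rb p w k n :=
  reach (vertw w) (fun a b => geo w a b /\ w (iB (epair a b)) < p) (inbox k) (far k n).

Lemma has_inf_ext L (V : set L) (E E' : L -> L -> Prop) :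
  (forall x y, V x -> V y -> E x y <-> E' x y) ->
  has_infinite_cluster V E -> has_infinite_cluster V E'.
Proof.
move=> EE [u [Vu inf]]; exists u; split=> // fin; apply: inf.
apply: sub_finite_set fin => b [_ ub]; split=> //; apply: crt_sub ub => x y [Vx [Vy]].
by move=> Exy; split=> //; split=> //; apply/EE.
Qed.

Lemma rcm_perc_w w : has_infinite_cluster (vertw w) (adjw w) <-> exists k, forall n, Rc w k n.
Proof.
rewrite -(inf_reach (geo w) (@subset_refl _ (vertw w))).
by split; apply: has_inf_ext => a b va vb; rewrite adjw_geo.
Qed.

Lemma site_perc_w p w :
  has_infinite_cluster [set a | Cinfw w a /\ w (iS a) < p] (adjw w) <->
  exists k, forall n, Rs p w k n.
Proof.
have Vv : [set a | vertw w a /\ w (iS a) < p] `<=` vertw w by move=> a [].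
rewrite -(inf_reach (geo w) Vv).
rewrite (_ : [set a | Cinfw w a /\ _] = [set a | Cinfw w a /\ [set a | vertw w a /\ w (iS a) < p] a]).
  rewrite inf_Cinf //.
  by split; apply: has_inf_ext => a b [? ?] [? ?]; rewrite adjw_geo.
by apply/seteqP; split=> a /= => [[[? ?] ?]|[? []]]; split.
Qed.

Lemma bond_perc_w p w :
  has_infinite_cluster (Cinfw w) (fun a b => adjw w a b /\ w (iB (epair a b)) < p) <->
  exists k, forall n, Rb p w k n.
Proof.
rewrite -(inf_reach _ (@subset_refl _ (vertw w))).
rewrite (_ : Cinfw w = [set a | Cinfw w a /\ vertw w a]).
  rewrite inf_Cinf //; last by move=> a b [].
  by split; apply: has_inf_ext => a b va vb; rewrite adjw_geo.
by apply/seteqP; split=> a /= => [[? ?]|[]].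
Qed.

Lemma sig_Rc k n : sig setT [set w | Rc w k n].
Proof.
apply: sig_reach => [x|x y]; first exact: sig_vert.
exact: sig_sub (sig_geo x y).
Qed.

Lemma sig_Rs p k n : sig setT [set w | Rs p w k n].
Proof.
apply: sig_reach => [x|x y]; last exact: sig_sub (sig_geo x y).
apply: sig_and; first exact: sig_vert.
by apply: (@sig_coord _ _ _ (iS x) [set y | y < p]) => //; rewrite -set_itvNyo.
Qed.

Lemma sig_Rb p k n : sig setT [set w | Rb p w k n].
Proof.
apply: sig_reach => [x|x y]; first exact: sig_vert.
apply: sig_and; first exact: sig_sub (sig_geo x y).
by apply: (@sig_coord _ _ _ (iB (epair x y)) [set y | y < p]) => //; rewrite -set_itvNyo.
Qed.

End Config.

(** * Threshold growth inside bond percolation *)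

Section Growth.
Implicit Types (E O : seq (Lab * Lab)) (S : set Lab) (th : Lab -> nat) (x y z : Lab).

Inductive und O S : Lab -> Prop :=
| und0 x : S x -> und O S x
| undS x y : und O S x -> epair x y \in O -> und O S y.

(** No rule applies to thresholds other than 1 and 2: such a vertex is active only as a seed. *)
Inductive thr th E S : Lab -> Prop :=
| thr0 x : S x -> thr th E S x
| thr1 x y : thr th E S x -> th y = 1%N -> epair x y \in E -> thr th E S y
| thr2 x x' y : thr th E S x -> thr th E S x' -> x <> x' -> th y = 2%N ->
    epair x y \in E -> epair x' y \in E -> thr th E S y.

Definition hits (B : set Lab) (S : Lab -> Prop) := exists x, S x /\ B x.

Lemma hits_sub B (S S' : Lab -> Prop) : (forall x, S x -> S' x) -> hits B S -> hits B S'.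
Proof. by move=> SS [x [Sx Bx]]; exists x; split=> //; exact: SS. Qed.

Lemma und_sub O O' S S' z : {subset O <= O'} -> S `<=` S' -> und O S z -> und O' S' z.
Proof.
move=> OO SS; elim=> [x /SS|x y _ H /OO]; first exact: und0.
exact: undS.
Qed.

Definition add1 S y : set Lab := [set z | S z \/ z = y].
Definition upd th y n : Lab -> nat := fun z => if z == y then n else th z.

Section Step.
Variables (E : seq (Lab * Lab)) (S : set Lab) (x y : Lab).
Hypothesis Sx : S x.
Hypothesis nSy : ~ S y.
Let e := epair x y.
Let E' := [seq e' <- E | e' != e].

Lemma und_stepR O O' z : {subset O' <= O} -> e \in O ->
  und O' (add1 S y) z -> und O S z.
Proof.
move=> OO eO; elim=> [u [Su|->]|u v _ H /OO]; first exact: und0.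
  by apply: (@undS _ _ x) => //; exact: und0.
exact: undS.
Qed.

Let xy : x <> y. Proof. by move=> h; apply: nSy; rewrite -h. Qed.

Let edgeE u v : epair u v \in E -> epair u v \in E' \/ (u = x /\ v = y) \/ (u = y /\ v = x).
Proof.
move=> uv; have [ee|ee] := eqVneq (epair u v) e; last by left; rewrite mem_filter ee.
by right; exact: epair_eq ee.
Qed.

(** Once [y] is a seed, both ends of [e] are seeds and the edge has nothing left to do. *)
Lemma thr_step1 th z : thr th E S z -> thr th E' (add1 S y) z.
Proof.
elim=> [u Su|u v _ H tv /edgeE|u u' v _ H _ H' uu' tv /edgeE].
- by apply: thr0; left.
- move=> [uv|[[_ ->]|[_ ->]]]; first exact: thr1 uv.
    by apply: thr0; right.
  by apply: thr0; left.
- move=> [uv|[[_ ->]|[_ ->]]]; last 2 first.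
    by move=> _; apply: thr0; right.
  by move=> _; apply: thr0; left.
  move=> /edgeE [u'v|[[_ ->]|[_ ->]]]; first exact: thr2 uu' tv uv u'v.
    by apply: thr0; right.
  by apply: thr0; left.
Qed.

(** The seed [x] already provides one of the two neighbours that [y] needs; as [thr2] asks for
    distinct neighbours, the other one comes through an edge different from [e]. *)
Lemma thr_step2 th z : th y = 2%N -> thr th E S z -> thr (upd th y 1) E' S z.
Proof.
move=> ty; elim=> [u Su|u v _ H tv /edgeE|u u' v _ H _ H' uu' tv uv u'v].
- exact: thr0.
- have nvy : v != y by apply/eqP => h; move: tv; rewrite h ty.
  move=> [uv|[[_ h]|[_ ->]]]; last exact: thr0; last by rewrite h eqxx in nvy.
  by apply: thr1 H _ uv; rewrite /upd (negbTE nvy).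
have [vy|nvy] := eqVneq v y.
  have upy : upd th y 1 v = 1%N by rewrite /upd vy eqxx.
  case/edgeE: uv => [uv|[[ux _]|[_ vx]]]; first exact: thr1 H upy uv.
    case/edgeE: u'v => [u'v|[[u'x _]|[_ vx]]]; first exact: thr1 H' upy u'v.
      by case: uu'; rewrite ux u'x.
    by case: xy; rewrite -vx vy.
  by case: xy; rewrite -vx vy.
have upv : upd th y 1 v = 2%N by rewrite /upd (negbTE nvy).
case/edgeE: uv => [uv|[[_ h]|[_ ->]]]; last exact: thr0; last by rewrite h eqxx in nvy.
case/edgeE: u'v => [u'v|[[_ h]|[_ ->]]]; last exact: thr0; last by rewrite h eqxx in nvy.
exact: thr2 H H' uu' upv uv u'v.
Qed.

Lemma thr_step0 th z : th y = 0%N -> thr th E S z -> thr th E' S z.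
Proof.
move=> ty; elim=> [u Su|u v _ H tv /edgeE|u u' v _ H _ H' uu' tv uv u'v].
- exact: thr0.
- have nvy : v != y by apply/eqP => h; move: tv; rewrite h ty.
  move=> [uv|[[_ h]|[_ ->]]]; last exact: thr0; last by rewrite h eqxx in nvy.
  exact: thr1 H tv uv.
have nvy : v != y by apply/eqP => h; move: tv; rewrite h ty.
case/edgeE: uv => [uv|[[_ h]|[_ ->]]]; last exact: thr0; last by rewrite h eqxx in nvy.
case/edgeE: u'v => [u'v|[[_ h]|[_ ->]]]; last exact: thr0; last by rewrite h eqxx in nvy.
exact: thr2 H H' uu' tv uv u'v.
Qed.

End Step.

Lemma thr_root th th' E S y z : S y -> (forall v, v != y -> th v = th' v) ->
  thr th E S z -> thr th' E S z.
Proof.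
move=> Sy tt; elim=> [u Su|u v _ H tv uv|u u' v _ H _ H' uu' tv uv u'v].
- exact: thr0.
- have [->|vy] := eqVneq v y; first exact: thr0.
  by apply: thr1 H _ uv; rewrite -tt.
- have [->|vy] := eqVneq v y; first exact: thr0.
  by apply: thr2 H H' uu' _ uv u'v; rewrite -tt.
Qed.

Lemma thr_stuck th E S z : (forall x y, S x -> epair x y \in E -> S y) ->
  thr th E S z -> S z.
Proof.
move=> st; elim=> [u //|u v _ Su _ uv|u u' v _ Su _ _ _ _ uv _]; exact: st uv.
Qed.

End Growth.

Section Comparison.
Variables (R : realType) (Q : probability (Om R Idx) R).
Hypothesis iQ : indep Q.
Hypothesis uQ : forall i t, isU i -> pr Q [set w | w i <= t] = Num.min (Num.max t 0) 1.
Variables (p : R) (B : set Lab).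
Hypothesis p01 : 0 <= p < 1.

Definition level (a b u : R) : nat := if u < a then 1%N else if u < a + b then 2%N else 0%N.

(** Written as a lookup in a finite list, so that it is discrete data; vertices outside [vs] get
    threshold [0]. *)
Definition theta (vs : seq Lab) (a b : Lab -> R) (w : Idx -> R) : Lab -> nat :=
  fun y => nth 0%N [seq level (a y) (b y) (w (iS y)) | y <- vs] (index y vs).

Lemma thetaE vs a b w y :
  theta vs a b w y = if y \in vs then level (a y) (b y) (w (iS y)) else 0%N.
Proof.
rewrite /theta; case: ifP => Hy; last first.
  by rewrite nth_default // size_map; rewrite -index_mem in Hy; rewrite leqNgt Hy.
by rewrite (nth_map y) ?index_mem // nth_index.
Qed.

Definition openE (E : seq (Lab * Lab)) (w : Idx -> R) := [seq e <- E | w (iB e) < p].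

Lemma sig_lt (J : set Idx) i (t : R) : J i -> sig J [set w | w i < t].
Proof. by move=> Ji; apply: (@sig_coord _ _ _ i [set y | y < t]) => //; rewrite -set_itvNyo. Qed.

Lemma disc_lt (J : set Idx) i (t : R) : J i -> disc J (fun w => w i < t).
Proof. by move=> Ji; apply: disc_boolP; exact: sig_lt. Qed.

Lemma disc_level (J : set Idx) i a b : J i -> disc J (fun w => level a b (w i)).
Proof.
move=> Ji; apply: (@disc_comp _ _ _ _ _ (fun w => (w i < a, w i < a + b))
  (fun c : bool * bool => if c.1 then 1%N else if c.2 then 2%N else 0%N)).
by apply: disc_pair; exact: disc_lt.
Qed.

Lemma sig_theta (J : set Idx) vs a b (F : (Lab -> nat) -> Prop) :
  (forall y, y \in vs -> J (iS y)) -> sig J [set w | F (theta vs a b w)].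
Proof.
move=> Jv; apply: (disc_pred (D := fun w => [seq level (a y) (b y) (w (iS y)) | y <- vs])
  (Q := fun c _ => F (fun y => nth 0%N c (index y vs)))).
  by apply: disc_map => y /Jv; exact: disc_level.
by move=> c; exact: sig_cst.
Qed.

Lemma sig_open (J : set Idx) E (F : seq (Lab * Lab) -> Prop) :
  (forall e, e \in E -> J (iB e)) -> sig J [set w | F (openE E w)].
Proof.
move=> JE; apply: (disc_pred (D := openE E) (Q := fun c _ => F c)); last by move=> c; exact: sig_cst.
by apply: disc_filter => e /JE; exact: disc_lt.
Qed.

Let sTh vs a b E S : sig setT [set w : Idx -> R | hits B (thr (theta vs a b w) E S)].
Proof. exact: (@sig_theta setT vs a b (fun t => hits B (thr t E S))). Qed.

Let sUn E S : sig setT [set w : Idx -> R | hits B (und (openE E w) S)].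
Proof. exact: (@sig_open setT E (fun o => hits B (und o S))). Qed.

Lemma pr_level1 y a b : 0 <= a -> 0 <= b -> a + b <= 1 ->
  pr Q [set w | level a b (w (iS y)) = 1%N] = a.
Proof.
move=> a0 b0 ab; rewrite -[RHS](unif_lt (fun t => uQ (i := iS y) t isT)); last by lra.
congr (pr Q _); apply/seteqP; split=> w /=; rewrite /level; case: ifP => //.
by case: ifP.
Qed.

Lemma pr_level2 y a b : 0 <= a -> 0 <= b -> a + b <= 1 ->
  pr Q [set w | level a b (w (iS y)) = 2%N] = b.
Proof.
move=> a0 b0 ab.
have ul t : 0 <= t <= 1 -> pr Q [set w | w (iS y) < t] = t.
  exact: (unif_lt (fun t => uQ (i := iS y) t isT)).
have H := prD Q (@sig_lt setT (iS y) (a + b) I) (@sig_lt setT (iS y) a I).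
have E1 : [set w : Idx -> R | w (iS y) < a + b] `&` [set w | w (iS y) < a] = [set w | w (iS y) < a].
  by apply/seteqP; split=> w /=; [case|move=> h; split=> //; lra].
have E2 : [set w : Idx -> R | w (iS y) < a + b] `&` ~` [set w | w (iS y) < a] =
    [set w | level a b (w (iS y)) = 2%N].
  apply/seteqP; split=> w /=; rewrite /level.
    by move=> [-> /negP/negbTE ->].
  by case: ifP => // /negbT/negP h; case: ifP.
by move: H; rewrite E1 E2 !ul; lra.
Qed.

Lemma pr_level0 y a b : 0 <= a -> 0 <= b -> a + b <= 1 ->
  pr Q [set w | level a b (w (iS y)) = 0%N] = 1 - a - b.
Proof.
move=> a0 b0 ab.
have s n : sig setT [set w : Idx -> R | level a b (w (iS y)) = n] by exact: disc_level.
have -> : [set w : Idx -> R | level a b (w (iS y)) = 0%N] =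
  ~` ([set w | level a b (w (iS y)) = 1%N] `|` [set w | level a b (w (iS y)) = 2%N]).
  apply/seteqP; split=> w /=; first by move=> -> [].
  rewrite /level; case: ifP => _; last case: ifP => _ //; move=> H; exfalso; apply: H.
    by left.
  by right.
rewrite prC; last exact: sigU.
rewrite prU ?pr_level1 ?pr_level2 //; first by lra.
by apply/seteqP; split=> w //= [->].
Qed.

Let JS (s : seq Lab) : set Idx := [set i | exists2 y, y \in s & i = iS y].
Let JB (E : seq (Lab * Lab)) : set Idx := [set i | exists2 e, e \in E & i = iB e].

(* Reveal an edge from an active [x] to an inactive [y].  Being open, of
   probability [p], dominates threshold 1; given that the threshold is not 1, it
   is 2 with probability at most [b / (1 - a) <= p], and only one more active
   neighbour is then needed. *)
Lemma bond_ge_threshold n : forall E S vs (a b : Lab -> R), (size E <= n)%N ->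
  (forall y, 0 <= a y <= p) -> (forall y, 0 <= b y <= p * (1 - a y)) ->
  pr Q [set w | hits B (thr (theta vs a b w) E S)] <=
  pr Q [set w | hits B (und (openE E w) S)].
Proof.
have [p0 p1] := andP p01.
elim: n => [|n IH] E S vs a b sE ha hb.
  move: sE; rewrite leqn0 size_eq0 => /eqP ->.
  apply: pr_le; [exact: sTh|exact: sUn|move=> w].
  by apply: hits_sub => x Hx; apply: und0; apply: thr_stuck Hx.
have [[x [y [Sx [nSy xyE]]]]|nex] :=
  pselect (exists x y, S x /\ ~ S y /\ epair x y \in E); last first.
  apply: pr_le; [exact: sTh|exact: sUn|move=> w].
  apply: hits_sub => z Hz; apply: und0; apply: thr_stuck Hz => x y Sx xy.
  by apply: contrapT => nSy; apply: nex; exists x, y.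
set e := epair x y in xyE; set E' := [seq e' <- E | e' != e].
have sE' : (size E' <= n)%N.
  rewrite -ltnS; apply: leq_trans sE; rewrite size_filter -(count_predC (pred1 e) E) /=.
  rewrite -[X in (X < _)%N]add0n ltn_add2r -has_count; apply/hasP; exists e => //=.
have E'E : {subset E' <= E} by move=> e'; rewrite mem_filter => /andP[].
pose vs' := [seq v <- vs | v != y].
pose U1 := pr Q [set w | hits B (und (openE E' w) (add1 S y))].
pose U0 := pr Q [set w | hits B (und (openE E' w) S)].
have oE w : {subset openE E' w <= openE E w}.
  by move=> e'; rewrite !mem_filter => /andP[-> /andP[_ ->]].
have U01 : U0 <= U1.
  apply: pr_le; [exact: sUn|exact: sUn|move=> w].
  by apply: hits_sub => z; apply: und_sub => // u; left.
have UE : p * U1 + (1 - p) * U0 <= pr Q [set w | hits B (und (openE E w) S)].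
  have dJ : [set iB e] `&` JB E' = set0.
    apply/seteqP; split=> // i [/= -> [e' He' [ee]]].
    by move: He'; rewrite -ee mem_filter eqxx.
  have sA (A : seq (Lab * Lab) -> Prop) : sig (JB E') [set w : Idx -> R | A (openE E' w)].
    by apply: (@sig_open _ E' A) => e' He'; exists e'.
  have sb : sig [set iB e] [set w : Idx -> R | w (iB e) < p] by exact: sig_lt.
  have -> : p * U1 = pr Q ([set w | w (iB e) < p] `&`
      [set w | hits B (und (openE E' w) (add1 S y))]).
    rewrite (indep_sig iQ dJ) //; last exact: (sA (fun o => hits B (und o (add1 S y)))).
    by rewrite (unif_lt (fun t => uQ (i := iB e) t isT)) //; lra.
  have -> : (1 - p) * U0 = pr Q (~` [set w | w (iB e) < p] `&`
      [set w | hits B (und (openE E' w) S)]).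
    rewrite (indep_sig iQ dJ); [|exact: sigC|exact: (sA (fun o => hits B (und o S)))].
    rewrite prC; last exact: sig_sub sb.
    by rewrite (unif_lt (fun t => uQ (i := iB e) t isT)) //; lra.
  rewrite -prU; first last.
  - by apply/seteqP; split=> // w [[/= h _] [/=]].
  - by apply: sigI; [apply: sigC; exact: sig_lt|exact: sUn].
  - by apply: sigI; [exact: sig_lt|exact: sUn].
  apply: pr_le; [|exact: sUn|].
    apply: sigU; apply: sigI; do ?exact: sUn; first exact: sig_lt.
    by apply: sigC; exact: sig_lt.
  move=> w [[/= bo]|[/= bo]]; apply: hits_sub => z.
    by apply: (und_stepR Sx (oE w)); rewrite /openE mem_filter bo.
  by apply: und_sub => //; exact: oE.
apply: le_trans UE.
pose F (th : Lab -> nat) (S' : set Lab) := hits B (thr th E' S').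
pose th0 w := theta vs' a b w.
have th0y w : th0 w y = 0%N by rewrite /th0 thetaE mem_filter eqxx.
have th0v w v : v != y -> theta vs a b w v = th0 w v.
  by move=> vy; rewrite /th0 !thetaE mem_filter vy.
pose F1 := pr Q [set w | F (th0 w) (add1 S y)].
pose F2 := pr Q [set w | F (upd (th0 w) y 1) S].
pose F0 := pr Q [set w | F (th0 w) S].
have F1U : F1 <= U1 by exact: IH.
have F0U : F0 <= U0 by exact: IH.
have sF G : sig (JS vs') [set w : Idx -> R | G (th0 w)].
  by apply: (@sig_theta _ vs' a b G) => v Hv; exists v.
have [yvs|yvs] := boolP (y \in vs); last first.
  have E0 w : theta vs a b w = th0 w.
    apply/funext => v; rewrite /th0 !thetaE mem_filter.
    by have [->|] := eqVneq v y; rewrite //= (negbTE yvs).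
  have : pr Q [set w | hits B (thr (theta vs a b w) E S)] <= F0.
    apply: pr_le; [exact: sTh|exact: sTh|move=> w /=].
    by rewrite E0; apply: hits_sub => z; apply: thr_step0 => //; exact: th0y.
  by have := pr_ge0 Q [set w | F (th0 w) S]; move: U01 F0U; rewrite -/F0; nra.
have [/andP[a0 ap] /andP[b0 bp]] := (ha y, hb y).
have ab : a y + b y <= 1 by nra.
pose ly w := level (a y) (b y) (w (iS y)).
have dJ : [set iS y] `&` JS vs' = set0.
  by apply/seteqP; split=> // i [/= -> [v Hv [h]]]; rewrite -h mem_filter eqxx in Hv.
have sl n' : sig [set iS y] [set w : Idx -> R | ly w = n'] by exact: disc_level.
have lyE w : theta vs a b w y = ly w by rewrite thetaE yvs.
have M1 : pr Q [set w | hits B (thr (theta vs a b w) E S)] <=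
    a y * F1 + b y * F2 + (1 - a y - b y) * F0.
  have -> : a y * F1 = pr Q ([set w | ly w = 1%N] `&` [set w | F (th0 w) (add1 S y)]).
    rewrite (indep_sig iQ dJ (sl _)) ?pr_level1 //.
    exact: (sF (fun t => F t (add1 S y))).
  have -> : b y * F2 = pr Q ([set w | ly w = 2%N] `&` [set w | F (upd (th0 w) y 1) S]).
    rewrite (indep_sig iQ dJ (sl _)) ?pr_level2 //.
    exact: (sF (fun t => F (upd t y 1) S)).
  have -> : (1 - a y - b y) * F0 = pr Q ([set w | ly w = 0%N] `&` [set w | F (th0 w) S]).
    rewrite (indep_sig iQ dJ (sl _)) ?pr_level0 //.
    exact: (sF (fun t => F t S)).
  have sT n' : sig setT [set w : Idx -> R | ly w = n'] by exact: disc_level.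
  have sFT G : sig setT [set w : Idx -> R | G (th0 w)] by exact: (@sig_theta setT vs' a b G).
  have s1 : sig setT ([set w | ly w = 1%N] `&` [set w | F (th0 w) (add1 S y)]).
    by apply: sigI => //; exact: (sFT (fun t => F t (add1 S y))).
  have s2 : sig setT ([set w | ly w = 2%N] `&` [set w | F (upd (th0 w) y 1) S]).
    by apply: sigI => //; exact: (sFT (fun t => F (upd t y 1) S)).
  have s0 : sig setT ([set w | ly w = 0%N] `&` [set w | F (th0 w) S]).
    by apply: sigI => //; exact: (sFT (fun t => F t S)).
  apply: le_trans (lerD (prU_le Q s1 s2) (lexx _)).
  apply: le_trans (prU_le Q (sigU s1 s2) s0).
  apply: pr_le; [exact: sTh|by apply: sigU => //; exact: sigU|].
  move=> w /= H.
  case E1: (ly w == 1%N).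
    left; left; split; first exact/eqP.
    apply: hits_sub H => z; move/(@thr_step1 E S x y Sx); apply: thr_root; first by right.
    exact: th0v.
  case E2: (ly w == 2%N).
    left; right; split; first exact/eqP.
    have -> : upd (th0 w) y 1 = upd (theta vs a b w) y 1.
      by apply/funext => v; rewrite /upd; case: eqVneq => // vy; rewrite th0v.
    apply: hits_sub H => z; apply: thr_step2 => //; rewrite lyE; exact/eqP.
  have E0 : ly w = 0%N.
    by move: E1 E2; rewrite /ly /level; case: ifP => //; case: ifP.
  right; split=> //; have -> : th0 w = theta vs a b w.
    by apply/funext => v; have [->|vy] := eqVneq v y; [rewrite th0y lyE|rewrite th0v].
  by apply: hits_sub H => z; apply: thr_step0 => //; rewrite lyE.
pose c := b y / (1 - a y).
have c01 : 0 <= c <= p.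
  rewrite divr_ge0 ?b0 //=; last by lra.
  by rewrite ler_pdivrMr //; lra.
(* With threshold 1 of probability [c] and threshold 2 excluded at [y], the parameters again satisfy
   the hypotheses, so the induction hypothesis covers this mixture. *)
have M2 : c * F2 + (1 - c) * F0 <= U0.
  pose a' := fun v => if v == y then c else a v.
  pose b' := fun v => if v == y then 0 else b v.
  have th0' w : th0 w = theta vs' a' b' w.
    apply/funext => v; rewrite /th0 !thetaE mem_filter /a' /b'; by case: eqVneq.
  apply: (@le_trans _ _ (pr Q [set w | hits B (thr (theta vs a' b' w) E' S)])); last first.
    apply: IH => // v; rewrite /a' /b'; case: eqVneq => // _.
    by rewrite lexx /= mulr_ge0 //; lra.
  pose ly' w := level c 0 (w (iS y)).
  have sl' n' : sig [set iS y] [set w : Idx -> R | ly' w = n'] by exact: disc_level.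
  have -> : c * F2 = pr Q ([set w | ly' w = 1%N] `&` [set w | F (upd (th0 w) y 1) S]).
    rewrite (indep_sig iQ dJ (sl' _)) ?pr_level1 //; try lra.
    exact: (sF (fun t => F (upd t y 1) S)).
  have -> : (1 - c) * F0 = pr Q ([set w | ly' w = 0%N] `&` [set w | F (th0 w) S]).
    rewrite (indep_sig iQ dJ (sl' _)) ?pr_level0 ?subr0 //; try lra.
    exact: (sF (fun t => F t S)).
  have sT n' : sig setT [set w : Idx -> R | ly' w = n'] by exact: disc_level.
  have sFT G : sig setT [set w : Idx -> R | G (th0 w)] by exact: (@sig_theta setT vs' a b G).
  have s2 : sig setT ([set w | ly' w = 1%N] `&` [set w | F (upd (th0 w) y 1) S]).
    by apply: sigI => //; exact: (sFT (fun t => F (upd t y 1) S)).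
  have s0 : sig setT ([set w | ly' w = 0%N] `&` [set w | F (th0 w) S]).
    by apply: sigI => //; exact: (sFT (fun t => F t S)).
  rewrite -prU //; last by apply/seteqP; split=> // w [[/= -> _] [/=]].
  apply: pr_le; [exact: sigU|exact: sTh|].
  have ly'E w : theta vs a' b' w y = ly' w by rewrite thetaE yvs /a' /b' eqxx.
  have thv w v : v != y -> theta vs a' b' w v = th0 w v.
    by move=> vy; rewrite th0' !thetaE mem_filter vy.
  move=> w [[/= l1]|[/= l1]]; rewrite /F => H.
    have <- : upd (th0 w) y 1 = theta vs a' b' w; last by [].
    by apply/funext => v; rewrite /upd; case: eqVneq => [->|vy]; rewrite ?ly'E ?thv.
  have <- : th0 w = theta vs a' b' w; last by [].
  by apply/funext => v; have [->|vy] := eqVneq v y; [rewrite ly'E th0y|rewrite thv].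
have bE : b y = (1 - a y) * c by rewrite /c mulrC divfK //; lra.
apply: le_trans M1 _.
(* The weight of the better alternative rises from [a y] to [p]; this helps because [U0 <= U1]. *)
have : a y * F1 + (1 - a y) * (c * F2 + (1 - c) * F0) <= p * U1 + (1 - p) * U0.
  by move: F1U M2 U01; nra.
by rewrite bE; lra.
Qed.

End Comparison.

(** * Thinning by types *)

Section Multinomial.
Variables (R : realType) (Tt : finType) (q : Tt -> R).

Fixpoint allseq n : seq (seq Tt) :=
  if n is m.+1 then [seq t :: s | t <- enum Tt, s <- allseq m] else [:: [::]].

Lemma mem_allseq n s : (s \in allseq n) = (size s == n).
Proof.
elim: n s => [|n IH] s /=; first by rewrite inE; case: s.
apply/allpairsP/eqP => [[[t u] [/= _ Hu ->]]|].
  by move: Hu; rewrite IH => /eqP <-.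
case: s => [//|t u] /= [su]; exists (t, u); split=> //=; first by rewrite mem_enum.
by rewrite IH su.
Qed.

Lemma allseq_uniq n : uniq (allseq n).
Proof.
elim: n => [//|n IH] /=; apply: allpairs_uniq => //; first exact: enum_uniq.
by move=> [t u] [t' u'] _ _ /= [-> ->].
Qed.

Definition mult (m : Tt -> nat) : R := \prod_t (q t ^+ m t / (m t)`!%:R).

(** Here [n! * mult m] is the multinomial probability. Induction on the first letter [t0]: removing
    it lowers [m t0] by one and leaves the factor [m t0], and these factors add up to [n.+1]. *)
Lemma mult_allseq n (m : Tt -> nat) : (\sum_t m t = n)%N ->
  \sum_(ts <- allseq n | [forall t, count_mem t ts == m t]) \prod_(t <- ts) q t =
  n`!%:R * mult m.
Proof.
elim: n m => [|n IH] m Hm /=.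
  have m0 t : m t = 0%N by apply/eqP; rewrite -leqn0 -Hm (bigD1 t) //= leq_addr.
  rewrite big_cons big_nil ifT ?addr0; last by apply/forallP => t /=; rewrite m0.
  rewrite big_nil addr0 fact0 mul1r /mult big1 // => t _.
  by rewrite m0 fact0 expr0 divr1.
rewrite big_mkcond big_allpairs_dep /=.
pose m' t0 t := if t == t0 then (m t).-1 else m t.
have step t0 : \sum_(s <- allseq n)
    (if [forall t, (t0 == t) + count_mem t s == m t]%N then \prod_(t <- t0 :: s) q t else 0)
    = n`!%:R * ((m t0)%:R * mult m).
  have [m0|m0] := posnP (m t0).
    rewrite m0 mul0r mulr0 big1 // => s _; case: ifP => // /forallP /(_ t0).
    by rewrite eqxx m0.
  have Hm' : (\sum_t m' t0 t = n)%N.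
    apply/eqP; rewrite -eqSS -Hm (bigD1 t0) //= [in X in _ == X](bigD1 t0) //= {1}/m' eqxx.
    rewrite -addSn prednK // eqn_add2l; apply/eqP; apply: eq_bigr => t /negbTE tt0.
    by rewrite /m' tt0.
  transitivity (q t0 * (n`!%:R * mult (m' t0))).
    rewrite -IH // big_distrr /= [in RHS]big_mkcond; apply: eq_bigr => s _.
    have -> : [forall t, (t0 == t) + count_mem t s == m t]%N =
              [forall t, count_mem t s == m' t0 t].
      apply: eq_forallb => t; rewrite /m'.
      have [->|tt0] := eqVneq t t0; last by [].
      by lia.
    by case: ifP => _; rewrite ?big_cons ?mulr0.
  rewrite mulrCA; congr (_ * _); rewrite /mult.
  rewrite (bigD1 t0) //= [in RHS](bigD1 t0) //= !mulrA; congr (_ * _); last first.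
    by apply: eq_bigr => t /negbTE tt0; rewrite /m' tt0.
  rewrite /m' eqxx; case: (m t0) m0 => // j _ /=.
  rewrite exprS factS natrM invfM; field.
  by rewrite nat1r !pnatr_eq0 -lt0n fact_gt0.
transitivity (\sum_(t0 <- enum Tt) n`!%:R * ((m t0)%:R * mult m)).
  by apply: eq_bigr => t0 _; exact: step.
rewrite big_enum /= -big_distrr /= -big_distrl /= -natr_sum Hm factS natrM.
by ring.
Qed.

End Multinomial.

Lemma nth_map_index (A : eqType) B (g : A -> B) (s : seq A) x0 t : t \in s ->
  nth x0 [seq g u | u <- s] (index t s) = g t.
Proof. by move=> ts; rewrite (nth_map t) ?index_mem // nth_index. Qed.

(** * Joint laws of independent discrete variables *)

Section ListLaws.
Variables (R : realType) (I : choiceType) (Q : probability (Om R I) R).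
Hypothesis iQ : indep Q.

Lemma pr_disc_sum (C : countType) (D : (I -> R) -> C) (s : seq C) : disc setT D -> uniq s ->
  pr Q [set w | D w \in s] = \sum_(c <- s) pr Q [set w | D w = c].
Proof.
move=> dD; elim: s => [_|c s IH /= /andP[cs us]].
  by rewrite big_nil (_ : mkset _ = set0) ?pr0 //; apply/seteqP; split.
have sD (P : C -> Prop) : sig setT [set w | P (D w)].
  by apply: (disc_pred (Q := fun c _ => P c)) => // c'; exact: sig_cst.
rewrite big_cons -IH // -prU.
- congr (pr Q _); apply/seteqP; split=> w /=.
    by rewrite inE => /orP[/eqP|]; [left|right].
  by rewrite inE => -[->|->]; rewrite ?eqxx ?orbT.
- exact: dD.
- exact: (sD (fun c => c \in s)).
- by apply/seteqP; split=> w //= [-> ]; rewrite (negbTE cs).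
Qed.

Lemma law_map (K : eqType) (C : countType) (J : K -> set I) (W : seq K)
    (G : K -> (I -> R) -> C) (c : seq C) :
  uniq W -> (forall k k', k \in W -> k' \in W -> k != k' -> J k `&` J k' = set0) ->
  (forall k, k \in W -> disc (J k) (G k)) ->
  pr Q [set w | [seq G k w | k <- W] = c] =
  if size c == size W then \prod_(kc <- zip W c) pr Q [set w | G kc.1 w = kc.2] else 0.
Proof.
elim: W c => [|k W IH] c /=.
  move=> _ _ _; case: c => [|x c] /=.
    by rewrite big_nil (_ : mkset _ = setT) ?prT //; apply/seteqP; split.
  by rewrite (_ : mkset _ = set0) ?pr0 //; apply/seteqP; split.
move=> /andP[kW uW] JJ dG; case: c => [|x c] /=.
  by rewrite (_ : mkset _ = set0) ?pr0 //; apply/seteqP; split.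
have -> : [set w | G k w :: [seq G k w | k <- W] = x :: c] =
    [set w | G k w = x] `&` [set w | [seq G k w | k <- W] = c].
  by apply/seteqP; split=> w /= => [[-> ->]|[-> ->]].
rewrite (indep_sig iQ (J1 := J k) (J2 := \bigcup_(l in [set` W]) J l)); first last.
- apply: disc_map => l lW; apply: disc_sub (dG l _); last by rewrite inE lW orbT.
  exact: bigcup_sup.
- by apply: dG; rewrite mem_head.
- apply/seteqP; split=> // i [Jk [l /= ls Jl]].
  suff : (J k `&` J l) i by rewrite JJ ?mem_head ?inE ?ls ?orbT //; apply: contraNneq kW => ->.
  by split.
rewrite IH //; first last.
- by move=> l lW; apply: dG; rewrite inE lW orbT.
- by move=> l l' lW lW'; apply: JJ; rewrite inE ?lW ?lW' orbT.
by rewrite eqSS; case: ifP => _; rewrite ?mulr0 // big_cons.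
Qed.

Lemma law_map_eq (K : eqType) (C : countType) (J J' : K -> set I) (W : seq K)
    (G G' : K -> (I -> R) -> C) :
  uniq W -> (forall k k', k \in W -> k' \in W -> k != k' -> J k `&` J k' = set0) ->
  (forall k k', k \in W -> k' \in W -> k != k' -> J' k `&` J' k' = set0) ->
  (forall k, k \in W -> disc (J k) (G k)) -> (forall k, k \in W -> disc (J' k) (G' k)) ->
  (forall k c, k \in W -> pr Q [set w | G k w = c] = pr Q [set w | G' k w = c]) ->
  forall c, pr Q [set w | [seq G k w | k <- W] = c] = pr Q [set w | [seq G' k w | k <- W] = c].
Proof.
move=> uW JJ JJ' dG dG' GG c; rewrite (law_map _ uW JJ dG) (law_map _ uW JJ' dG').
case: ifP => // /eqP sc; rewrite !big_seq; apply: eq_bigr => -[k x] kx; apply: GG => /=.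
by have := map_f fst kx; rewrite -/unzip1 unzip1_zip // sc.
Qed.

End ListLaws.

(** * Renaming the points of a box by type *)

Section Labels.
Variable Tt : finType.

Definition occ (s : seq Tt) (t : Tt) (i : nat) : nat :=
  nth 0%N [seq j <- iota 0 (size s) | nth t s j == t] i.

Lemma size_occ (s : seq Tt) t : size [seq j <- iota 0 (size s) | nth t s j == t] = count_mem t s.
Proof.
rewrite size_filter -[in RHS](mkseq_nth t s) /mkseq count_map; exact: eq_count.
Qed.

Lemma occP (s : seq Tt) t i : (i < count_mem t s)%N ->
  (occ s t i < size s)%N /\ forall t0, nth t0 s (occ s t i) = t.
Proof.
move=> Hi; have : occ s t i \in [seq j <- iota 0 (size s) | nth t s j == t].
  by rewrite mem_nth // size_occ.
rewrite mem_filter mem_iota /= add0n => /andP[/eqP E lt]; split=> // t0.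
by rewrite (set_nth_default t).
Qed.

Lemma occ_inj (s : seq Tt) t i t' i' : (i < count_mem t s)%N -> (i' < count_mem t' s)%N ->
  occ s t i = occ s t' i' -> t = t' /\ i = i'.
Proof.
move=> Hi Hi' E; have tt : t = t'.
  by rewrite -((occP Hi).2 t) E (occP Hi').2.
split=> //; move: Hi' E; rewrite -tt => Hi' /eqP.
rewrite nth_uniq ?size_occ // ?filter_uniq ?iota_uniq //.
by move/eqP.
Qed.

Lemma occ_surj (s : seq Tt) j t : (j < size s)%N -> nth t s j = t -> exists2 i, (i < count_mem t s)%N & occ s t i = j.
Proof.
move=> Hj E; have jin : j \in [seq j <- iota 0 (size s) | nth t s j == t].
  by rewrite mem_filter E eqxx mem_iota.
exists (index j [seq j <- iota 0 (size s) | nth t s j == t]).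
  by rewrite -size_occ index_mem.
by rewrite /occ nth_index.
Qed.

Definition slot (k : int * int) (t : Tt) (i : nat) : Lab := (k, pickle (t, i)).

(** Sends the slot of the [i]-th point of type [t] to the true label of that point. Slots without a
    point go beyond the [size (c a.1)] true labels of the box, which keeps the map injective. *)
Definition sigma (c : int * int -> seq Tt) (a : Lab) : Lab :=
  if pickle_inv a.2 is Some (t, i) then
    if (i < count_mem t (c a.1))%N then (a.1, occ (c a.1) t i)
    else (a.1, (size (c a.1) + a.2)%N)
  else (a.1, (size (c a.1) + a.2)%N).

Lemma sigma_slot c k t i : (i < count_mem t (c k))%N -> sigma c (slot k t i) = (k, occ (c k) t i).
Proof. by move=> Hi; rewrite /sigma /slot /= pickleK_inv Hi. Qed.

Lemma sigma_inj c : injective (sigma c).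
Proof.
move=> [k n] [k' n']; rewrite /sigma /=.
case E: (pickle_inv n) => [[t i]|]; case E': (pickle_inv n') => [[t' i']|].
- have En : pickle (t, i) = n by have := @pickle_invK (Tt * nat)%type n; rewrite /oapp E.
  have En' : pickle (t', i') = n' by have := @pickle_invK (Tt * nat)%type n'; rewrite /oapp E'.
  case: ifP => Hi; case: ifP => Hi' [kk]; subst k'.
  + by move=> /(occ_inj Hi Hi') [e1 e2]; rewrite -En -En' e1 e2.
  + by have [H _] := occP Hi; lia.
  + by have [H _] := occP Hi'; lia.
  + by move=> ?; congr pair; lia.
- case: ifP => Hi [kk]; subst k'; first by have [H _] := occP Hi; lia.
  by move=> ?; congr pair; lia.
- case: ifP => Hi [kk]; subst k'; first by have [H _] := occP Hi; lia.
  by move=> ?; congr pair; lia.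
- by case=> kk; subst k' => ?; congr pair; lia.
Qed.

End Labels.

(** * Poisson thinning *)

Section Thinning.
Variables (R : realType) (Q : probability (Om R Idx) R) (lam : R).
Hypothesis lam0 : 0 < lam.
Hypothesis mQ : model Q lam.
Variables (Tt : finType) (tyf : R -> Tt) (q : Tt -> R).
Hypothesis mty : forall t, measurable [set u | tyf u = t].
Hypothesis q0 : forall t, 0 < q t.
Hypothesis q1 : \sum_t q t = 1.
Hypothesis qE : forall a t, pr Q [set w | tyf (w (iS a)) = t] = q t.

Let iQ : indep Q. Proof. by case: mQ. Qed.

Definition tseq (w : Idx -> R) (k : int * int) : seq Tt :=
  [seq tyf (w (iS (k, i))) | i <- iota 0 (nN w k)].

Definition Jbox (k : int * int) : set Idx :=
  [set i | i = iN k \/ exists n, i = iS (k, n)].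

Lemma Jbox_disj k k' : k != k' -> Jbox k `&` Jbox k' = set0.
Proof.
move=> kk'; apply/seteqP; split=> // i [[->|[n ->]] [|[n' //]]] //.
  by case=> E; rewrite E eqxx in kk'.
by case=> E; rewrite E eqxx in kk'.
Qed.

Lemma disc_ty (J : set Idx) a : J (iS a) -> disc J (fun w => tyf (w (iS a))).
Proof. by move=> Ja t; apply: (@sig_coord _ _ _ (iS a) [set u | tyf u = t]). Qed.

Lemma disc_tseq k : disc (Jbox k) (tseq^~ k).
Proof.
move=> ts.
have dn : disc (Jbox k) (fun w : Idx -> R => nN w k) by apply: disc_nN; left.
apply: (@disc_pred _ _ _ _ _ (fun n w => [seq tyf (w (iS (k, i))) | i <- iota 0 n] = ts) dn).
by move=> n; apply: disc_map => i _; apply: disc_ty; right; exists i.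
Qed.

Lemma pr_tseq k ts : pr Q [set w | tseq w k = ts] =
  poisson_pmf lam (size ts) * \prod_(t <- ts) q t.
Proof.
have -> : [set w | tseq w k = ts] = [set w | nN w k = size ts] `&`
    [set w | [seq tyf (w (iS (k, i))) | i <- iota 0 (size ts)] = ts].
  apply/seteqP; split=> w /=.
    by rewrite /tseq => E; have := congr1 size E; rewrite size_map size_iota => <-.
  by move=> [E1 E2]; rewrite /tseq E1.
rewrite (indep_sig iQ (J1 := [set iN k]) (J2 := [set i | exists n, i = iS (k, n)])).
- rewrite (pr_nN lam0 mQ); congr (_ * _).
  have ud n : (forall i j, i \in iota 0 n -> j \in iota 0 n -> i != j ->
      [set iS (k, i)] `&` [set iS (k, j)] = set0).
    by move=> i j _ _ ij; apply/seteqP; split=> // x /= [-> [E]]; rewrite E eqxx in ij.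
  rewrite (law_map iQ _ (iota_uniq _ _) (@ud _)); last by move=> i _; exact: disc_ty.
  rewrite size_iota eqxx; under eq_bigr do rewrite qE.
  rewrite -(big_map snd xpredT q) -/unzip2 unzip2_zip // size_iota //.
- by apply/seteqP; split=> // i /= [-> [n]].
- exact: disc_nN.
- by apply: disc_map => i _; apply: disc_ty; exists i.
Qed.

Definition counts (ts : seq Tt) : seq nat := [seq count_mem t ts | t <- enum Tt].

(** Fresh variables for the counts by type; the successor keeps them apart from [cN k], which
    occupies label [0]. *)
Definition cM (k : int * int) (t : Tt) : Idx := iB ((k, (pickle t).+1), (k, 0%N)).

Definition mcount (k : int * int) (w : Idx -> R) : seq nat :=
  [seq qn (lam * q t) (w (cM k t)) | t <- enum Tt].

Definition JM (k : int * int) : set Idx := [set i | exists t, i = cM k t].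

Lemma disc_qn (J : set Idx) (mu : R) i : 0 < mu -> J i -> disc J (fun w => qn mu (w i)).
Proof.
move=> m0 Ji n; apply: (@sig_coord _ _ _ i [set u | qn mu u = n]) => //; exact: qn_meas.
Qed.

Lemma pr_qn (mu : R) i n : 0 < mu -> isU i -> pr Q [set w | qn mu (w i) = n] = poisson_pmf mu n.
Proof.
case: mQ => _ _ uQ m0 Ui; rewrite -(pois_of_unif (fun t => uQ i t Ui) m0).
congr (pr Q _); apply/seteqP; split=> w /=; rewrite /qnt; first by move=> ->.
by move=> /eqP; rewrite eqr_nat => /eqP.
Qed.

Let lq t : 0 < lam * q t. Proof. by rewrite mulr_gt0. Qed.

Lemma disc_mcount k : disc (JM k) (mcount k).
Proof. by apply: disc_map => t _; apply: disc_qn => //; exists t. Qed.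

Lemma cM_inj k t t' : cM k t = cM k t' -> t = t'.
Proof. by move=> [] /(pcan_inj pickleK). Qed.

(** The mass of a total [n] times the multinomial probability of the counts splits into a product of
    Poisson masses, because the [q t] add up to 1. *)
Lemma pr_counts k c : pr Q [set w | counts (tseq w k) = c] = pr Q [set w | mcount k w = c].
Proof.
have uJ t t' : t \in enum Tt -> t' \in enum Tt -> t != t' ->
    [set cM k t] `&` [set cM k t'] = set0.
  move=> _ _ tt'; apply/seteqP; split=> // x /= [->] /cM_inj E.
  by rewrite E eqxx in tt'.
rewrite (law_map iQ (G := fun t w => qn (lam * q t) (w (cM k t))) c (enum_uniq _) uJ); last first.
  by move=> t _; exact: disc_qn.
case: ifP => [/eqP sc|/eqP sc]; last first.
  rewrite (_ : mkset _ = set0) ?pr0 //; apply/seteqP; split=> // w /= E.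
  by apply: sc; rewrite -E size_map.
pose m t := nth 0%N c (index t (enum Tt)).
have cE : c = [seq m t | t <- enum Tt].
  apply: (@eq_from_nth _ 0%N); first by rewrite size_map.
  move=> i Hi; have t0 : Tt.
    by case: (enum Tt) sc => [|t s] //; case: (c) Hi.
  rewrite (nth_map t0) -?sc // /m index_uniq ?enum_uniq // -sc //.
have -> : \prod_(kc <- zip (enum Tt) c) pr Q [set w | qn (lam * q kc.1) (w (cM k kc.1)) = kc.2]
    = \prod_t poisson_pmf (lam * q t) (m t).
  rewrite {1}cE -{1}[enum Tt]map_id zip_map big_map big_enum /=.
  by apply: eq_bigr => t _; rewrite pr_qn.
set n := (\sum_t m t)%N.
have -> : [set w | counts (tseq w k) = c] =
   [set w | tseq w k \in [seq ts <- allseq Tt n | [forall t, count_mem t ts == m t]]].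
  apply/seteqP; split=> w /=; rewrite mem_filter mem_allseq.
    rewrite cE => E; have Et t : count_mem t (tseq w k) = m t.
      have /= := congr1 (fun s => nth 0%N s (index t (enum Tt))) E.
      by rewrite /counts !nth_map_index ?mem_enum.
    apply/andP; split; first by apply/forallP => t; rewrite Et.
    apply/eqP; rewrite /n; under eq_bigr do rewrite -Et.
    elim: (tseq w k) => [|x s IH] /=; first by rewrite big1.
    rewrite big_split /= -IH (bigD1 x) //= eqxx big1 // => t tx.
    by rewrite eq_sym (negbTE tx).
  move=> /andP[/forallP H _]; rewrite cE; apply: eq_map => t; exact/eqP.
rewrite pr_disc_sum ?filter_uniq ?allseq_uniq //; last first.
  by apply: disc_sub (@disc_tseq k).
rewrite big_filter.
transitivity (\sum_(ts <- allseq Tt n | [forall t, count_mem t ts == m t])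
    poisson_pmf lam n * \prod_(t <- ts) q t).
  rewrite big_seq_cond [in RHS]big_seq_cond; apply: eq_bigr => ts /andP[]; rewrite mem_allseq => /eqP sz _.
  by rewrite pr_tseq sz.
rewrite -big_distrr /= mult_allseq // /poisson_pmf lam0 /mult.
transitivity (\prod_t ((lam ^+ m t * expR (- (lam * q t))) * (q t ^+ m t / (m t)`!%:R))).
  rewrite [RHS]big_split /= mulrA; congr (_ * _).
  rewrite big_split /= prodrXr -/n -expR_sum sumrN -big_distrr /= q1 mulr1.
  by field; rewrite pnatr_eq0 -lt0n fact_gt0.
apply: eq_bigr => t _; rewrite lq exprMn; ring.
Qed.

Section Window.
Variable W : seq (int * int).
Hypothesis uW : uniq W.

Definition tys (w : Idx -> R) : seq (seq Tt) := [seq tseq w k | k <- W].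
Definition tfun (c : seq (seq Tt)) (k : int * int) : seq Tt := nth [::] c (index k W).
Definition mcounts (w : Idx -> R) : seq (seq nat) := [seq mcount k w | k <- W].

Lemma tfunE w k : k \in W -> tfun (tys w) k = tseq w k.
Proof. by move=> kW; rewrite /tfun /tys (nth_map k) ?index_mem // nth_index. Qed.

Lemma sig_relab s (A : set (Idx -> R)) : injective s -> sig JG A ->
  sig JG [set w : Idx -> R | A (relab s w)].
Proof.
move=> si sA.
have mid (i : Idx) : measurable_fun setT ((fun _ => id) i : R -> R) by exact: measurable_id.
apply: sig_sub (@sig_transport R Idx Idx (tauR s) (fun _ => id) mid JG A sA).
move=> _ [i Ji <-]; move: i Ji => [[[[k|[a c]]|[a b]]|a]|e] // ab.
apply: (@epair_lt (s a) (s b)); apply: contraTneq ab => /si ->; by rewrite /JG /mkset ltnn.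
Qed.

Definition JNS : set Idx := \bigcup_(k in [set` W]) Jbox k.
Definition JMM : set Idx := \bigcup_(k in [set` W]) JM k.

Lemma disc_tys : disc JNS tys.
Proof.
apply: disc_map => k kW; apply: disc_sub (@disc_tseq k); exact: bigcup_sup.
Qed.

Lemma disc_mcounts : disc JMM mcounts.
Proof.
apply: disc_map => k kW; apply: disc_sub (@disc_mcount k); exact: bigcup_sup.
Qed.

Lemma JNS_JG : JNS `&` JG = set0.
Proof. by apply/seteqP; split=> // i [[k _ [->|[n ->]]]]. Qed.

Lemma JMM_JG : JMM `&` JG = set0.
Proof. by apply/seteqP; split=> // i [[k _ [t ->]]]. Qed.

Lemma JM_disj k k' : k != k' -> JM k `&` JM k' = set0.
Proof.
move=> kk'; apply/seteqP; split=> // i [[t ->] [t' [E]]]; by rewrite E eqxx in kk'.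
Qed.

(* Poisson thinning: the labels [slot k t i] make the points of each type an
   independent layer. *)
Lemma layer_eq (S : seq (seq nat) -> set (Idx -> R)) : (forall m, sig JG (S m)) ->
  pr Q [set w | S (map counts (tys w)) (relab (sigma (tfun (tys w))) w)] =
  pr Q [set w | S (mcounts w) w].
Proof.
move=> sS.
(* With the type sequences frozen, the renaming is undone by [relab_law]; the random counts are then
   exchanged for fresh ones with the same law. *)
transitivity (pr Q [set w | S (map counts (tys w)) w]).
  have E c : pr Q [set w | S (map counts c) (relab (sigma (tfun c)) w)] = pr Q (S (map counts c)).
    by rewrite -(relab_law mQ (@sigma_inj _ (tfun c)) (sS _)).
  have s1 c : sig JG [set w | S (map counts c) (relab (sigma (tfun c)) w)].
    by apply: sig_relab => //; exact: sigma_inj.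
  apply/eqP; rewrite eq_le; apply/andP; split.
    apply: (cond_le iQ JNS_JG JNS_JG disc_tys (A := fun c => [set w | S (map counts c) (relab (sigma (tfun c)) w)])
      (B := fun c => S (map counts c))) => // c; by rewrite E.
  apply: (cond_le iQ JNS_JG JNS_JG disc_tys (B := fun c => [set w | S (map counts c) (relab (sigma (tfun c)) w)])
      (A := fun c => S (map counts c))) => // c; by rewrite E.
apply: (cond_law iQ JNS_JG JMM_JG (D := fun w => map counts (tys w)) (A := S)) => //.
- by apply: disc_comp; exact: disc_tys.
- exact: disc_mcounts.
rewrite /tys /mcounts => c.
have -> : [set w | [seq counts i | i <- [seq tseq w k | k <- W]] = c] =
          [set w | [seq counts (tseq w k) | k <- W] = c].
  by apply/seteqP; split=> w /=; rewrite -map_comp.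
apply: (law_map_eq iQ (J := Jbox) (J' := JM) uW) => //.
- by move=> k k' _ _; exact: Jbox_disj.
- by move=> k k' _ _; exact: JM_disj.
- by move=> k _; apply: disc_comp; exact: disc_tseq.
- by move=> k _; exact: disc_mcount.
- by move=> k c' _; exact: pr_counts.
Qed.

End Window.
End Thinning.

Lemma reach_map (V V' : set Lab) E E' k n (h : Lab -> Lab) :
  (forall a, V a -> V' (h a) /\ (h a).1 = a.1) ->
  (forall a b, V a -> V b -> E a b -> E' (h a) (h b)) ->
  reach V E (inbox k) (far k n) -> reach V' E' (inbox k) (far k n).
Proof.
move=> hV hE [a [b [ka Va fb ab]]]; have Vb := gedge_V Va ab.
exists (h a), (h b); split.
- by rewrite /inbox /= (hV a Va).2.
- exact: (hV a Va).1.
- by rewrite /far /= (hV b Vb).2.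
elim: ab {ka fb} Va Vb => {a b} [a b [Va [Vb ab]]|a|a b c ab H1 bc H2] Va' Vb'.
- by apply: rt_step; split; [exact: (hV a _).1|split; [exact: (hV b _).1|exact: hE]].
- exact: rt_refl.
- have Vb := gedge_V Va' ab; apply: rt_trans (H1 Va' Vb) (H2 Vb Vb').
Qed.

(** The path is stopped at its first vertex at distance [n] or more. It then stays in a finite
    window, as thinning and the replacement box by box require. *)
Lemma reach_trunc (V : set Lab) E k n D :
  (forall a b, V a -> V b -> E a b -> (bdist a.1 b.1 <= D)%N) ->
  reach V E (inbox k) (far k n) ->
  reach [set a | V a /\ (bdist k a.1 <= n + D)%N] E (inbox k) (far k n).
Proof.
move=> near [a [b [ka Va fb /crt_chain [p [cp lp]]]]].
have aW : (bdist k a.1 <= n + D)%N by rewrite ka bdistxx.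
suff [c fc ac] : exists2 c, far k n c &
    crt (gedge [set a | V a /\ (bdist k a.1 <= n + D)%N] E) a c by exists a, c.
move: {ka} a Va aW cp lp; elim: p => [|x p IH] a Va aW /=.
  by move=> _ ab; exists a; [rewrite ab|exact: rt_refl].
move=> [[_ [Vx ax]] cp] lp.
have [na|an] := leqP n (bdist k a.1); first by exists a => //; exact: rt_refl.
have xW : (bdist k x.1 <= n + D)%N.
  by have := bdist_tri k a.1 x.1; have := near _ _ Va Vx ax; lia.
have [c fc xc] := IH x Vx xW cp lp; exists c => //.
by apply: rt_trans xc; apply: rt_step; split=> //; split.
Qed.

(** * Edge lengths and boxes *)

Section Geometry.
Variables (R : realType) (f : R -> R) (r : R).
Hypothesis fdec : forall s t : R, 0 <= s -> s <= t -> f t <= f s.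
Hypothesis f01 : forall s : R, 0 <= s -> 0 <= f s <= 1.
Hypothesis r0 : 0 < r.
Hypothesis fr1 : forall s : R, 0 <= s -> 0 < f s -> s <= r.
Hypothesis fr2 : forall s : R, 0 <= s -> s < r -> 0 < f s.

(** The ends of an edge are at distance at most [r], and positions inside unit boxes add at most 1;
    this bounds the distance between their boxes. *)
Definition DD : nat := (Num.truncn r).+2.

(** An almost sure event. Nonnegative edge variables rule out edges at distances where [f] is
    zero. *)
Definition reg (w : Idx -> R) : Prop :=
  (forall ac : Lab * bool, 0 <= w (iX ac.1 ac.2) <= 1) /\ (forall e, 0 <= w (iE e)).

Lemma sig_01 (J : set Idx) i : J i -> sig J [set w : Idx -> R | 0 <= w i <= 1].
Proof.
by move=> Ji; apply: (@sig_coord _ _ _ i [set x | 0 <= x <= 1]) => //; rewrite -set_itvcc.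
Qed.

Lemma sig_ge0 (J : set Idx) i : J i -> sig J [set w : Idx -> R | 0 <= w i].
Proof.
by move=> Ji; apply: (@sig_coord _ _ _ i [set x | 0 <= x]) => //; rewrite -set_itvcy.
Qed.

Lemma sig_reg : sig setT [set w | reg w].
Proof.
by apply: sig_and; apply: sig_all => c; [exact: sig_01|exact: sig_ge0].
Qed.

Lemma pr_reg (Q : probability (Om R Idx) R) lam : model Q lam -> pr Q [set w | reg w] = 1.
Proof.
move=> [iQ pQ uQ].
have H1 : pr Q [set w | forall ac : Lab * bool, 0 <= w (iX ac.1 ac.2) <= 1] = 1.
  apply: (@pr_all1 _ _ Q _ (fun ac : Lab * bool => [set w | 0 <= w (iX ac.1 ac.2) <= 1])).
    by move=> c; exact: sig_01.
  by move=> c; exact: (unif_01 (fun t => uQ (iX c.1 c.2) t isT)).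
have s1 : sig setT [set w : Idx -> R | forall ac : Lab * bool, 0 <= w (iX ac.1 ac.2) <= 1].
  by apply: sig_all => c; exact: sig_01.
have s2 : sig setT [set w : Idx -> R | forall e, 0 <= w (iE e)].
  by apply: sig_all => c; exact: sig_ge0.
apply/eqP; rewrite eq_le pr_le1 /=; last exact: sig_reg.
have <- : pr Q [set w | forall e, 0 <= w (iE e)] = 1.
  apply: (@pr_all1 _ _ Q _ (fun e : Lab * Lab => [set w | 0 <= w (iE e)])).
    by move=> c; exact: sig_ge0.
  move=> c; apply/eqP; rewrite eq_le pr_le1 /=; last exact: sig_ge0.
  rewrite -(unif_01 (fun t => uQ (iE c) t isT)); apply: pr_le; [exact: sig_01|exact: sig_ge0|].
  by move=> w /= /andP[].
by apply: (pr_as_le s1) => //; [exact: sig_reg|move=> w [H2 H1']; split].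
Qed.

Lemma geo_dist w a b : reg w -> geo f w a b -> distw a b w <= r.
Proof.
move=> [_ rE] [_ H]; apply: fr1; first exact: sqrtr_ge0.
exact: le_lt_trans (rE _) H.
Qed.

Lemma distw_coord w a b (s : R) : 0 <= s -> distw a b w <= s ->
  `|xw a w - xw b w| <= s /\ `|yw a w - yw b w| <= s.
Proof.
move=> s0 H; split; apply: le_trans H; rewrite -sqrtr_sqr /distw ler_wsqrtr //.
  by rewrite lerDl sqr_ge0.
by rewrite lerDr sqr_ge0.
Qed.

Lemma int_near (z : int) (u v : R) : 0 <= u <= 1 -> 0 <= v <= 1 ->
  `|z%:~R + (u - v)| <= r -> (absz z <= DD)%N.
Proof.
move=> u01 v01 H.
have zr : `|z%:~R : R| < (Num.truncn r).+2%:R.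
  have := truncnS_gt r; have := ler_normB (z%:~R + (u - v)) (u - v).
  have : `|u - v| <= 1 by rewrite ler_norml; lra.
  rewrite addrK -natr1 -natr1; lra.
rewrite -intr_norm -[X in _ < X]/((Posz (Num.truncn r).+2)%:~R : R) ltr_int in zr.
by rewrite /DD; lia.
Qed.

Lemma geo_near w a b : reg w -> geo f w a b -> (bdist a.1 b.1 <= DD)%N.
Proof.
move=> rw g; have [hx hy] := distw_coord (ltW r0) (geo_dist rw g).
have [rX _] := rw.
have u (c : Lab) (e : bool) : 0 <= w (iX c e) <= 1 by exact: (rX (c, e)).
have h1 : (absz (a.1.1 - b.1.1)%R <= DD)%N.
  apply: (int_near (u a false) (u b false)).
  by rewrite intrB; move: hx; rewrite /xw; congr (`|_| <= _); ring.
have h2 : (absz (a.1.2 - b.1.2)%R <= DD)%N.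
  apply: (int_near (u a true) (u b true)).
  by rewrite intrB; move: hy; rewrite /yw; congr (`|_| <= _); ring.
by rewrite /bdist; lia.
Qed.

Lemma geo_relab (s : Lab -> Lab) w a b : injective s -> (forall a, (s a).1 = a.1) ->
  geo f (relab s w) a b <-> geo f w (s a) (s b).
Proof.
move=> si s1.
have eX c e : relab s w (iX c e) = w (iX (s c) e) by [].
have eE e : relab s w (iE e) = w (iE (epair (s e.1) (s e.2))) by [].
rewrite /geo /distw /xw /yw eE !eX !s1.
have -> : epair (s (epair a b).1) (s (epair a b).2) = epair (s a) (s b).
  by case: (epair_cases a b) => -> //=; exact: epairC.
split=> -[H1 H2]; split=> //; last by move=> ab; apply: H1; rewrite ab.
by move=> /si.
Qed.

Lemma sigma_box (Tt : finType) (c : int * int -> seq Tt) a : (sigma c a).1 = a.1.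
Proof. by rewrite /sigma; case: pickle_inv => [[t i]|] //; case: ifP. Qed.

Lemma Rc_anti w k n : Rc f w k n.+1 -> Rc f w k n.
Proof. by apply: reach_sub => // a; rewrite /far /=; exact: ltnW. Qed.

Lemma Rb_anti p w k n : Rb f p w k n.+1 -> Rb f p w k n.
Proof. by apply: reach_sub => // a; rewrite /far /=; exact: ltnW. Qed.

Lemma geo_Y (mu : R) w a b : geo f (Y mu w) a b <-> geo f w a b.
Proof. by []. Qed.

Lemma nN_Y (mu : R) w k : nN (Y mu w) k = qn mu (w (cN k)).
Proof. exact: nNx_nat. Qed.

Definition mget (Tt : finType) (W : seq (int * int)) (m : seq (seq nat)) k (t : Tt) :=
  nth 0%N (nth [::] m (index k W)) (index t (enum Tt)).

Lemma mget_counts (Tt : finType) tyf W (w : Idx -> R) k (t : Tt) : k \in W ->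
  mget W (map (@counts Tt) (tys tyf W w)) k t = count_mem t (tseq tyf w k).
Proof.
move=> kW; rewrite /mget /tys -map_comp nth_map_index //=.
by rewrite /counts nth_map_index // mem_enum.
Qed.

Lemma mget_mcounts (Tt : finType) (lam : R) q W (w : Idx -> R) k (t : Tt) : k \in W ->
  mget W (mcounts lam q W w) k t = qn (lam * q t) (w (cM k t)).
Proof.
move=> kW; rewrite /mget /mcounts nth_map_index //.
by rewrite /mcount nth_map_index // mem_enum.
Qed.

(** * Site percolation as a model of smaller intensity *)

Section Site.
Variables (Q : probability (Om R Idx) R) (lam p : R).
Hypothesis lam0 : 0 < lam.
Hypothesis mQ : model Q lam.
Hypothesis p0 : 0 < p.
Hypothesis p1 : p < 1.

Let iQ : indep Q. Proof. by case: mQ. Qed.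
Let tyf (u : R) : bool := u < p.
Let q (t : bool) : R := if t then p else 1 - p.

Let mty t : measurable [set u | tyf u = t].
Proof.
have m1 : measurable [set u : R | u < p] by rewrite -set_itvNyo.
case: t; first exact: m1.
rewrite (_ : mkset _ = ~` [set u | u < p]); first exact: measurableC.
by apply/seteqP; split=> u /=; rewrite /tyf; [move=> ->|move/negP/negbTE].
Qed.

Let qE a t : pr Q [set w | tyf (w (iS a)) = t] = q t.
Proof.
case: mQ => _ _ uQ.
have e1 : pr Q [set w | w (iS a) < p] = p.
  by apply: (unif_lt (fun t => uQ (iS a) t isT)); rewrite (ltW p0) ltW.
case: t; first exact: e1.
transitivity (1 - pr Q [set w | w (iS a) < p]); last by rewrite e1.
rewrite -prC; last exact: sig_lt.
congr (pr Q _); apply/seteqP; split=> w /=; rewrite /tyf; first by move=> ->.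
by move/negP/negbTE.
Qed.

(** The open vertices are the layer of type [true], with Poisson counts of mean [lam * p]. After
    thinning it remains to exchange the count variables [cM _ true] for the [cN] read by [Y], and to
    turn labels [pickle (true, i)] into [i]. *)
Lemma Rs_le_Y k n : pr Q [set w | Rs f p w k n] <= pr Q [set w | Rc f (Y (lam * p) w) k n].
Proof.
have mu0 : 0 < lam * p by rewrite mulr_gt0.
set W := window k (n + DD).
have uW : uniq W by exact: window_uniq.
pose S (m : seq (seq nat)) (w : Idx -> R) :=
  reach [set a | a.1 \in W /\ exists2 i, (i < mget W m a.1 true)%N & a.2 = pickle (true, i)]
    (geo f w) (inbox k) (far k n).
have sS m : sig JG [set w | S m w].
  by apply: sig_reach => [x|x y]; [exact: sig_cst|exact: sig_geo].
have q0 t : 0 < q t by case: t; rewrite /q ?subr_gt0.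
have q1 : \sum_t q t = 1 by rewrite big_bool /= /q; ring.
apply: (@le_trans _ _ (pr Q [set w | S (map (@counts _) (tys tyf W w))
    (relab (sigma (tfun W (tys tyf W w))) w)])).
  apply: (pr_as_le sig_reg); [exact: sig_Rs| |exact: pr_reg mQ|].
    apply: (disc_pred (D := tys tyf W) (Q := fun c w => S (map (@counts _) c) (relab (sigma (tfun W c)) w))).
      by apply: disc_sub (disc_tys mty (W := W)).
    move=> c; apply: (@sig_sub _ _ JG) => //.
    exact: (sig_relab (@sigma_inj _ (tfun W c)) (sS (map (@counts _) c))).
  move=> w [/= H rw].
  have {}H := reach_trunc (fun a b _ _ g => geo_near rw g) H.
  set c := tfun W (tys tyf W w).
  have cE k' : k' \in W -> c k' = tseq tyf w k' by exact: tfunE.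
  pose P a i := (i < count_mem true (c a.1))%N /\ occ (c a.1) true i = a.2.
  (* The slot that [sigma c] sends back to the open vertex [a]. *)
  pose h (a : Lab) : Lab := slot a.1 true (xget 0%N [set i | P a i]).
  have hP a : vertw w a /\ w (iS a) < p -> (bdist k a.1 <= n + DD)%N ->
      P a (xget 0%N [set i | P a i]) /\ a.1 \in W.
    move=> [va op] aW; have kW : a.1 \in W by rewrite mem_window.
    split=> //.
    have [i Pi] : exists i, P a i.
      have [||i Hi Ei] := @occ_surj _ (c a.1) a.2 true; last by exists i.
      - by rewrite cE // size_map size_iota; apply/vertwE.
      - rewrite cE // (nth_map 0%N) ?size_iota; last exact/vertwE.
        by rewrite nth_iota ?add0n; [case: (a) op|exact/vertwE].
    by case: xgetP => [j _ //|/(_ i)].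
  apply: (reach_map (h := h)) H.
    move=> a [Va aW]; have [[Hi Ei] kW] := hP a Va aW; split=> //; split=> //.
    exists (xget 0%N [set i | P a i]) => //; rewrite mget_counts //.
    by rewrite -cE.
  move=> a b [Va aW] [Vb bW] ab; apply/geo_relab.
  - exact: sigma_inj.
  - by move=> ?; exact: sigma_box.
  have E x : vertw w x /\ w (iS x) < p -> (bdist k x.1 <= n + DD)%N -> sigma c (h x) = x.
    move=> Vx xW; have [[Hi Ei] kW] := hP x Vx xW.
    by rewrite /h sigma_slot // Ei; case: (x).
  by rewrite !E.
rewrite (layer_eq lam0 mQ mty q0 q1 qE uW sS).
pose S2 (l : seq nat) (w : Idx -> R) :=
  reach [set a | a.1 \in W /\ exists2 i, (i < nth 0%N l (index a.1 W))%N & a.2 = pickle (true, i)]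
    (geo f w) (inbox k) (far k n).
pose S3 (l : seq nat) (w : Idx -> R) :=
  reach [set a | a.1 \in W /\ (a.2 < nth 0%N l (index a.1 W))%N]
    (geo f w) (inbox k) (far k n).
have sS2 l : sig JG [set w | S2 l w].
  by apply: sig_reach => [x|x y]; [exact: sig_cst|exact: sig_geo].
have sS3 l : sig JG [set w | S3 l w].
  by apply: sig_reach => [x|x y]; [exact: sig_cst|exact: sig_geo].
pose D1 (w : Idx -> R) := [seq qn (lam * p) (w (cM k' true)) | k' <- W].
pose D2 (w : Idx -> R) := [seq qn (lam * p) (w (cN k')) | k' <- W].
pose J1 : set Idx := [set i | exists k', i = cM k' true].
pose J2 : set Idx := [set i | exists k', i = cN k'].
have dD1 : disc J1 D1 by apply: disc_map => k' _; apply: disc_qn => //; exists k'.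
have dD2 : disc J2 D2 by apply: disc_map => k' _; apply: disc_qn => //; exists k'.
have J1G : J1 `&` JG = set0 by apply/seteqP; split=> // i [[k' ->]].
have J2G : J2 `&` JG = set0 by apply/seteqP; split=> // i [[k' ->]].
have -> : [set w | S (mcounts lam q W w) w] = [set w | S2 (D1 w) w].
  apply/seteqP; split=> w /=; apply: reach_sub => // a [aW [i Hi Ea]]; split=> //; exists i => //.
    by move: Hi; rewrite mget_mcounts // /D1 nth_map_index.
  by rewrite mget_mcounts //; move: Hi; rewrite /D1 nth_map_index.
rewrite (cond_law iQ J1G J2G dD1 dD2 (A := S2)) //; last first.
  move=> c; apply: (law_map_eq iQ (J := fun k' => [set cM k' true]) (J' := fun k' => [set cN k']) uW).
  - by move=> x y _ _ xy; apply/seteqP; split=> // i [/= -> [E]]; rewrite E eqxx in xy.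
  - by move=> x y _ _ xy; apply/seteqP; split=> // i [/= -> [E]]; rewrite E eqxx in xy.
  - by move=> x _; exact: disc_qn.
  - by move=> x _; exact: disc_qn.
  - by move=> x m _; rewrite !(pr_qn mQ).
apply: (@le_trans _ _ (pr Q [set w | S3 (D2 w) w])).
  apply: (cond_le iQ J2G J2G dD2 (A := S2) (B := S3)) => // l.
  pose s' (a : Lab) : Lab := (a.1, pickle (true, a.2)).
  have s'i : injective s'.
    move=> [a i] [b j] E; have Ei : pickle (true, i) = pickle (true, j) := congr1 snd E.
    by have [->] := pcan_inj pickleK Ei; have Ea : a = b := congr1 fst E; rewrite Ea.
  rewrite [in leRHS](relab_law mQ s'i (sS3 l)).
  have s4 : sig JG [set w | S3 l (relab s' w)] by exact: (sig_relab s'i (sS3 l)).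
  apply: pr_le; [exact: sig_sub (sS2 l)|exact: sig_sub s4|].
  move=> w /=; pose h (a : Lab) : Lab :=
    (a.1, if @pickle_inv (bool * nat)%type a.2 is Some (_, i) then i else 0%N).
  apply: (reach_map (h := h)).
    by move=> [k' j] /= [aW [i Hi ->]]; rewrite /h /= pickleK_inv.
  move=> [k1 j1] [k2 j2] [_ [i1 _ /= ->]] [_ [i2 _ /= ->]] g.
  apply/geo_relab => //; by rewrite /h /= !pickleK_inv.
apply: pr_le.
- by apply: (disc_pred (Q := fun c w => S3 c w) (disc_sub (@subsetT _ J2) dD2)) => c; exact: sig_sub (sS3 c).
- by apply: sig_sub (sig_Y mu0 (sig_Rc fdec k n)); exact: subsetT.
move=> w /=; apply: reach_sub => // a [aW Hi]; apply/vertwE.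
by rewrite nN_Y; move: Hi; rewrite /D2 nth_map_index.
Qed.

Lemma site_to_Y : 0 < pr Q [set w | exists k, forall n, Rs f p w k n] ->
  0 < pr Q [set w | exists k, forall n, Rc f (Y (lam * p) w) k n].
Proof.
have mu0 : 0 < lam * p by rewrite mulr_gt0.
have sY k n : sig setT [set w | Rc f (Y (lam * p) w) k n].
  by apply: sig_sub (sig_Y mu0 (sig_Rc fdec k n)); exact: subsetT.
move=> /(@pr_bigcup_gt0 _ _ Q _ (fun k => [set w | forall n, Rs f p w k n])) [].
  by move=> k; apply: sig_all => n; exact: sig_Rs.
move=> k ck; apply: lt_le_trans ck _.
apply: (@le_trans _ _ (pr Q [set w | forall n, Rc f (Y (lam * p) w) k n])); last first.
  apply: pr_le; [by apply: sig_all|by apply: sig_ex => k'; apply: sig_all|].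
  by move=> w /= H; exists k.
apply: (@pr_bigcap_ge _ _ Q (fun n => [set w | Rc f (Y (lam * p) w) k n])) => // n.
  by move=> w; exact: Rc_anti.
apply: le_trans (Rs_le_Y k n); apply: pr_le.
- by apply: sig_all => n'; exact: sig_Rs.
- exact: sig_Rs.
- by move=> w /= /(_ n).
Qed.

End Site.
End Geometry.

(** * Absence of percolation at small intensity *)

Section Walks.
Variable D : nat.

Definition step (x y : int * int) : bool := (bdist x y <= D)%N.

Fixpoint walks (m : nat) (k : int * int) : seq (seq (int * int)) :=
  if m is m'.+1 then flatten [seq [seq x :: p | p <- walks m' x] | x <- window k D]
  else [:: [::]].

Lemma walksS m k :
  walks m.+1 k = flatten [seq [seq x :: p | p <- walks m x] | x <- window k D].
Proof. by []. Qed.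

Lemma mem_walks m k p : size p = m -> path step k p -> p \in walks m k.
Proof.
elim: m k p => [|m IH] k [|x p] // [sp] /andP[kx pp].
apply/flattenP; exists [seq x :: p | p <- walks m x]; last by apply: map_f; exact: IH.
by apply: (map_f (fun x => [seq x :: p | p <- walks m x])); rewrite mem_window.
Qed.

Lemma size_walks m k p : p \in walks m k -> size p = m.
Proof.
elim: m k p => [|m IH] k p; first by rewrite inE => /eqP ->.
by move=> /flattenP[s /mapP[x _ ->] /mapP[q Hq ->]] /=; rewrite (IH x).
Qed.

Lemma count_walks m k : size (walks m k) = ((D.*2.+1 ^ 2) ^ m)%N.
Proof.
elim: m k => [|m IH] k //.
rewrite walksS size_flatten /shape -map_comp.
rewrite (eq_map (g := fun=> ((D.*2.+1 ^ 2) ^ m)%N)); last by move=> x /=; rewrite size_map IH.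
rewrite [RHS]expnS; set X := (_ ^ m)%N; rewrite -(size_window k D).
by elim: (window k D) => //= x s ->.
Qed.

Lemma walk_bdist k p : path step k p -> (bdist k (last k p) <= D * size p)%N.
Proof.
elim: p k => [|x p IH] k /=; first by rewrite bdistxx.
move=> /andP[kx /IH H]; have := bdist_tri k x (last x p); move: kx; rewrite /step; nia.
Qed.

Variables (R : realType) (Q : probability (Om R Idx) R).
Variables (Bd : int * int -> set (Idx -> R)) (th : R).
Hypothesis sB : forall k, sig setT (Bd k).
Hypothesis th0 : 0 <= th.
Hypothesis pB : forall s : seq (int * int), uniq s ->
  pr Q [set w | forall k, k \in s -> Bd k w] <= th ^+ size s.

Lemma sig_allB (s : seq (int * int)) : sig setT [set w | forall k, k \in s -> Bd k w].
Proof.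
by apply: sig_all => k; apply: sig_imp; [exact: sig_cst|exact: sB].
Qed.

(** A union bound over the walks of length [m]; the boxes of a walk are distinct, so each walk costs
    [th ^+ m]. *)
Lemma walk_bound m k :
  pr Q [set w | exists p, [/\ size p = m, path step k p, uniq p & forall x, x \in p -> Bd x w]]
  <= ((D.*2.+1 ^ 2)%:R * th) ^+ m.
Proof.
pose F (p : seq (int * int)) : set (Idx -> R) := [set w | uniq p /\ forall x, x \in p -> Bd x w].
have sF p : sig setT (F p) by apply: sig_and; [exact: sig_cst|exact: sig_allB].
apply: (@le_trans _ _ (pr Q [set w | exists2 p, p \in walks m k & F p w])).
  apply: pr_le.
  - apply: (@sig_ext _ _ _ (fun w => exists p, (size p = m /\ path step k p) /\ F p w)).
      move=> w; split=> [[p [[? ?] [? ?]]]|[p [? ? ? ?]]]; by exists p.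
    by apply: sig_ex => p; apply: sig_and; [exact: sig_cst|exact: sF].
  - apply: (@sig_ext _ _ _ (fun w => exists p, p \in walks m k /\ F p w)).
      by move=> w; split=> [[p [? ?]]|[p ? ?]]; exists p.
    by apply: sig_ex => p; apply: sig_and; [exact: sig_cst|exact: sF].
  - by move=> w /= [p [sp pp up Bp]]; exists p; [exact: mem_walks|split].
apply: le_trans (pr_bigU_le Q _ sF) _.
rewrite exprMn -natrX -(count_walks m k).
have H p : p \in walks m k -> pr Q (F p) <= th ^+ m.
  move=> pw; have [up|nup] := boolP (uniq p); last first.
    rewrite (_ : F p = set0) ?pr0 ?exprn_ge0 //; apply/seteqP; split=> // w [].
    by rewrite (negbTE nup).
  rewrite -(size_walks pw); apply: le_trans (pB up).
  by apply: pr_le; [exact: sF|exact: sig_allB|move=> w []].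
rewrite big_seq_cond; apply: le_trans (ler_sum _ (G := fun=> th ^+ m) _) _.
  by move=> p; rewrite andbT; exact: H.
rewrite -big_seq_cond big_const_seq count_predT; elim: (size _) => [|j IH] /=; first by rewrite mul0r.
by rewrite -natr1 mulrDl mul1r addrC lerD2r.
Qed.

End Walks.

(** A path of vertices projects to a walk of boxes; loop erasure by [shortenP] makes the boxes
    distinct, which makes their occupations independent. *)
Lemma label_path (V : set Lab) E k n D : 
  (forall a b, V a -> V b -> E a b -> (bdist a.1 b.1 <= D)%N) ->
  reach V E (inbox k) (far k n) ->
  exists p, [/\ path (step D) k p, uniq (k :: p), (n <= bdist k (last k p))%N &
    forall x, x \in p -> exists2 a, V a & a.1 = x].
Proof.
move=> near [a [b [ka Va fb /crt_chain [p [cp lp]]]]].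
pose e x y := step D x y && `[< exists2 c, V c & c.1 = y >].
have H : path e a.1 (map fst p).
  elim: p a Va cp {ka lp} => [//|x p IH] a Va /= [[_ [Vx ax]] cp].
  apply/andP; split; last exact: IH.
  rewrite /e /step (near a x) //=; apply/asboolP; by exists x.
have L : last a.1 (map fst p) = b.1 by rewrite last_map lp.
case/shortenP: H L => q pq uq _ L.
exists q; rewrite -ka; split=> //.
- by apply: sub_path pq => x y /andP[].
- by rewrite L ka; exact: fb.
move=> x xq; elim: q (a.1) pq xq {uq L} => [//|y q IH] z /= /andP[/andP[_ /asboolP Vy] pq].
by rewrite inE => /orP[/eqP ->//|]; exact: IH pq.
Qed.

Section Subcritical.
Variables (R : realType) (f : R -> R) (r : R).
Hypothesis fdec : forall s t : R, 0 <= s -> s <= t -> f t <= f s.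
Hypothesis r0 : 0 < r.
Hypothesis fr1 : forall s : R, 0 <= s -> 0 < f s -> s <= r.
Variables (Q : probability (Om R Idx) R) (lam : R).
Hypothesis mQ : model Q lam.

(** A box is occupied with probability at most [mu], so a walk of [m] distinct occupied boxes from
    [k] has probability at most [2^-m]. *)
Lemma subcritical (mu : R) : 0 < mu -> (((DD r).*2.+1) ^ 2)%:R * mu <= 1 / 2 ->
  pr Q [set w | exists k, forall n, Rc f (Y mu w) k n] = 0.
Proof.
move=> mu0 small; set C := ((_ ^ 2)%:R : R) in small.
have iQ : indep Q by case: mQ.
have sY k n : sig setT [set w | Rc f (Y mu w) k n].
  by apply: sig_sub (sig_Y mu0 (sig_Rc fdec k n)); exact: subsetT.
apply/eqP; rewrite eq_le pr_ge0 andbT leNgt; apply/negP.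
move=> /(@pr_bigcup_gt0 _ _ Q _ (fun k => [set w | forall n, Rc f (Y mu w) k n])) [].
  by move=> k; apply: sig_all.
move=> k; set c := pr Q _ => c0.
pose Bd (k : int * int) : set (Idx -> R) := [set w | (0 < qn mu (w (cN k)))%N].
have sB J k' : J (cN k') -> sig J (Bd k').
  move=> Jk; apply: (disc_pred (Q := fun n _ => (0 < n)%N) (disc_qn mu0 Jk)) => n; exact: sig_cst.
have pB s : uniq s -> pr Q [set w | forall k, k \in s -> Bd k w] <= mu ^+ size s.
  move=> us; rewrite (indep_blocks iQ (J := fun k => [set cN k])) //; first last.
  - by move=> x _; exact: sB.
  - by move=> x y _ _ xy; apply/seteqP; split=> // i [/= -> [E]]; rewrite E eqxx in xy.
  have H x : pr Q (Bd x) <= mu.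
    have -> : Bd x = ~` [set w | qn mu (w (cN x)) = 0%N].
      by apply/seteqP; split=> w /=; rewrite /Bd /=; case: (qn mu _).
    rewrite prC; last by apply: disc_qn.
    rewrite (pr_qn mQ) // pmf0 //; have := expR_ge1Dx (- mu); lra.
  elim: s {us} => [|x s IH]; first by rewrite big_nil.
  by rewrite big_cons /= exprS ler_pM ?pr_ge0 // ?prodr_ge0 // => y _; exact: pr_ge0.
have bound m : c <= (1 / 2) ^+ m.
  apply: (@le_trans _ _ (pr Q [set w | Rc f (Y mu w) k (DD r * m)])).
    by apply: pr_le => //; [exact: sig_all|move=> w /= /(_ (DD r * m)%N)].
  apply: (@le_trans _ _ ((C * mu) ^+ m)); last first.
    by rewrite lerXn2r ?nnegrE ?mulr_ge0 ?ler0n ?divr_ge0 ?ler01 // ltW.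
  apply: (le_trans _ (@walk_bound (DD r) R Q Bd mu (fun k => sB setT k I) (ltW mu0) pB m k)).
  apply: (pr_as_le (@sig_reg R)) => //.
  - apply: sig_ex => p.
    apply: (@sig_ext _ _ _ (fun w => (size p = m /\ path (step (DD r)) k p /\ uniq p) /\ forall x, x \in p -> Bd x w)).
      by move=> w; split=> [[[? [? ?]] ?]|[? ? ? ?]].
    apply: sig_and; first exact: sig_cst.
    apply: sig_all => x; apply: sig_imp; [exact: sig_cst|exact: sB].
  - exact: pr_reg mQ.
  move=> w [/= H rw].
  have near (a b : Lab) : geo f (Y mu w) a b -> (bdist a.1 b.1 <= DD r)%N.
    by move=> g; apply: (geo_near r0 fr1 rw); exact: g.
  have [p [pp up fp Vp]] := label_path (fun a b _ _ => near a b) H.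
  have sp : (m <= size p)%N.
    by have := leq_trans fp (walk_bdist pp); rewrite leq_mul2l; rewrite /DD.
  exists (take m p); split.
  - by rewrite size_take; case: ltngtP sp.
  - by move: pp; rewrite -{1}(cat_take_drop m p) cat_path => /andP[].
  - by rewrite take_uniq //; move: up => /= /andP[].
  move=> x /mem_take /Vp [a Va <-]; rewrite /Bd /=.
  by move/vertwE: Va; rewrite nN_Y; lia.
have [m Hm] : exists m, (1 / 2 : R) ^+ m < c.
  have : (fun m => (1 / 2 : R) ^+ m) @ \oo --> (0 : R).
    by apply: cvg_expr; rewrite ger0_norm; lra.
  move=> /cvgrPdist_lt /(_ _ c0) [m _ Hm]; exists m.
  by have := Hm m (leqnn m); rewrite /= sub0r normrN ger0_norm // exprn_ge0 //; lra.
by have := bound m; rewrite leNgt Hm.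
Qed.

End Subcritical.

(** * Gadgets *)

Section GadgetLabels.
Variables (Rg m : nat).
Hypothesis m1 : (1 < m)%N.

Definition Off := ('I_(Rg.*2.+1) * 'I_(Rg.*2.+1))%type.
(** [None] is a vertex of no use, [tO] an ordinary one, and [tH o] a helping vertex reserved for the
    gadget of the box at offset [o]. The reservation gives different gadgets disjoint sets of
    helping vertices. *)
Definition Ty := option (option Off).
Definition tO : Ty := Some None.
Definition tH (o : Off) : Ty := Some (Some o).

Definition off (k b : int * int) : Off :=
  (inord (absz (b.1 - k.1 + Rg%:Z)), inord (absz (b.2 - k.2 + Rg%:Z))).

Lemma off_inj k b b' : (bdist k b <= Rg)%N -> (bdist k b' <= Rg)%N ->
  off k b = off k b' -> b = b'.
Proof.
rewrite /bdist => H H' [/(congr1 val) /= E1 /(congr1 val) /= E2].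
rewrite !inordK in E1 E2; try lia.
case: b b' H H' E1 E2 => [x y] [x' y'] /= H H' E1 E2.
by have [-> ->] : x = x' /\ y = y' by lia.
Qed.

Definition boxof (g : int * int) : int * int := ((g.1 %/ m)%Z, (g.2 %/ m)%Z).
Definition subof (g : int * int) : nat :=
  (absz (g.1 %% m)%Z * m + absz (g.2 %% m)%Z)%N.

Lemma subof_lt g : (subof g < m ^ 2)%N.
Proof.
rewrite /subof; have := ltz_pmod g.1 (d := m) ltac:(lia).
have := ltz_pmod g.2 (d := m) ltac:(lia).
have := modz_ge0 g.1 (d := m) ltac:(lia); have := modz_ge0 g.2 (d := m) ltac:(lia).
nia.
Qed.

Lemma boxsub_inj g g' : boxof g = boxof g' -> subof g = subof g' -> g = g'.
Proof.
move: g g' => [x y] [x' y']; rewrite /boxof /subof /= => -[Ex Ey].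
have [[a1 b1] [a2 b2]] := ((ltz_pmod x (d := m) ltac:(lia), modz_ge0 x (d := m) ltac:(lia)),
  (ltz_pmod y (d := m) ltac:(lia), modz_ge0 y (d := m) ltac:(lia))).
have [[a3 b3] [a4 b4]] := ((ltz_pmod x' (d := m) ltac:(lia), modz_ge0 x' (d := m) ltac:(lia)),
  (ltz_pmod y' (d := m) ltac:(lia), modz_ge0 y' (d := m) ltac:(lia))).
have := divz_eq x m; have := divz_eq y m; have := divz_eq x' m; have := divz_eq y' m.
rewrite -Ex -Ey; move: a1 b1 a2 b2 a3 b3 a4 b4.
set q := (x %/ m)%Z; set q' := (y %/ m)%Z.
set u := (x %% m)%Z; set v := (y %% m)%Z; set u' := (x' %% m)%Z; set v' := (y' %% m)%Z.
move=> *.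
have uu : u = u' by nia.
have vv : v = v' by nia.
congr pair; lia.
Qed.

(* [hl b g] is the helping vertex of the gadget of box [b] in the square [g] of
   mesh [1 / m]; [ol k i] is the [i]-th ordinary vertex of box [k]. *)
Definition hl (b g : int * int) : Lab := slot (boxof g) (tH (off (boxof g) b)) (subof g).
Definition ol (k : int * int) (i : nat) : Lab := slot k tO i.
Definition inR (b g : int * int) : bool := (bdist b (boxof g) <= Rg)%N.

Lemma inRE b g : inR b g = (bdist b (boxof g) <= Rg)%N. Proof. by []. Qed.

Lemma boxofE g : boxof g = ((g.1 %/ m)%Z, (g.2 %/ m)%Z). Proof. by []. Qed.

Lemma subofE g : subof g = (absz (g.1 %% m)%Z * m + absz (g.2 %% m)%Z)%N. Proof. by []. Qed.

Lemma slot_inj (T' : finType) k (t : T') i k' t' i' : slot k t i = slot k' t' i' ->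
  [/\ k = k', t = t' & i = i'].
Proof.
move=> E; have E1 : k = k' := congr1 fst E.
have E2 : pickle (t, i) = pickle (t', i') := congr1 snd E.
by have [-> ->] := pcan_inj pickleK E2.
Qed.

Lemma hl_inj b g b' g' : inR b g -> inR b' g' -> hl b g = hl b' g' -> b = b' /\ g = g'.
Proof.
move=> ig ig' /slot_inj [Eb Et Es]; have gg := boxsub_inj Eb Es; split=> //.
have Eo : off (boxof g) b = off (boxof g') b' :=
  congr1 (fun t : Ty => if t is Some (Some o) then o else off (boxof g) b) Et.
rewrite -Eb in Eo; apply: off_inj Eo; rewrite bdistC //.
by rewrite Eb.
Qed.

Lemma ol_hl k i b g : ol k i <> hl b g.
Proof. by move=> /slot_inj []. Qed.

End GadgetLabels.

Lemma bdistP k k' n : (bdist k k' <= n)%N ->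
  (- n%:Z <= k'.1 - k.1 <= n%:Z /\ - n%:Z <= k'.2 - k.2 <= n%:Z)%R.
Proof. rewrite /bdist; lia. Qed.

Definition between (x y z : int) : bool := ((x <= z <= y) || (y <= z <= x))%R.

Lemma bdist_leE k k' n : (bdist k k' <= n)%N =
  ((absz (k.1 - k'.1)%R <= n) && (absz (k.2 - k'.2)%R <= n))%N.
Proof. by rewrite /bdist geq_max. Qed.

Lemma between_le (b x y z : int) (n : nat) : (absz (b - x)%R <= n)%N -> (absz (b - y)%R <= n)%N ->
  between x y z -> (absz (b - z)%R <= n)%N.
Proof. rewrite /between; lia. Qed.

Lemma between_div (m : nat) (x y z : int) : between x y z ->
  between (x %/ m)%Z (y %/ m)%Z (z %/ m)%Z.
Proof.
have mono (s t : int) : (s <= t)%R -> ((s %/ m)%Z <= (t %/ m)%Z)%R by apply: lez_pdiv2r.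
by rewrite /between => /orP[]/andP[/mono -> /mono ->] //; rewrite orbT.
Qed.

Lemma inR_between Rg m b x y z : inR Rg m b x -> inR Rg m b y ->
  between x.1 y.1 z.1 -> between x.2 y.2 z.2 -> inR Rg m b z.
Proof.
rewrite /inR !bdist_leE /= => /andP[a1 a2] /andP[b1 b2] h1 h2.
by rewrite (between_le a1 b1 (between_div m h1)) (between_le a2 b2 (between_div m h2)).
Qed.

Definition mv (t : int) (s u : int) : int := if (absz (u - s)%R <= absz t)%N then u
   else if (s < u)%R then (s + t)%R else (s - t)%R.

Lemma mv_between t s u : (0 <= t)%R -> between s u (mv t s u).
Proof. rewrite /mv /between; case: ifP => h; [lia|case: ifP; lia]. Qed.

Lemma mv_dist (t s u : int) : (0 <= t)%R ->
  (absz (u - mv t s u)%R = absz (u - s)%R - absz t)%N /\ (absz (s - mv t s u)%R <= absz t)%N.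
Proof. rewrite /mv; case: ifP => h; [lia|case: ifP; lia]. Qed.

(** Moving one and two steps towards [g] in both coordinates gives two different squares, each
    closer to [g] than [x]: the two active neighbours that a helping vertex in [x] needs. *)
Lemma toward n g x : (bdist g x = n.+2)%N -> exists p1 p2,
  [/\ between x.1 g.1 p1.1 /\ between x.2 g.2 p1.2, between x.1 g.1 p2.1 /\ between x.2 g.2 p2.2,
      (bdist g p1 <= n.+1)%N /\ (bdist x p1 <= 2)%N, (bdist g p2 <= n.+1)%N /\ (bdist x p2 <= 2)%N &
      p1 <> p2].
Proof.
move=> H; exists (mv 1 x.1 g.1, mv 1 x.2 g.2), (mv 2 x.1 g.1, mv 2 x.2 g.2).
have [a1 a2] := @mv_dist 1 x.1 g.1 isT; have [b1 b2] := @mv_dist 1 x.2 g.2 isT.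
have [c1 c2] := @mv_dist 2 x.1 g.1 isT; have [d1 d2] := @mv_dist 2 x.2 g.2 isT.
split; try by split; exact: mv_between.
- by move: H a1 a2 b1 b2; rewrite /bdist /=; clear; lia.
- by move: H c1 c2 d1 d2; rewrite /bdist /=; clear; lia.
- by move=> E; move: (congr1 fst E) (congr1 snd E) H a1 b1 c1 d1; rewrite /bdist /=; clear; lia.
Qed.

Lemma succ_neq (g : int * int) : g <> (g.1 + 1, g.2)%R.
Proof. by case: g => x y /= [H]; lia. Qed.

Lemma bdist_succ (g : int * int) : (bdist g (g.1 + 1, g.2)%R <= 1)%N.
Proof. by rewrite bdist_leE /=; lia. Qed.

Lemma near3 (b x : int * int) (u v u' : int) (D : nat) : (bdist b x <= D)%N ->
  (absz (u - x.1)%R <= D)%N -> (absz (v - x.2)%R <= D)%N -> (absz (u' - u)%R <= 1)%N ->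
  (2 <= D)%N -> (bdist b (u, v) <= 3 * D)%N /\ (bdist b (u', v) <= 3 * D)%N.
Proof. rewrite !bdist_leE /=; lia. Qed.

Lemma div_succ (m : nat) (g : int) : (0 < m)%N ->
  (absz (((g + 1) %/ m)%Z - (g %/ m)%Z)%R <= 1)%N.
Proof.
move=> m0; have m0' : (0 < m%:Z)%R by [].
have a1 := divz_eq g m; have a2 := divz_eq (g + 1) m.
have b1 := ltz_pmod g m0'; have b2 := ltz_pmod (g + 1) m0'.
have d1 := modz_ge0 g (d := m) ltac:(lia); have d2 := modz_ge0 (g + 1) (d := m) ltac:(lia).
nia.
Qed.

Section Gadget.
Variables (R : realType) (f : R -> R) (r : R).
Hypothesis fdec : forall s t : R, 0 <= s -> s <= t -> f t <= f s.
Hypothesis r0 : 0 < r.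
Hypothesis fr1 : forall s : R, 0 <= s -> 0 < f s -> s <= r.

(* Points in squares at distance at most 2 are within [3 / 4 * r]. *)
Definition mm : nat := (Num.truncn (32 / r)).+2.
(** One [DD r] from the box of the gadget to the box of a nearby vertex, one from there to the
    midpoint of an edge, and one for the shift to a neighbouring square. *)
Definition RG : nat := (3 * DD r)%N.
(** Positive, as [3 / 4 * r] is below the end of the support; an edge variable below [c0] produces
    an edge at every distance up to [3 / 4 * r]. *)
Definition c0 : R := f (3 / 4 * r).

Local Notation hl := (hl RG mm).
Local Notation ol := (ol RG).
Local Notation inR := (inR RG mm).
Local Notation boxof := (boxof mm).

Lemma mm1 : (1 < mm)%N. Proof. by []. Qed.

Lemma mm_r : 32 <= mm%:R * r.
Proof.
have := truncnS_gt (32 / r); rewrite ltr_pdivrMr // => H.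
apply/ltW; apply: lt_le_trans H _; by rewrite ler_wpM2r ?(ltW r0) // ler_nat leqnSn.
Qed.

Lemma mm_gt0 : 0 < mm%:R :> R. Proof. by rewrite ltr0n. Qed.

Variables (w : Idx -> R) (K : nat).
Hypothesis rw : reg w.
Variables (pres act : Lab -> Prop) (k0 : int * int).

Definition Zpos (b : int * int) : Prop := forall g, inR b g ->
  ((g.1 %% mm)%Z%:~R <= mm%:R * w (iX (hl b g) false) <= (g.1 %% mm)%Z%:~R + 1) /\
  ((g.2 %% mm)%Z%:~R <= mm%:R * w (iX (hl b g) true) <= (g.2 %% mm)%Z%:~R + 1).

(* The edges between two gadgets are charged to the one with the smaller code,
   so that the gadget events depend on disjoint sets of variables. *)
Definition Xslot (b : int * int) (x : Lab) : Prop :=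
  (exists k i, [/\ (bdist b k <= RG)%N, (i < K)%N & x = ol k i]) \/
  (exists b' g, [/\ (bdist b b' <= RG)%N, inR b' g, (pickle b <= pickle b')%N & x = hl b' g]).

Definition Zedge (b : int * int) : Prop := forall g x, inR b g -> Xslot b x ->
  x <> hl b g -> w (iE (epair (hl b g) x)) < c0.

Definition gad (b : int * int) : Prop :=
  [/\ forall g, inR b g -> pres (hl b g), Zpos b & Zedge b].

(** These three closure rules are all that is asked of the threshold growth; [nreach_thr] supplies
    them, [act] being the activity of the vertex behind a slot. *)
Hypothesis act0 : forall x, pres x -> x.1 = k0 -> act x.
Hypothesis act1 : forall k i y, pres (ol k i) -> act y -> geo f w y (ol k i) -> act (ol k i).
Hypothesis act2 : forall b g y y', pres (hl b g) -> inR b g -> act y -> act y' -> y <> y' ->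
  geo f w y (hl b g) -> geo f w y' (hl b g) -> act (hl b g).

Lemma posH b g : gad b -> inR b g ->
  (g.1%:~R <= mm%:R * xw (hl b g) w <= g.1%:~R + 1) /\
  (g.2%:~R <= mm%:R * yw (hl b g) w <= g.2%:~R + 1).
Proof.
move=> [_ Z _] ig; have [H1 H2] := Z g ig.
have E1 : (g.1%:~R : R) = (g.1 %/ mm)%Z%:~R * mm%:R + (g.1 %% mm)%Z%:~R.
  by rewrite {1}(divz_eq g.1 mm) intrD intrM.
have E2 : (g.2%:~R : R) = (g.2 %/ mm)%Z%:~R * mm%:R + (g.2 %% mm)%Z%:~R.
  by rewrite {1}(divz_eq g.2 mm) intrD intrM.
rewrite /xw /yw E1 E2 /=.
by split; lra.
Qed.

Lemma dist_le (x y : Lab) (s : R) : 0 <= s ->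
  (xw x w - xw y w) ^+ 2 + (yw x w - yw y w) ^+ 2 <= s ^+ 2 -> distw x y w <= s.
Proof.
by move=> s0 H; rewrite /distw -(ger0_norm s0) -sqrtr_sqr ler_wsqrtr.
Qed.

Lemma geoH b g x : x <> hl b g -> w (iE (epair (hl b g) x)) < c0 ->
  (xw x w - xw (hl b g) w) ^+ 2 + (yw x w - yw (hl b g) w) ^+ 2 <= (3 / 4 * r) ^+ 2 ->
  geo f w x (hl b g).
Proof.
move=> xh we H; split=> //; rewrite epairC; apply: lt_le_trans we _.
apply: fdec; first exact: sqrtr_ge0.
by apply: dist_le H; have := r0; lra.
Qed.

Definition linkable (b : int * int) (x : Lab) : Prop :=
  forall g, inR b g -> x <> hl b g -> w (iE (epair (hl b g) x)) < c0.

Lemma link_ol b k i : gad b -> (bdist b k <= RG)%N -> (i < K)%N -> linkable b (ol k i).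
Proof. by move=> [_ _ Z] bk iK g ig; apply: Z => //; left; exists k, i. Qed.

Lemma link_hl b b' g' : gad b -> gad b' -> (bdist b b' <= RG)%N -> inR b' g' ->
  linkable b (hl b' g').
Proof.
move=> [_ _ Z] [_ _ Z'] bb ig' g ig xh.
have [H|H] := leqP (pickle b) (pickle b'); first by apply: Z => //; right; exists b', g'.
rewrite epairC; apply: Z' => //; last by move=> E; apply: xh.
by right; exists b, g; split=> //; [rewrite bdistC|exact: ltnW].
Qed.

Lemma close_sq (s t : R) : (-3 <= mm%:R * s <= 3) -> (-3 <= mm%:R * t <= 3) ->
  s ^+ 2 + t ^+ 2 <= (3 / 4 * r) ^+ 2.
Proof.
have := mm_r; have := mm_gt0; have := r0; move=> ? ? ? ? ?.
have hs : - (3 / 32 * r) <= s <= 3 / 32 * r by nra.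
have ht : - (3 / 32 * r) <= t <= 3 / 32 * r by nra.
nra.
Qed.

Lemma geo_hh b g b' g' : gad b -> gad b' -> (bdist b b' <= RG)%N -> inR b g -> inR b' g' ->
  hl b' g' <> hl b g -> (bdist g g' <= 2)%N -> geo f w (hl b' g') (hl b g).
Proof.
move=> gb gb' bb ig ig' nh gg; apply: geoH => //.
  exact: (link_hl gb gb' bb ig' ig nh).
have [hx hy] := posH gb ig; have [hx' hy'] := posH gb' ig'.
have [d1 d2] := bdistP gg.
have e1 : -2 <= (g'.1%:~R - g.1%:~R : R) <= 2.
  by rewrite -intrB -[2]/(2%:~R) -intrN !ler_int.
have e2 : -2 <= (g'.2%:~R - g.2%:~R : R) <= 2.
  by rewrite -intrB -[2]/(2%:~R) -intrN !ler_int.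
by apply: close_sq; lra.
Qed.

Lemma spread1 b g g1 g2 : gad b -> inR b g -> inR b g1 -> inR b g2 -> g1 <> g2 ->
  (bdist g g1 <= 2)%N -> (bdist g g2 <= 2)%N -> act (hl b g1) -> act (hl b g2) -> act (hl b g).
Proof.
move=> gb ig ig1 ig2 n12 d1 d2 a1 a2.
have [E1|n1] := eqVneq g g1; first by rewrite E1.
have [E2|n2] := eqVneq g g2; first by rewrite E2.
have bb : (bdist b b <= RG)%N by rewrite bdistxx.
have H x : inR b x -> g != x -> hl b x <> hl b g.
  by move=> ix gx /(hl_inj mm1 ix ig) [_ E]; rewrite E eqxx in gx.
apply: (act2 (y := hl b g1) (y' := hl b g2)) => //.
- by case: gb => P _ _; exact: P.
- by move=> /(hl_inj mm1 ig1 ig2) [].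
- by apply: geo_hh => //; exact: H.
- by apply: geo_hh => //; exact: H.
Qed.

(** Induction on the distance to [g]: the two squares given by [toward] are active already, and they
    stay in the gadget because they lie coordinatewise between two of its squares. *)
Lemma spread b g g' : gad b -> inR b g -> inR b g' -> g <> g' -> (bdist g g' <= 1)%N ->
  act (hl b g) -> act (hl b g') -> forall g'', inR b g'' -> act (hl b g'').
Proof.
move=> gb ig ig' ngg dgg ag ag'.
suff H n : forall g'', inR b g'' -> (bdist g g'' <= n.+1)%N -> act (hl b g'').
  by move=> g'' ig''; apply: (H (bdist g g'')) => //; exact: leqnSn.
elim: n => [|n IH] g'' ig'' d.
  apply: (spread1 gb ig'' ig ig' ngg) => //; first by rewrite bdistC; lia.
  have := bdist_tri g'' g g'; rewrite (bdistC g'' g); lia.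
have [dn|dn] := leqP (bdist g g'') n.+1; first exact: IH.
have [p1 [p2 [[u1 u2] [v1 v2] D1 D2 n12]]] : exists p1 p2,
  [/\ between g''.1 g.1 p1.1 /\ between g''.2 g.2 p1.2, between g''.1 g.1 p2.1 /\ between g''.2 g.2 p2.2,
      (bdist g p1 <= n.+1)%N /\ (bdist g'' p1 <= 2)%N, (bdist g p2 <= n.+1)%N /\ (bdist g'' p2 <= 2)%N &
      p1 <> p2] by apply: toward; apply/eqP; rewrite eqn_leq d dn.
have i1 : inR b p1 by exact: (inR_between ig'' ig).
have i2 : inR b p2 by exact: (inR_between ig'' ig).
apply: (spread1 gb ig'' i1 i2 n12) => //; try by case: D1; case: D2.
- by apply: IH => //; case: D1.
- by apply: IH => //; case: D2.
Qed.

Definition sq (px py : R) : int * int := (Num.floor (mm%:R * px), Num.floor (mm%:R * py)).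

Lemma sqP (px : R) : (Num.floor (mm%:R * px))%:~R <= mm%:R * px < (Num.floor (mm%:R * px))%:~R + 1.
Proof. by have := floor_itv (mm%:R * px); rewrite intrD. Qed.

Lemma sq_box (x : Lab) (c : bool) (z : int) (u px : R) : 0 <= u <= 1 ->
  `|px - (z%:~R + u)| <= r / 2 -> (absz ((Num.floor (mm%:R * px) %/ mm)%Z - z) <= DD r)%N.
Proof.
move=> u01; rewrite ler_norml => H; have /andP[s1 s2] := sqP px.
set g := Num.floor _ in s1 s2 *; set q := (g %/ mm)%Z.
have g1 : (q%:~R * mm%:R <= g%:~R :> R).
  by rewrite [in leRHS](divz_eq g mm) -/q intrD intrM lerDl ler0z modz_ge0.
have g2 : (g%:~R + 1 <= (q%:~R + 1) * mm%:R :> R).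
  rewrite {1}(divz_eq g mm) -/q intrD intrM mulrDl mul1r -addrA lerD2l.
  rewrite -[mm%:R]/(mm%:Z%:~R) -[1]/(1%:~R) -intrD ler_int.
  by rewrite lezD1; exact: ltz_pmod.
have m0 := mm_gt0.
have q1 : q%:~R <= px by nra.
have q2 : px < q%:~R + 1 by nra.
have zr : `|((q - z)%:~R : R)| < (Num.truncn r).+2%:R.
  have := truncnS_gt r; have := r0; rewrite -natr1 -natr1 intrB ltr_norml; lra.
rewrite -intr_norm -[X in _ < X]/((Posz (Num.truncn r).+2)%:~R : R) ltr_int in zr.
by move: zr; rewrite /DD; move: (q) (Num.truncn r) => q' t; clear; lia.
Qed.

Lemma sq_inR b (x : Lab) px py : (bdist b x.1 <= DD r)%N ->
  `|px - xw x w| <= r / 2 -> `|py - yw x w| <= r / 2 ->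
  inR b (sq px py) /\ inR b ((sq px py).1 + 1, (sq px py).2).
Proof.
move=> bx hx hy; have [rX _] := rw.
have H1 := sq_box x false (rX (x, false)) hx.
have H2 := sq_box x false (rX (x, true)) hy.
have H3 := @div_succ mm (sq px py).1 isT.
have D2 : (2 <= DD r)%N by [].
exact: (near3 bx H1 H2 H3 D2).
Qed.

(** Half of the edge contributes at most [r / 2], and the position inside the squares at most
    [2 / mm <= r / 16] in each coordinate. *)
Lemma mid_sq (d e s t : R) : d ^+ 2 + e ^+ 2 <= r ^+ 2 ->
  (-2 <= mm%:R * s <= 2) -> (-2 <= mm%:R * t <= 2) ->
  (d / 2 + s) ^+ 2 + (e / 2 + t) ^+ 2 <= (3 / 4 * r) ^+ 2.
Proof.
have := mm_r; have := mm_gt0; have := r0; move=> ? ? ? H ? ?.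
have hs : - (1 / 16 * r) <= s <= 1 / 16 * r by nra.
have ht : - (1 / 16 * r) <= t <= 1 / 16 * r by nra.
have hd : - r <= d <= r by nra.
have he : - r <= e <= r by nra.
nra.
Qed.

(* Two squares at the midpoint of [x] and [y] hold helping vertices adjacent to
   both. *)
Lemma kick b x y : gad b -> act x -> act y -> geo f w x y ->
  linkable b x -> linkable b y -> (bdist b x.1 <= DD r)%N ->
  forall g, inR b g -> act (hl b g).
Proof.
move=> gb ax ay gxy lx ly bx.
have dxy := geo_dist fr1 rw gxy.
have xy : x <> y by case: gxy.
have H2 : (xw x w - xw y w) ^+ 2 + (yw x w - yw y w) ^+ 2 <= r ^+ 2.
  have := dxy; rewrite /distw -[leRHS]ger0_norm ?(ltW r0) // -sqrtr_sqr ler_sqrt //.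
  exact: sqr_ge0.
have [hx hy] := distw_coord (ltW r0) dxy.
pose px := (xw x w + xw y w) / 2; pose py := (yw x w + yw y w) / 2.
have [ig ig'] : inR b (sq px py) /\ inR b ((sq px py).1 + 1, (sq px py).2).
  by apply: (sq_inR bx); rewrite /px /py; move: hx hy; rewrite !ler_norml; lra.
set g := sq px py in ig ig'; set g' := (g.1 + 1, g.2) in ig'.
have [/andP[sx1 sx2] /andP[sy1 sy2]] := (sqP px, sqP py).
have [/andP[h1 h2] /andP[h3 h4]] := posH gb ig.
have [/andP[h1' h2'] /andP[h3' h4']] := posH gb ig'.
rewrite /= intrD in h1' h2' h3' h4'.
have pP (g1 : int * int) : inR b g1 -> pres (hl b g1) by case: gb => P _ _; exact: P.
have cl g1 u : inR b g1 -> (u = x \/ u = y) -> g1 = g \/ g1 = g' -> u <> hl b g1 -> geo f w u (hl b g1).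
  move=> ig1 ux gg1 uh; apply: geoH => //.
    by case: ux uh => -> uh; [exact: lx|exact: ly].
  have hm1 : -2 <= mm%:R * (px - xw (hl b g1) w) <= 2.
    by case: gg1 => ->; rewrite mulrBr; rewrite /g /sq /= in h1 h2 h1' h2' *; lra.
  have hm2 : -2 <= mm%:R * (py - yw (hl b g1) w) <= 2.
    by case: gg1 => ->; rewrite mulrBr; rewrite /g /sq /= in h3 h4 h3' h4' *; lra.
  case: ux => ->.
    have -> : xw x w - xw (hl b g1) w = (xw x w - xw y w) / 2 + (px - xw (hl b g1) w) by rewrite /px; lra.
    have -> : yw x w - yw (hl b g1) w = (yw x w - yw y w) / 2 + (py - yw (hl b g1) w) by rewrite /py; lra.
    exact: mid_sq.
  have -> : xw y w - xw (hl b g1) w = (xw y w - xw x w) / 2 + (px - xw (hl b g1) w) by rewrite /px; lra.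
  have -> : yw y w - yw (hl b g1) w = (yw y w - yw x w) / 2 + (py - yw (hl b g1) w) by rewrite /py; lra.
  by apply: mid_sq => //; rewrite -(sqrrN (_ - _)) opprB -(sqrrN (yw y w - _)) opprB.
have key g1 : inR b g1 -> g1 = g \/ g1 = g' -> act (hl b g1).
  move=> ig1 gg1.
  have [E|nx] := eqVneq x (hl b g1); first by rewrite -E.
  have [E|ny] := eqVneq y (hl b g1); first by rewrite -E.
  apply: (act2 (y := x) (y' := y)) => //; first exact: pP.
    by apply: cl => //; [left|exact/eqP].
  by apply: cl => //; [right|exact/eqP].
have ag : act (hl b g) by apply: key => //; left.
have ag' : act (hl b g') by apply: key => //; right.
exact: (spread gb ig ig' (@succ_neq g) (bdist_succ g) ag ag').
Qed.

(* State [K.+1] of a box stands for a working gadget, the node [None]; a state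
   [j <= K] stands for [j] ordinary points, the nodes [Some i]. *)
Definition Node := ((int * int) * option nat)%type.

Definition nodeok (s : int * int -> nat) (x : Node) : Prop :=
  if x.2 is Some i then (s x.1 <= K)%N /\ (i < s x.1)%N else s x.1 = K.+1.

(** A link with a gadget asks only that the boxes be close, so it is implied by any edge between
    vertices of the two boxes. *)
Definition nedge (x y : Node) : Prop := (bdist x.1 y.1 <= DD r)%N /\
  if (x.2, y.2) is (Some i, Some j) then geo f w (ol x.1 i) (ol y.1 j) else True.

Definition nstep (s : int * int -> nat) (x y : Node) : Prop :=
  [/\ nodeok s x, nodeok s y & nedge x y].

Definition nreach (s : int * int -> nat) n : Prop := s k0 = K.+1 /\
  exists x, (n <= bdist k0 x.1)%N /\ clos_refl_trans Node (nstep s) (k0, None) x.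

Variable s : int * int -> nat.
Hypothesis sgad : forall k, s k = K.+1 -> gad k.
Hypothesis spres : forall k i, (s k <= K)%N -> (i < s k)%N -> pres (ol k i).

(** The vertices whose edges to all gadgets within [DD r] of [k] are controlled, by [link_ol] or
    [link_hl]. *)
Definition tame (k : int * int) (y : Lab) : Prop :=
  (exists k' i, [/\ y = ol k' i, (i < K)%N & (bdist k k' <= DD r)%N]) \/
  (exists b g, [/\ y = hl b g, gad b, inR b g & (bdist b k <= DD r)%N]).

(** An ordinary vertex remembers an active tame neighbour, because waking a gadget by [kick] takes
    two adjacent active vertices. *)
Definition nact (x : Node) : Prop :=
  if x.2 is Some i then act (ol x.1 i) /\ exists y, [/\ act y, geo f w y (ol x.1 i) & tame x.1 y]
  else forall g, inR x.1 g -> act (hl x.1 g).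

Let cg (k : int * int) : int * int := (k.1 * mm%:Z, k.2 * mm%:Z)%R.

Let cg_box k : boxof (cg k) = k /\ boxof ((cg k).1 + 1, (cg k).2) = k.
Proof.
rewrite !boxofE /cg /= !mulzK //; split; first by case: (k).
rewrite divzMDl // (_ : (1 %/ mm)%Z = 0) ?addr0; first by case: (k).
by apply: divz_small; rewrite /=; have := mm1; lia.
Qed.

Lemma nact_step x y : nact x -> nstep s x y -> nact y.
Proof.
have DR : (DD r + DD r <= RG)%N by rewrite /RG; lia.
case: x y => [k1 [i1|]] [k2 [i2|]] ax [/= ok1 ok2 [/= dk g]].
- case: ax => /= ax _; split; last first.
    exists (ol k1 i1); split=> //; left; exists k1, i1; split=> //; last by rewrite bdistC.
    by case: ok1; lia.
  by apply: (act1 (y := ol k1 i1)) => //; case: ok2 => *; exact: spres.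
- have gk := sgad ok2; case: ax => /= ax [y [ay gy ty]].
  have i1K : (i1 < K)%N by case: ok1; lia.
  rewrite bdistC in dk.
  apply: (kick gk ax ay) => //.
  + exact: geoC.
  + by apply: link_ol => //; apply: leq_trans DR; apply: leq_trans dk _; exact: leq_addr.
  case: ty => [[k' [i [-> iK dk']]]|[b [h [-> gb ih db]]]].
    apply: link_ol => //; apply: leq_trans DR.
    by apply: leq_trans (bdist_tri k2 k1 k') _; exact: leq_add.
  apply: link_hl => //; apply: leq_trans DR.
  by apply: leq_trans (bdist_tri k2 k1 b) _; rewrite (bdistC k1 b); exact: leq_add.
(* The helping vertex in the square that contains the new vertex activates it, and becomes its
   remembered neighbour. *)
- have gk := sgad ok1; case: ok2 => s2 i2s; have p2 := spres s2 i2s.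
  set x := ol k2 i2 in p2 *; have rr : r / 2 >= 0 by have := r0; lra.
  have [ig _] := @sq_inR k1 x (xw x w) (yw x w) dk ltac:(by rewrite subrr normr0) ltac:(by rewrite subrr normr0).
  set h := sq _ _ in ig.
  have gx : geo f w (hl k1 h) x.
    apply: geoC; apply: geoH; first exact: ol_hl.
      apply: (link_ol gk _ _ ig); last exact: ol_hl.
        exact: leq_trans dk (leq_trans (leq_addr _ _) DR).
      exact: leq_trans i2s s2.
    have [/andP[sx1 sx2] /andP[sy1 sy2]] := (sqP (xw x w), sqP (yw x w)).
    have [/andP[h1 h2] /andP[h3 h4]] := posH gk ig.
    by rewrite /h /sq /= in h1 h2 h3 h4; apply: close_sq; rewrite mulrBr /h /sq; lra.
  have ah : act (hl k1 h) by exact: ax.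
  split; first exact: act1 gx.
  by exists (hl k1 h); split=> //; right; exists k1, h.
(* Two neighbouring squares of the first gadget, chosen inside box [k2], wake the second one. *)
- have [gk1 gk2] := (sgad ok1, sgad ok2).
  have [B1 B2] := cg_box k2; set h := cg k2 in B1 B2; set h' := (h.1 + 1, h.2) in B2.
  have dR : (bdist k1 k2 <= RG)%N by exact: leq_trans dk (leq_trans (leq_addr _ _) DR).
  have i1 : inR k1 h by rewrite inRE B1.
  have i2 : inR k1 h' by rewrite inRE B2.
  have nh : hl k1 h <> hl k1 h'.
    by move=> /(hl_inj mm1 i1 i2) [_]; exact: succ_neq.
  apply: (kick gk2 (ax _ i1) (ax _ i2)).
  + apply: geo_hh => //; first by rewrite bdistxx.
    by rewrite bdistC; apply: leq_trans (bdist_succ h) _.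
  + by apply: link_hl => //; rewrite bdistC.
  + by apply: link_hl => //; rewrite bdistC.
  + by rewrite /= B1 bdistxx.
Qed.

Lemma nact_root : s k0 = K.+1 -> nact (k0, None).
Proof.
move=> /sgad gk g ig; have [B1 B2] := cg_box k0.
set h := cg k0 in B1 B2; set h' := (h.1 + 1, h.2) in B2.
have i1 : inR k0 h by rewrite inRE B1 bdistxx.
have i2 : inR k0 h' by rewrite inRE B2 bdistxx.
have pP (g1 : int * int) : inR k0 g1 -> pres (hl k0 g1) by case: gk => P _ _; exact: P.
apply: (spread gk i1 i2) => //.
- exact: succ_neq.
- exact: bdist_succ.
- by apply: act0; [exact: pP|rewrite /= B1].
- by apply: act0; [exact: pP|rewrite /= B2].
Qed.

Lemma nreach_act n : nreach s n -> exists x, act x /\ (n <= bdist k0 x.1)%N.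
Proof.
move=> [sk [x [fx cx]]].
have ax : nact x by apply: (crt_ind_l _ _ cx); [exact: nact_root|move=> y z; exact: nact_step].
case: x ax fx {cx} => [k [i|]] /=.
  by move=> [ax _] fx; exists (ol k i).
move=> ax fx; have [B1 _] := cg_box k; exists (hl k (cg k)); split; last by rewrite /= B1.
by apply: ax; rewrite inRE B1 bdistxx.
Qed.

End Gadget.

(** * Box by box domination *)

Section PoissonTails.
Variable R : realType.
Implicit Types (lam mu z : R).

Lemma pmfE lam n : 0 < lam -> poisson_pmf lam n = expR (- lam) * (lam ^+ n / n`!%:R).
Proof. by move=> l0; rewrite /poisson_pmf l0; rewrite mulrC mulrA. Qed.

(** Each mass at [mu1] is at least [expR (- (mu1 - mu))] times the mass at [mu]. *)
Lemma psum_shift mu mu1 j : 0 < mu -> mu <= mu1 -> psum mu j - (mu1 - mu) <= psum mu1 j.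
Proof.
move=> m0 mm1; have m1 : 0 < mu1 by apply: lt_le_trans mm1.
have H : expR (- (mu1 - mu)) * psum mu j <= psum mu1 j.
  rewrite /psum mulr_sumr; apply: ler_sum => i _; rewrite !pmfE // mulrA -expRD.
  rewrite (_ : - (mu1 - mu) + - mu = - mu1); last by ring.
  apply: ler_wpM2l; first exact: expR_ge0.
  apply: ler_wpM2r; first by rewrite invr_ge0 ler0n.
  by apply: lerXn2r => //; rewrite nnegrE ltW.
apply: le_trans H; have := expR_ge1Dx (- (mu1 - mu)).
have := psum_le1 m0 j; have := psum_ge0 mu j; nra.
Qed.

(** Exponential tilting: the mass at [i] is [z ^- i * expR (mu * (z - 1))] times a Poisson mass of
    mean [mu * z], and [z ^- i <= z ^- n] in the tail. *)
Lemma psum_chernoff lam mu z n : 0 < mu -> mu <= lam -> 1 <= z ->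
  1 - psum mu n <= z ^- n * expR (lam * (z - 1)).
Proof.
move=> m0 ml z1; have z0 : 0 < z by apply: lt_le_trans z1.
have mz : 0 < mu * z by exact: mulr_gt0.
have E i : poisson_pmf mu i = z ^- i * expR (mu * (z - 1)) * poisson_pmf (mu * z) i.
  rewrite !pmfE // exprMn.
  have -> : - mu = mu * (z - 1) + - (mu * z) by ring.
  rewrite expRD; field.
  by rewrite pnatr_eq0 -lt0n fact_gt0 expf_neq0 // gt_eqF.
suff H e : 0 < e -> 1 - psum mu n <= z ^- n * expR (lam * (z - 1)) + e.
  by apply/ler_addgt0Pr => e e0; exact: H.
move=> e0; have [N0 HN] := psum_eps m0 e0.
pose N := maxn N0 n.
have HN' : 1 - e < psum mu N by apply: lt_le_trans HN _; apply: psum_nd; exact: leq_maxl.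
suff : psum mu N - psum mu n <= z ^- n * expR (lam * (z - 1)) by move: HN'; lra.
have le_nN : (n <= N)%N := leq_maxr _ _.
have c0 : 0 <= z ^- n * expR (lam * (z - 1)).
  by rewrite mulr_ge0 ?expR_ge0 // invr_ge0 exprn_ge0 // ltW.
suff H k : psum mu (k + n) - psum mu n <= z ^- n * expR (lam * (z - 1)) * psum (mu * z) (k + n).
  rewrite -(subnK le_nN); apply: le_trans (H _) _.
  by rewrite -[leRHS]mulr1 ler_wpM2l // psum_le1.
elim: k => [|k IH]; first by rewrite subrr mulr_ge0 // psum_ge0.
rewrite addSn !psumS mulrDr addrAC; apply: lerD => //.
rewrite E ler_wpM2r // ?poisson_pmf_ge0 //; apply: ler_pM.
- by rewrite invr_ge0 exprn_ge0 // ltW.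
- exact: expR_ge0.
- rewrite lef_pV2 ?posrE ?exprn_gt0 //; apply: ler_weXn2l => //; exact: leq_addl.
- by rewrite ler_expR ler_wpM2r // subr_ge0.
Qed.

(** The mass at [n] is at most 1, so [expR (- mu) * mu ^+ n <= n!]; an exponent [i < n] gains a
    factor [1 / mu]. *)
Lemma psum_small mu n : 1 <= mu -> psum mu n <= n%:R * n`!%:R / mu.
Proof.
move=> m1; have m0 : 0 < mu by apply: lt_le_trans m1.
have fp k : 0 < k`!%:R :> R by rewrite ltr0n fact_gt0.
have H (i : nat) : (i < n)%N -> poisson_pmf mu i <= n`!%:R / mu.
  move=> li.
  have p1 : poisson_pmf mu n <= 1.
    by have := psum_le1 m0 n.+1; rewrite psumS; have := psum_ge0 mu n; lra.
  rewrite !pmfE // in p1 *.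
  have h1 : expR (- mu) * mu ^+ n <= n`!%:R by rewrite mulrA ler_pdivrMr // mul1r in p1.
  rewrite ler_pdivlMr //; apply: le_trans h1.
  rewrite -!mulrA ler_wpM2l ?expR_ge0 //.
  have -> : mu ^+ n = mu ^+ i * mu ^+ (n - i) by rewrite -exprD subnKC // ltnW.
  rewrite ler_wpM2l ?exprn_ge0 ?(ltW m0) //.
  have f1 : (i`!%:R)^-1 <= 1 :> R by rewrite invf_le1 // ler1n fact_gt0.
  have m2 : mu <= mu ^+ (n - i).
    by rewrite -{1}[mu]expr1; apply: ler_weXn2l => //; rewrite subn_gt0.
  by apply: le_trans m2; rewrite -[leRHS]mul1r ler_wpM2r // ltW.
rewrite /psum -mulrA; apply: (@le_trans _ _ (\sum_(i < n) (n`!%:R / mu))).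
  by apply: ler_sum => i _; exact: H.
by rewrite big_const_ord iter_addr_0 [leRHS]mulr_natl.
Qed.
End PoissonTails.

(** * Replacing the states of boxes one at a time *)

Section Replace.
Variables (R : realType) (I : choiceType) (Q : probability (Om R I) R).
Hypothesis iQ : indep Q.

(* [P (G_D) = P (G_0) + sum_j P (D > j) P (G_(j+1) minus G_j)], summed by parts. *)
Lemma replace_one (J1 J2 J3 : set I) (D1 D2 : (I -> R) -> nat) (G : nat -> set (I -> R)) M :
  J1 `&` J3 = set0 -> J2 `&` J3 = set0 -> disc J1 D1 -> disc J2 D2 ->
  (forall j, sig J3 (G j)) -> (forall j, G j `<=` G j.+1) ->
  (forall w, (D1 w <= M)%N) -> (forall w, (D2 w <= M)%N) ->
  (forall j, (j < M)%N -> pr Q [set w | (j < D1 w)%N] <= pr Q [set w | (j < D2 w)%N]) ->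
  pr Q [set w | G (D1 w) w] <= pr Q [set w | G (D2 w) w].
Proof.
move=> d1 d2 dD1 dD2 sG mG b1 b2 H.
have sT (A : set (I -> R)) J : sig J A -> sig setT A by apply: sig_sub.
have sDG J (D : (I -> R) -> nat) : disc J D -> forall m, sig setT [set w | G (minn (D w) m) w].
  move=> dD m; apply: (disc_pred (D := D) (Q := fun c w => G (minn c m) w)).
    exact: disc_sub dD.
  by move=> c; exact: (sT _ J3 (sG (minn c m))).
have sD J (D : (I -> R) -> nat) m : disc J D -> sig J [set w | (m < D w)%N].
  by move=> dD; apply: (disc_pred dD (Q := fun c _ => (m < c)%N)) => c; exact: sig_cst.
have step J (D : (I -> R) -> nat) m : J `&` J3 = set0 -> disc J D ->
    pr Q [set w | G (minn (D w) m.+1) w] =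
    pr Q [set w | G (minn (D w) m) w] + pr Q [set w | (m < D w)%N] * pr Q (G m.+1 `&` ~` G m).
  move=> dJ dD; rewrite -(indep_sig iQ dJ (sD _ _ m dD)); last by apply: sigI => //; exact: sigC.
  rewrite -prU.
  - congr (pr Q _); apply/seteqP; split=> w; rewrite /setU /setI /setC /mkset /=.
      have [mD|Dm] := ltnP m (D w).
        rewrite (minn_idPr mD) => gw.
        by have [g|g] := pselect (G m w); [left|right].
      by rewrite (minn_idPl (leqW Dm)); left.
    have [mD|Dm] := ltnP m (D w).
      by rewrite (minn_idPr mD) => -[/mG|[_ []]].
    by rewrite (minn_idPl (leqW Dm)) => -[|[]].
  - exact: sDG dD m.
  - by apply: sigI; [apply: (sT _ J); exact: sD|apply: (sT _ J3); apply: sigI => //; exact: sigC].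
  - apply/seteqP; split=> w //= -[g [mD [_ ng]]]; apply: ng.
    by rewrite (minn_idPr (ltnW mD)) in g.
have main m : (m <= M)%N -> pr Q [set w | G (minn (D1 w) m) w] <= pr Q [set w | G (minn (D2 w) m) w].
  elim: m => [_|m IH lm].
    by rewrite (_ : [set w | G (minn (D1 w) 0) w] = [set w | G (minn (D2 w) 0) w]) //;
      apply/seteqP; split=> w /=; rewrite !minn0.
  rewrite (step J1) // (step J2) //; apply: lerD; first exact: IH (ltnW lm).
  by rewrite ler_wpM2r ?pr_ge0 // H.
have := main M (leqnn _).
have E (D : (I -> R) -> nat) : (forall w, (D w <= M)%N) ->
   [set w | G (minn (D w) M) w] = [set w | G (D w) w].
  by move=> b; apply/seteqP; split=> w /=; rewrite (minn_idPl (b w)).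
by rewrite !E.
Qed.

Definition on (K : eqType) (W : seq K) (s t : K -> nat) : K -> nat :=
  fun k => if k \in W then s k else t k.

Lemma sig_on (K : eqType) (J : K -> set I) (J3 : set I) (S : K -> (I -> R) -> nat)
    (F : (K -> nat) -> set (I -> R)) (W : seq K) t :
  (forall k, k \in W -> disc (J k) (S k)) -> (forall s, sig J3 (F s)) ->
  sig (\bigcup_(k in [set` W]) J k `|` J3) [set w | F (on W (S^~ w) t) w].
Proof.
move=> dS sF; set U := \bigcup_(_ in _) _ `|` _.
have dl : disc U (fun w => [seq S k w | k <- W]).
  by apply: disc_map => k kW; apply: disc_sub (dS k kW) => i Ji; left; exists k.
apply: (@sig_ext _ _ _ (fun w => F (on W (fun k => nth 0%N [seq S k w | k <- W] (index k W)) t) w)).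
  move=> w; suff -> : on W (fun k => nth 0%N [seq S k w | k <- W] (index k W)) t = on W (S^~ w) t by [].
  apply: funext => k; rewrite /on; case: ifP => // kW.
  by rewrite (nth_map k) ?index_mem // nth_index.
apply: (disc_pred dl (Q := fun c w => F (on W (fun k => nth 0%N c (index k W)) t) w)) => c.
by apply: (sig_sub (J := J3) _ (sF _)) => i Ji; right.
Qed.

(** With the state of [b] frozen, the other boxes are exchanged by induction; [replace_one] then
    exchanges [b] against the new states. *)
Lemma replace_all (K : eqType) (J1 J2 : K -> set I) (J3 : set I) (S1 S2 : K -> (I -> R) -> nat)
    (F : (K -> nat) -> set (I -> R)) (M : nat) (W : seq K) :
  uniq W ->
  (forall k k', k \in W -> k' \in W -> k != k' -> J1 k `&` J1 k' = set0) ->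
  (forall k k', k \in W -> k' \in W -> k != k' -> J2 k `&` J2 k' = set0) ->
  (forall k k', k \in W -> k' \in W -> J1 k `&` J2 k' = set0) ->
  (forall k, k \in W -> J1 k `&` J3 = set0) -> (forall k, k \in W -> J2 k `&` J3 = set0) ->
  (forall k, k \in W -> disc (J1 k) (S1 k)) -> (forall k, k \in W -> disc (J2 k) (S2 k)) ->
  (forall s, sig J3 (F s)) ->
  (forall s s', (forall k, (s k <= s' k)%N) -> F s `<=` F s') ->
  (forall k w, k \in W -> (S1 k w <= M)%N) -> (forall k w, k \in W -> (S2 k w <= M)%N) ->
  (forall k j, k \in W -> (j < M)%N ->
     pr Q [set w | (j < S1 k w)%N] <= pr Q [set w | (j < S2 k w)%N]) ->
  forall t, pr Q [set w | F (on W (S1^~ w) t) w] <= pr Q [set w | F (on W (S2^~ w) t) w].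
Proof.
elim: W => [|b W IH] /=; first by [].
move=> /andP[bW uW] dJ1 dJ2 dJ12 dJ13 dJ23 D1 D2 sF mF b1 b2 H t.
have inW k : k \in W -> k \in b :: W by rewrite inE => ->; rewrite orbT.
have bb : b \in b :: W by rewrite mem_head.
have nb k : k \in W -> b != k by apply: contraTneq => <-.
pose up (t : K -> nat) j := fun k => if k == b then j else t k.
have E (S : K -> (I -> R) -> nat) w : on (b :: W) (S^~ w) t = on W (S^~ w) (up t (S b w)).
  by apply: funext => k; rewrite /on /up inE; case: eqVneq => [->|//]; rewrite (negbTE bW).
have ext (S : K -> (I -> R) -> nat) : [set w | F (on (b :: W) (S^~ w) t) w] =
    [set w | F (on W (S^~ w) (up t (S b w))) w].
  by apply/seteqP; split=> w /=; rewrite E.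
rewrite !ext.
pose U (J : K -> set I) := \bigcup_(k in [set` W]) J k `|` J3.
have sU (J : K -> set I) (S : K -> (I -> R) -> nat) t' : (forall k, k \in W -> disc (J k) (S k)) ->
    sig (U J) [set w | F (on W (S^~ w) t') w].
  by move=> dS; exact: sig_on.
have dsj J J' : (forall k, k \in W -> J' `&` J k = set0) -> J' `&` J3 = set0 -> J' `&` U J = set0.
  move=> h1 h2; apply/seteqP; split=> i //; rewrite /U => -[Ji [[k kW Jk]|J3i]].
    by have : (J' `&` J k) i by []; rewrite h1.
  by have : (J' `&` J3) i by []; rewrite h2.
have W1 k : k \in W -> disc (J1 k) (S1 k) by move=> /inW; exact: D1.
have W2 k : k \in W -> disc (J2 k) (S2 k) by move=> /inW; exact: D2.
apply: (@le_trans _ _ (pr Q [set w | F (on W (S2^~ w) (up t (S1 b w))) w])).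
  apply: (cond_le iQ (J1 := J1 b) (J2 := U J1) (J3 := U J2) (D := S1 b)
    (A := fun c => [set w | F (on W (S1^~ w) (up t c)) w])
    (B := fun c => [set w | F (on W (S2^~ w) (up t c)) w])).
  - by apply: dsj => [k kW|]; [apply: dJ1 => //; [exact: inW|exact: nb]|exact: dJ13].
  - by apply: dsj => [k kW|]; [apply: dJ12 => //; exact: inW|exact: dJ13].
  - exact: D1.
  - by move=> c; apply: sU.
  - by move=> c; apply: sU.
  - move=> c; apply: IH => //.
    + by move=> k k' kW kW'; apply: dJ1; exact: inW.
    + by move=> k k' kW kW'; apply: dJ2; exact: inW.
    + by move=> k k' kW kW'; apply: dJ12; exact: inW.
    + by move=> k kW; apply: dJ13; exact: inW.
    + by move=> k kW; apply: dJ23; exact: inW.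
    + by move=> k w kW; apply: b1; exact: inW.
    + by move=> k w kW; apply: b2; exact: inW.
    + by move=> k j kW; apply: H; exact: inW.
apply: (@replace_one (J1 b) (J2 b) (U J2) (S1 b) (S2 b)
  (fun c => [set w | F (on W (S2^~ w) (up t c)) w]) M).
- by apply: dsj => [k kW|]; [apply: dJ12 => //; exact: inW|exact: dJ13].
- by apply: dsj => [k kW|]; [apply: dJ2 => //; [exact: inW|exact: nb]|exact: dJ23].
- exact: D1.
- exact: D2.
- by move=> c; apply: sU.
- move=> j w /=; apply: mF => k; rewrite /on /up; case: ifP => // _.
  by case: ifP.
- by move=> w; apply: b1.
- by move=> w; apply: b2.
- by move=> j; apply: H.
Qed.

(* Repeated coordinates are allowed, which only increases the probability. *)
Lemma pr_conds_ge (K : eqType) (s : seq K) (idx : K -> I) (B : K -> set R) (c : R) :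
  0 <= c <= 1 -> (forall k, k \in s -> measurable (B k)) ->
  (forall k k', k \in s -> k' \in s -> idx k = idx k' -> B k = B k') ->
  (forall k, k \in s -> c <= pr Q [set w | B k (w (idx k))]) ->
  c ^+ size s <= pr Q [set w | forall k, k \in s -> B k (w (idx k))].
Proof.
move=> /andP[c0 c1] mB cons H.
pose B' (i : I) := nth setT [seq B k | k <- s] (find (fun k => idx k == i) s).
have B'E k : k \in s -> B' (idx k) = B k.
  move=> ks; have hs : has (fun k' => idx k' == idx k) s by apply/hasP; exists k.
  rewrite /B' (nth_map k) -?has_find //; apply: cons => //.
    by rewrite mem_nth // -has_find.
  by apply/eqP; exact: (nth_find k hs).
have mB' i : measurable (B' i).
  rewrite /B'; have [hs|nhs] := boolP (has (fun k => idx k == i) s).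
    have [k _ _] := hasP hs.
    rewrite (nth_map k) -?has_find //; apply: mB; by rewrite mem_nth // -has_find.
  by rewrite nth_default // size_map leqNgt -has_find.
have -> : [set w | forall k, k \in s -> B k (w (idx k))] = box (undup (map idx s)) B'.
  apply/seteqP; split=> w /=.
    move=> hw i; rewrite mem_undup => /mapP[k ks ->]; rewrite B'E //; exact: hw.
  move=> hw k ks; rewrite -B'E //; apply: hw; rewrite mem_undup; exact: map_f.
rewrite iQ ?undup_uniq //.
apply: (@le_trans _ _ (c ^+ size (undup (map idx s)))).
  by apply: ler_wiXn2l => //; rewrite -(size_map idx); exact: size_undup.
have : forall i, i \in undup (map idx s) -> c <= pr Q [set w | B' i (w i)].
  by move=> i; rewrite mem_undup => /mapP[k ks ->]; rewrite B'E //; exact: H.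
elim: (undup _) => [|i l IHl] hl; first by rewrite expr0 big_nil.
rewrite big_cons exprS; apply: ler_pM => //; first exact: exprn_ge0.
  by apply: hl; rewrite mem_head.
by apply: IHl => j jl; apply: hl; rewrite inE jl orbT.
Qed.
End Replace.

Lemma unif_co (R : realType) (Q : probability (Om R Idx) R) i :
  (forall t, pr Q [set w | w i <= t] = Num.min (Num.max t 0) 1) ->
  forall a b : R, 0 <= a -> a <= b -> b <= 1 -> pr Q [set w | a <= w i < b] = b - a.
Proof.
move=> uQ a b a0 ab b1.
have sl t : sig setT [set w : Idx -> R | w i < t] by exact: sig_lt.
have := prD Q (sl b) (sl a); rewrite (unif_lt uQ) ?(le_trans a0 ab) //.
have -> : [set w : Idx -> R | w i < b] `&` [set w | w i < a] = [set w | w i < a].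
  by apply/seteqP; split=> w /=; [case|move=> h; split=> //; exact: lt_le_trans ab].
have -> : [set w : Idx -> R | w i < b] `&` ~` [set w | w i < a] = [set w | a <= w i < b].
  apply/seteqP; split=> w /=; first by case=> h1 /negP; rewrite -leNgt => ->.
  by move=> /andP[h1 h2]; split=> //; apply/negP; rewrite -leNgt.
rewrite (unif_lt uQ) ?a0 ?(le_trans ab b1) //; lra.
Qed.

(** * Vertex types from uniform variables *)

Section Types.
Variables (R : realType) (Rg : nat) (p h : R).
Hypothesis p0 : 0 < p.
Hypothesis p1 : p < 1.
Hypothesis h0 : 0 < h.
Definition NC : nat := #|{: Off Rg}|.
Hypothesis ph : NC%:R * h <= p * (1 - p).

Definition tyf (u : R) : Ty Rg :=
  if u < p then tO Rg else if u < p + NC%:R * h then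
    tH (nth (ord0, ord0) (enum {: Off Rg}) (Num.truncn ((u - p) / h))) else None.
Definition tq (t : Ty Rg) : R :=
  match t with None => 1 - p - NC%:R * h | Some None => p | Some (Some _) => h end.

Let pp : p + NC%:R * h < 1.
Proof. by have := p0; have := p1; have := ph; nra. Qed.

Lemma tyf_O u : tyf u = tO Rg <-> u < p.
Proof. by rewrite /tyf; case: ifP => // _; split=> //; case: ifP. Qed.

Lemma tyf_H u o : tyf u = tH o <-> p + (index o (enum {: Off Rg}))%:R * h <= u <
   p + (index o (enum {: Off Rg})).+1%:R * h.
Proof.
have io : (index o (enum {: Off Rg}) < NC)%N by rewrite /NC cardE index_mem mem_enum.
rewrite /tyf; split.
  case: ltP => // pu; case: ltP => // uC /(congr1 (fun t : Ty Rg => if t is Some (Some o) then o else (ord0, ord0))) /= <-.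
  have x0 : 0 <= (u - p) / h by rewrite divr_ge0 ?subr_ge0 // ltW.
  have := truncn_itv x0; set j := Num.truncn _ => /andP[j1 j2].
  have jC : (j < size (enum {: Off Rg}))%N.
    rewrite -cardE -/NC -(ltr_nat R); apply: le_lt_trans j1 _.
    by rewrite ltr_pdivrMr // ltrBlDl.
  rewrite index_uniq ?enum_uniq //; rewrite ler_pdivlMr // in j1; rewrite ltr_pdivrMr // in j2.
  by apply/andP; split; lra.
move: io; set i := index _ _ => io /andP[u1 u2].
have ih : 0 <= i%:R * h by rewrite mulr_ge0 // ltW.
have iC : i.+1%:R * h <= NC%:R * h by apply: ler_wpM2r; [exact: ltW|rewrite ler_nat].
rewrite ltNge (le_trans _ u1) /=; last by rewrite lerDl.
rewrite (lt_le_trans u2) ?lerD2l //.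
have -> : Num.truncn ((u - p) / h) = i.
  apply/eqP; rewrite truncn_eq; last by rewrite divr_ge0 ?(ltW h0) // subr_ge0; lra.
  by rewrite ler_pdivlMr // ltr_pdivrMr //; apply/andP; split; lra.
by rewrite /i nth_index // mem_enum.
Qed.

Lemma tyf_N u : tyf u = None <-> p + NC%:R * h <= u.
Proof.
rewrite /tyf; have nh : 0 <= NC%:R * h by rewrite mulr_ge0 // ltW.
by case: ltP => pu; [split=> // ?; exfalso; lra|case: ltP].
Qed.

Lemma tyf_meas t : measurable [set u | tyf u = t].
Proof.
case: t => [ [v|] |].
- rewrite (_ : [set _ | _] = `[p + (index v (enum {: Off Rg}))%:R * h,
     p + (index v (enum {: Off Rg})).+1%:R * h[%classic); first exact: measurable_itv.
  by apply/seteqP; split=> u; rewrite /= in_itv /= => /tyf_H.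
- rewrite (_ : [set _ | _] = `]-oo, p[%classic); first exact: measurable_itv.
  by apply/seteqP; split=> u; rewrite /= in_itv /= => /tyf_O.
- rewrite (_ : [set _ | _] = `[p + NC%:R * h, +oo[%classic); first exact: measurable_itv.
  by apply/seteqP; split=> u; rewrite /= in_itv /= andbT => /tyf_N.
Qed.

Lemma tq_gt0 t : 0 < tq t.
Proof. by case: t => [ [v|] |] //=; have := pp; lra. Qed.

Lemma tq_sum : \sum_t tq t = 1.
Proof.
rewrite (bigD1 None) //= (bigD1 (Some None)) //=.
rewrite (reindex_omap (fun o : Off Rg => Some (Some o))
  (fun t : Ty Rg => if t is Some (Some o) then Some o else None)); last by case=> [ [] |].
rewrite (eq_bigl xpredT) /=; last by move=> o /=; rewrite !eqxx.
rewrite big_const -/NC iter_addr_0 -mulr_natl; ring.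
Qed.

Lemma pr_tyf (Q : probability (Om R Idx) R) i t :
  (forall t, pr Q [set w | w i <= t] = Num.min (Num.max t 0) 1) ->
  pr Q [set w | tyf (w i) = t] = tq t.
Proof.
move=> uQ; have := pp; have nh : 0 <= NC%:R * h by rewrite mulr_ge0 // ltW.
move=> ppx; case: t => [ [v|] |].
- have io : (index v (enum {: Off Rg}) < NC)%N by rewrite /NC cardE index_mem mem_enum.
  rewrite (_ : [set _ | _] = [set w | p + (index v (enum {: Off Rg}))%:R * h <= w i <
     p + (index v (enum {: Off Rg})).+1%:R * h]); last first.
    by apply/seteqP; split=> u; rewrite /= => /tyf_H.
  move: io; set j := index _ _ => jC.
  have jh : 0 <= j%:R * h by rewrite mulr_ge0 // ltW.
  have jCh : j.+1%:R * h <= NC%:R * h by apply: ler_wpM2r; [exact: ltW|rewrite ler_nat].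
  have jS : j.+1%:R * h = j%:R * h + h by rewrite -natr1 mulrDl mul1r.
  rewrite unif_co //=; have := p0; have := h0; lra.
- rewrite (_ : [set _ | _] = [set w | w i < p]); last by apply/seteqP; split=> u /= /tyf_O.
  by rewrite (unif_lt uQ) //= !ltW.
- rewrite (_ : [set _ | _] = ~` [set w | w i < p + NC%:R * h]); last first.
    by apply/seteqP; split=> u /=; [move=> /tyf_N; rewrite leNgt => /negP|move=> /negP; rewrite -leNgt => /tyf_N].
  rewrite prC ?(unif_lt uQ) //=; first by ring.
    by have := p0; lra.
  exact: sig_lt.
Qed.

Lemma level_O u : tyf u = tO Rg -> level p (NC%:R * h) u = 1%N.
Proof. by move=> /tyf_O u1; rewrite /level u1. Qed.

Lemma level_H u o : tyf u = tH o -> level p (NC%:R * h) u = 2%N.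
Proof. by rewrite /tyf /level; case: ifP => // _; case: ifP. Qed.
End Types.

Lemma und_crt (V : set Lab) (E : Lab -> Lab -> Prop) O S :
  S `<=` V -> (forall x y, epair x y \in O -> gedge V E x y) ->
  forall z, und O S z -> exists a, S a /\ crt (gedge V E) a z.
Proof.
move=> SV H z; elim=> [x Sx|x y _ [a [Sa ax]] /H xy].
  by exists x; split=> //; exact: rt_refl.
by exists a; split=> //; apply: rt_trans ax _; exact: rt_step.
Qed.

Lemma thr_in th E S (V : Lab -> Prop) z : S `<=` V -> (forall x y, epair x y \in E -> V x /\ V y) ->
  thr th E S z -> V z.
Proof.
move=> SV H; elim=> [x /SV //|x y _ _ _ /H[]//|x x' y _ _ _ _ _ _ /H[]//].
Qed.

(** * From gadgets to bond percolation *)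

Section BondLayer.
Variables (R : realType) (f : R -> R) (r : R).
Hypothesis fdec : forall s t : R, 0 <= s -> s <= t -> f t <= f s.
Hypothesis r0 : 0 < r.
Hypothesis fr1 : forall s : R, 0 <= s -> 0 < f s -> s <= r.
Variables (Q : probability (Om R Idx) R) (lam : R).
Hypothesis lam0 : 0 < lam.
Hypothesis mQ : model Q lam.
Local Notation RG := (RG r).
Local Notation mm := (mm r).
Variables (p h : R).
Hypothesis p0 : 0 < p.
Hypothesis p1 : p < 1.
Hypothesis h0 : 0 < h.
Hypothesis ph : (NC RG)%:R * h <= p * (1 - p).
Variables (K : nat) (k0 : int * int) (n N : nat).

Local Notation tyf := (tyf RG p h).
Local Notation Wd := (window k0 (N + RG)).
Let iQ : indep Q. Proof. by case: mQ. Qed.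
Let uQ i t : isU i -> pr Q [set w | w i <= t] = Num.min (Num.max t 0) 1.
Proof. by case: mQ => _ _; apply. Qed.

Definition vsD (w : Idx -> R) : seq Lab := flatten [seq labs w k | k <- Wd].
Definition edD (vs : seq Lab) (w : Idx -> R) : seq (Lab * Lab) :=
  [seq e <- [seq epair a b | a <- vs, b <- vs] | `[< geo f w e.1 e.2 >]].
Definition rtD (vs : seq Lab) : set Lab := [set a | a \in vs /\ a.1 = k0].

Lemma mem_vsD w a : a \in vsD w <-> a.1 \in Wd /\ vertw w a.
Proof.
split; first by case/flattenP => s /mapP[k kW ->] /mem_labs [-> va].
move=> [aW va]; apply/flattenP; exists (labs w a.1); first exact: map_f.
by apply/mem_labs.
Qed.

Lemma mem_edD vs w x y : epair x y \in edD vs w <-> [/\ x \in vs, y \in vs & geo f w x y].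
Proof.
have gE a b : geo f w (epair a b).1 (epair a b).2 <-> geo f w a b.
  by case: (epair_cases a b) => -> //=; split; exact: geoC.
rewrite mem_filter; split.
  move=> /andP[/asboolP /gE g /allpairsP [[a b] [/= aV bV E]]]; split=> //.
    by case: (epair_eq E) => -[-> _].
  by case: (epair_eq E) => -[_ ->].
move=> [xV yV g]; apply/andP; split; first by apply/asboolP/gE.
by apply: allpairs_f.
Qed.

Let J1 : set Idx := [set i | if i is inl (inl _) then True else False].
Let J2 : set Idx := [set i | if i is inl (inr _) then True else False].
Let J3 : set Idx := [set i | if i is inr _ then True else False].

Let disc_D : disc J1 (fun w => (vsD w, edD (vsD w) w)).
Proof.
have d1 : disc J1 vsD.
  apply: (disc_comp (D := fun w => [seq labs w k | k <- Wd]) (fun l => flatten l)).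
  apply: disc_map => k _; apply: (disc_comp (D := fun w => nN w k) (fun m => [seq (k, i) | i <- iota 0 m])).
  exact: disc_nN.
move=> c; apply: (disc_pred d1 (Q := fun vs w => (vs, edD vs w) = c)) => vs.
have : disc J1 (fun w => (vs, edD vs w)); last exact.
apply: disc_pair; first exact: disc_cst.
apply: disc_filter => e _; apply: disc_asbool; apply: (sig_sub (J := JG)); last exact: sig_geo.
by move=> [[[[?|?]|?]|?]|?].
Qed.

Definition thrD (w : Idx -> R) : Lab -> Prop :=
  thr (theta (vsD w) (fun=> p) (fun=> (NC RG)%:R * h) w) (edD (vsD w) w) (rtD (vsD w)).

Let A (c : seq Lab * seq (Lab * Lab)) : set (Idx -> R) :=
  [set w | hits (far k0 n) (thr (theta c.1 (fun=> p) (fun=> (NC RG)%:R * h) w) c.2 (rtD c.1))].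
Let B (c : seq Lab * seq (Lab * Lab)) : set (Idx -> R) :=
  [set w | hits (far k0 n) (und (openE p c.2 w) (rtD c.1))].

Let sA' c : sig J2 (A c).
Proof. by apply: (@sig_theta _ J2 _ _ _ (fun th => hits (far k0 n) (thr th c.2 (rtD c.1)))). Qed.

Let sB' c : sig J3 (B c).
Proof. by apply: (@sig_open _ _ J3 _ (fun O => hits (far k0 n) (und O (rtD c.1)))). Qed.

Lemma sig_thrD : sig setT [set w | hits (far k0 n) (thrD w)].
Proof.
apply: (disc_pred (D := fun w => (vsD w, edD (vsD w) w)) (Q := A)); first exact: disc_sub disc_D.
by move=> c; exact: (sig_sub _ (sA' c)).
Qed.

(** The graph in the window is read from [J1]. With it frozen, the site variables in [J2] decide the
    thresholds and the bond variables in [J3] the open edges, and [bond_ge_threshold] applies. *)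
Lemma bond_thr : pr Q [set w | hits (far k0 n) (thrD w)] <= pr Q [set w | Rb f p w k0 n].
Proof.
apply: (@le_trans _ _ (pr Q [set w | B (vsD w, edD (vsD w) w) w])).
  apply: (cond_le iQ (J1 := J1) (J2 := J2) (J3 := J3) (D := fun w => (vsD w, edD (vsD w) w)) (A := A) (B := B)) => //.
  - by apply/seteqP; split=> // -[[?|?]|?] [].
  - by apply/seteqP; split=> // -[[?|?]|?] [].
  - move=> c; apply: (@bond_ge_threshold _ Q iQ uQ p _ _ (size c.2)) => //.
    + by rewrite ltW.
    + by move=> y; rewrite lexx ltW.
    + by move=> y; rewrite ph mulr_ge0 // ltW.
apply: pr_le.
- apply: (disc_pred (D := fun w => (vsD w, edD (vsD w) w)) (Q := B)); first exact: disc_sub disc_D.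
  by move=> c; exact: (sig_sub _ (sB' c)).
- exact: sig_Rb.
move=> w [z [uz fz]].
have [a [[aV ak] az]] : exists a, rtD (vsD w) a /\
   crt (gedge (vertw w) (fun a b => geo f w a b /\ w (iB (epair a b)) < p)) a z.
  apply: und_crt uz; first by move=> x [/mem_vsD []].
  move=> x y; rewrite mem_filter => /andP[we /mem_edD [xV yV g]].
  by split; [have /mem_vsD [] := xV|split=> //; have /mem_vsD [] := yV].
by exists a, z; split=> //; have /mem_vsD [] := aV.
Qed.

Definition gadA (m : seq (seq nat)) (w : Idx -> R) (b : int * int) : Prop :=
  (forall k, (bdist b k <= RG)%N -> (mm ^ 2 <= mget Wd m k (tH (off RG k b)))%N) /\
  (Zpos r w b /\ Zedge f r w K b).

(** A box with more than [K] ordinary vertices and no gadget is declared empty, since gadgets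
    control only the ordinary labels below [K]. Boxes beyond [N] are emptied so that all gadgets fit
    in the window. *)
Definition sA (m : seq (seq nat)) (w : Idx -> R) (b : int * int) : nat :=
  if (bdist k0 b <= N)%N then
    if `[< gadA m w b >] then K.+1
    else if (mget Wd m b (tO RG) <= K)%N then mget Wd m b (tO RG) else 0%N
  else 0%N.

Lemma reg_relab s (w : Idx -> R) : reg w -> reg (relab s w).
Proof. by move=> [H1 H2]; split=> [[a c]|e] /=; [exact: (H1 (s a, c))|exact: H2]. Qed.

(** Gadgets are described in terms of slots, the growth in terms of true labels; a slot counts as
    active when [sigma] sends it to an active vertex. *)
Lemma nreach_thr w : reg w ->
  let w' := relab (sigma (tfun Wd (tys tyf Wd w))) w in
  nreach f r w' K k0 (sA (map (@counts _) (tys tyf Wd w)) w') n ->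
  hits (far k0 n) (thrD w).
Proof.
move=> rw w'; set c := tfun Wd (tys tyf Wd w); set m := map _ _.
have cE k : k \in Wd -> c k = tseq tyf w k by exact: tfunE.
have mE k t : k \in Wd -> mget Wd m k t = count_mem t (tseq tyf w k) by exact: mget_counts.
pose pres (x : Lab) := exists k t i, [/\ x = slot k t i, k \in Wd & (i < count_mem t (tseq tyf w k))%N].
pose act (x : Lab) := thrD w (sigma c x).
have presV x : pres x -> sigma c x \in vsD w.
  move=> [k [t [i [-> kW it]]]]; apply/mem_vsD; rewrite sigma_slot cE //; split=> //.
  apply/vertwE => /=; have [] := occP it; by rewrite size_map size_iota.
have presL k t i : k \in Wd -> (i < count_mem t (tseq tyf w k))%N ->
    theta (vsD w) (fun=> p) (fun=> (NC RG)%:R * h) w (sigma c (slot k t i)) =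
    level p ((NC RG)%:R * h) (w (iS (sigma c (slot k t i)))) /\
    tyf (w (iS (sigma c (slot k t i)))) = t.
  move=> kW it; rewrite thetaE presV; last by exists k, t, i.
  rewrite sigma_slot cE //; split=> //.
  have [lt /(_ t)] := occP it; rewrite size_map size_iota in lt.
  by rewrite (nth_map 0%N) ?size_iota // nth_iota.
have actV x : act x -> sigma c x \in vsD w.
  apply: (@thr_in _ _ _ (fun z => z \in vsD w)); first by move=> z [].
  by move=> y z /mem_edD [].
have gW x y : geo f w' x y <-> geo f w (sigma c x) (sigma c y).
  by apply: geo_relab; [exact: sigma_inj|exact: sigma_box].
have slotW k t i : pres (slot k t i) -> k \in Wd /\ (i < count_mem t (tseq tyf w k))%N.
  by move=> [k' [t' [i' [/slot_inj [-> -> ->]]]]].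
move=> nr.
have NW k b : (bdist k0 b <= N)%N -> (bdist b k <= RG)%N -> k \in Wd.
  move=> h1 h2; rewrite mem_window; apply: leq_trans (bdist_tri k0 b k) _; exact: leq_add.
have NW0 b : (bdist k0 b <= N)%N -> b \in Wd by move=> h1; apply: (NW b b) => //; rewrite bdistxx.
suff [x [ax fx]] : exists x, act x /\ (n <= bdist k0 x.1)%N.
  by exists (sigma c x); split=> //; rewrite /far /= sigma_box.
apply: (@nreach_act R f r fdec r0 fr1 w' K (reg_relab _ rw) pres act k0 _ _ _ _ _ _ n nr).
- move=> x px xk; apply: thr0; split; first exact: presV.
  by rewrite sigma_box.
- move=> k i y px ay gx; have [kW ik] := slotW _ _ _ px; have [th1 th2] := presL _ _ _ kW ik.
  apply: (thr1 (x := sigma c y)) => //; first by rewrite th1; exact: level_O.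
  by apply/mem_edD; split; [exact: actV|exact: presV|exact/gW].
- move=> b g y y' pb ib ay ay' nyy gy gy'.
  have [kW ik] := slotW _ _ _ pb; have [th1 th2] := presL _ _ _ kW ik.
  apply: (thr2 (x := sigma c y) (x' := sigma c y')) => //.
  + by move=> /sigma_inj.
  + by rewrite th1; exact: level_H th2.
  + by apply/mem_edD; split; [exact: actV|exact: presV|exact/gW].
  + by apply/mem_edD; split; [exact: actV|exact: presV|exact/gW].
- move=> k; rewrite /sA; case: leqP => // kN; case: asboolP => [[H [Zp Ze]] _|_].
    split=> // g ig; exists (boxof mm g), (tH (off RG (boxof mm g) k)), (subof mm g).
    have gW' : boxof mm g \in Wd by apply: NW kN _.
    split=> //; rewrite -mE //; apply: leq_trans (H _ ig); exact: subof_lt.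
  by case: ifP => // h1 h2; rewrite h2 ltnn in h1.
- move=> k i; rewrite /sA; case: (leqP (bdist k0 k) N) => // kN; case: asboolP => [_|_]; first by rewrite ltnn.
  case: ifP => // _ _; rewrite mE ?NW0 // => ik.
  by exists k, (tO RG), i; split=> //; exact: NW0.
Qed.

Lemma sig_Zpos (J : set Idx) b : (forall g e, inR RG mm b g -> J (iX (hl RG mm b g) e)) ->
  sig J [set w : Idx -> R | Zpos r w b].
Proof.
move=> HJ; apply: sig_all => g.
have [ig|ng] := boolP (inR RG mm b g); last by apply: sig_triv => w.
have S z e : sig J [set w : Idx -> R | z%:~R <= mm%:R * w (iX (hl RG mm b g) e) <= z%:~R + 1].
  apply: (sig_coord (B := [set u : R | z%:~R <= mm%:R * u <= z%:~R + 1])); first exact: HJ.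
  rewrite (_ : [set _ | _] = `[z%:~R / mm%:R, (z%:~R + 1) / mm%:R]%classic); first exact: measurable_itv.
  by apply/seteqP; split=> u /=; rewrite in_itv /= ler_pdivrMr ?ler_pdivlMr ?(mm_gt0 r) // !(mulrC u).
by apply: sig_imp; [exact: sig_cst|apply: sig_and; exact: S].
Qed.

Lemma sig_Zedge (J : set Idx) b : (forall g x, inR RG mm b g -> Xslot r K b x ->
  x <> hl RG mm b g -> J (iE (epair (hl RG mm b g) x))) ->
  sig J [set w : Idx -> R | Zedge f r w K b].
Proof.
move=> HJ; apply: sig_all => g; apply: sig_all => x.
have [ig|ng] := boolP (inR RG mm b g); last by apply: sig_triv => w.
have [xs|nx] := pselect (Xslot r K b x); last by apply: sig_triv.
have [xh|nh] := pselect (x = hl RG mm b g); first by apply: sig_triv.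
apply: (@sig_ext _ _ _ (fun w => w (iE (epair (hl RG mm b g) x)) < c0 f r)); first by move=> w; split=> // H; exact: H.
by apply: sig_lt; exact: HJ.
Qed.

Lemma sig_nreach (J : set Idx) (S : (Idx -> R) -> int * int -> nat) :
  (forall b, disc J (S^~ b)) ->
  (forall k i k' i', sig J [set w | geo f w (ol RG k i) (ol RG k' i')]) ->
  sig J [set w | nreach f r w K k0 (S w) n].
Proof.
move=> dS sg; apply: sig_and.
  by apply: (disc_pred (dS k0) (Q := fun c _ => c = K.+1)) => c; exact: sig_cst.
apply: sig_ex => x; apply: sig_and; first exact: sig_cst.
apply: sig_crt => y z; rewrite /nstep.
have ok u : sig J [set w | nodeok K (S w) u].
  rewrite /nodeok; case: u => k [i|] /=.
    by apply: (disc_pred (dS k) (Q := fun c _ => (c <= K)%N /\ (i < c)%N)) => c; exact: sig_cst.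
  by apply: (disc_pred (dS k) (Q := fun c _ => c = K.+1)) => c; exact: sig_cst.
apply: (@sig_ext _ _ _ (fun w => nodeok K (S w) y /\ (nodeok K (S w) z /\ nedge f r w y z))).
  by move=> w; split=> [[? []]|[]].
apply: sig_and => //; apply: sig_and => //; apply: sig_and; first exact: sig_cst.
by case: y z => [? [?|]] [? [?|]] /=; first exact: sg; exact: sig_cst.
Qed.

Lemma sig_nreach_sA m : sig JG [set w | nreach f r w K k0 (sA m w) n].
Proof.
apply: sig_nreach => [b|k i k' i']; last exact: sig_geo.
have sg : sig JG [set w | gadA m w b].
  apply: sig_and; first exact: sig_cst.
  apply: sig_and; first exact: sig_Zpos.
  apply: sig_Zedge => g x ig xs nh; apply: (@epair_lt (hl RG mm b g) x); apply/eqP => E; exact: nh.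
apply: (disc_comp (D := fun w => `[< gadA m w b >])
  (fun t : bool => if (bdist k0 b <= N)%N then if t then K.+1
  else if (mget Wd m b (tO RG) <= K)%N then mget Wd m b (tO RG) else 0%N else 0%N)).
exact: disc_asbool.
Qed.

Lemma bond_layer : pr Q [set w | nreach f r w K k0 (sA (mcounts lam (@tq R RG p h) Wd w) w) n] <=
  pr Q [set w | Rb f p w k0 n].
Proof.
apply: le_trans bond_thr.
pose S (m : seq (seq nat)) := [set w | nreach f r w K k0 (sA m w) n].
have sS m : sig JG (S m) by exact: sig_nreach_sA.
have mty t : measurable [set u | tyf u = t] by exact: tyf_meas.
have tq0 := tq_gt0 p0 p1 h0 ph.
have q1 : \sum_(t : Ty RG) @tq R RG p h t = 1 by apply: tq_sum.
have qE a t : pr Q [set w | tyf (w (iS a)) = t] = @tq R RG p h t by apply: pr_tyf => // u; exact: uQ.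
have E := layer_eq lam0 mQ mty tq0 q1 qE (window_uniq k0 (N + RG)) sS.
rewrite -[leLHS]E; apply: (pr_as_le (O := [set w | reg w])).
- exact: sig_reg.
- apply: (disc_pred (D := tys tyf Wd) (Q := fun c w => S (map (@counts _) c) (relab (sigma (tfun Wd c)) w))).
    have dT : disc (JNS Wd) (tys tyf Wd) by exact: disc_tys.
    exact: disc_sub dT.
  move=> c; apply: (sig_sub (J := JG)) => //; apply: sig_relab => //; exact: sigma_inj.
- exact: sig_thrD.
- exact: pr_reg mQ.
by move=> w [Sw rw]; exact: nreach_thr.
Qed.
End BondLayer.

(** * The probability of a gadget *)

Section GadgetLaw.
Variables (R : realType) (f : R -> R) (r : R).
Hypothesis fdec : forall s t : R, 0 <= s -> s <= t -> f t <= f s.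
Hypothesis f01 : forall s : R, 0 <= s -> 0 <= f s <= 1.
Hypothesis r0 : 0 < r.
Hypothesis fr2 : forall s : R, 0 <= s -> s < r -> 0 < f s.
Variables (Q : probability (Om R Idx) R) (lam : R).
Hypothesis lam0 : 0 < lam.
Hypothesis mQ : model Q lam.
Local Notation RG := (RG r).
Local Notation mm := (mm r).
Local Notation hl := (hl RG mm).
Local Notation ol := (ol RG).
Local Notation inR := (inR RG mm).
Variables (h : R).
Hypothesis h0 : 0 < h.
Variables (K : nat).
Let iQ : indep Q. Proof. by case: mQ. Qed.
Let uQ i t : isU i -> pr Q [set w | w i <= t] = Num.min (Num.max t 0) 1.
Proof. by case: mQ => _ _; apply. Qed.
Local Notation cH k b := (cM k (tH (off RG k b))).

Definition gadM (w : Idx -> R) (b : int * int) : Prop :=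
  (forall k, (bdist b k <= RG)%N -> (mm ^ 2 <= qn (lam * h) (w (cH k b)))%N) /\
  (Zpos r w b /\ Zedge f r w K b).

Definition JGad (b : int * int) : set Idx := [set i |
  [\/ exists k, (bdist b k <= RG)%N /\ i = cH k b,
      exists g e, inR b g /\ i = iX (hl b g) e |
      exists g x, [/\ inR b g, Xslot r K b x, x <> hl b g & i = iE (epair (hl b g) x)]]].

Definition JBox (b : int * int) : set Idx := JGad b `|` [set cM b (tO RG)].

Definition JOl : set Idx := [set i | (exists k i' e, i = iX (ol k i') e) \/
  (exists k i' l j, i = iE (epair (ol k i') (ol l j)))].

Lemma iX_inj a e a' e' : iX a e = iX a' e' -> a = a' /\ e = e'.
Proof. by case=> -> ->. Qed.

Lemma iE_inj e e' : iE e = iE e' -> e = e'. Proof. by case. Qed.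

Lemma cM_inj2 (k k' : int * int) (t t' : Ty RG) : cM k t = cM k' t' -> k = k' /\ t = t'.
Proof. by move=> H; have kk : k = k' by [case: H]; subst k'; split=> //; exact: cM_inj H. Qed.

Lemma tH_inj (u v : Off RG) : tH u = tH v -> u = v. Proof. by case. Qed.

(** Count and position variables name [b] through the offset in the type. An edge variable is the
    delicate case, settled by the order on codes. *)
Lemma JGad_disj b b' i : JGad b i -> JGad b' i -> b = b'.
Proof.
case=> [[k [bk ->]]|[g [e [ig ->]]]|[g [x [ig xs xh ->]]]];
case=> [[k' [bk' E]]|[g' [e' [ig' E]]]|[g' [x' [ig' xs' xh' E]]]] //.
- have [kk /tH_inj E2] := cM_inj2 E; rewrite -kk in E2 bk'.
  by apply: (off_inj (mm1 r) _ _ E2); rewrite bdistC.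
- by have [/(hl_inj (mm1 r) ig ig') []] := iX_inj E.
- have [[E1 _]|[E1 E2]] := epair_eq (iE_inj E).
    by have [] := hl_inj (mm1 r) ig ig' E1.
  (* If an edge between helping vertices belonged to both gadgets, each code would be at most the
     other. *)
  have H (b1 b2 : int * int) g1 : inR b1 g1 -> Xslot r K b2 (hl b1 g1) -> (pickle b2 <= pickle b1)%N.
    move=> i1 [[k [j [_ _ /esym /ol_hl //]]]|[b3 [g3 [_ i3 le E3]]]].
    by have [-> _] := hl_inj (mm1 r) i1 i3 E3.
  have l1 : (pickle b' <= pickle b)%N by apply: H ig _; rewrite E1.
  have l2 : (pickle b <= pickle b')%N by apply: H ig' _; rewrite -E2.
  by apply: (pcan_inj pickleK); apply/eqP; rewrite eqn_leq l1 l2.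
Qed.

Lemma JGad_tO b b' : ~ JGad b (cM b' (tO RG)).
Proof. by case=> [[k [_ /cM_inj2 []]]|[g [e []]]|[g [x []]]]. Qed.

Lemma JBox_disj b b' : b != b' -> JBox b `&` JBox b' = set0.
Proof.
move=> nb; apply/seteqP; split=> // i [[H1|->] [H2|E]].
- by rewrite (JGad_disj H1 H2) eqxx in nb.
- by rewrite E in H1; case: (JGad_tO H1).
- by case: (JGad_tO H2).
- by have [bb _] := cM_inj2 E; rewrite bb eqxx in nb.
Qed.

Lemma JBox_JOl b : JBox b `&` JOl = set0.
Proof.
apply/seteqP; split=> // i [[]]; last by move=> -> [[k [i' [e]]]|[k [i' [l [j]]]]].
case=> [[k [_ ->]]|[g [e [ig ->]]]|[g [x [ig xs xh ->]]]] [[k' [i' [e' E]]]|[k' [i' [l [j E]]]]] //.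
- by have [/esym /ol_hl] := iX_inj E.
- by have [[/esym /ol_hl]|[/esym /ol_hl]] := epair_eq (iE_inj E).
Qed.

Lemma JBox_cN b b' : [set cN b] `&` JBox b' = set0.
Proof.
apply/seteqP; split=> // i [-> [[[k [_]]|[g [e []]]|[g [x []]]]|]] //.
Qed.

Lemma cN_JOl b : [set cN b] `&` JOl = set0.
Proof. by apply/seteqP; split=> // i [-> [[k [i' [e]]]|[k [i' [l [j]]]]]]. Qed.

Lemma cN_disj b b' : b != b' -> [set cN b] `&` [set cN b'] = set0 :> set Idx.
Proof. by move=> nb; apply/seteqP; split=> // i [-> [E _]]; rewrite E eqxx in nb. Qed.

Let lh : 0 < lam * h. Proof. exact: mulr_gt0. Qed.

Lemma sig_gadM b : sig (JGad b) [set w | gadM w b].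
Proof.
apply: sig_and.
  apply: sig_all => k; have [bk|nb] := boolP (bdist b k <= RG)%N; last by apply: sig_triv.
  apply: sig_imp; first exact: sig_cst.
  apply: (disc_pred (D := fun w => qn (lam * h) (w (cH k b))) (Q := fun c _ => (mm ^ 2 <= c)%N)).
    by apply: disc_qn => //; apply: Or31; exists k.
  by move=> c; exact: sig_cst.
apply: sig_and.
  by apply: sig_Zpos => g e ig; apply: Or32; exists g, e.
by apply: sig_Zedge => g x ig xs nh; apply: Or33; exists g, x.
Qed.

Definition squares (b : int * int) : seq (int * int) :=
  [seq ((k.1 * mm%:Z + ij.1%:Z)%R, (k.2 * mm%:Z + ij.2%:Z)%R) | k <- window b RG,
    ij <- [seq (i, j) | i <- iota 0 mm, j <- iota 0 mm]].

Lemma size_squares b : size (squares b) = (RG.*2.+1 ^ 2 * (mm * mm))%N.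
Proof. by rewrite !size_allpairs size_window !size_iota. Qed.

Lemma mem_squares b g : inR b g -> g \in squares b.
Proof.
move=> ig; apply/allpairsP.
have m0 g' := @modz_ge0 g' mm isT; have ml g' := @ltz_pmod g' mm isT.
exists (boxof mm g, (absz (g.1 %% mm)%Z, absz (g.2 %% mm)%Z)); split.
- by rewrite mem_window.
- apply: (allpairs_f pair); rewrite mem_iota /=.
    have := m0 g.1; have := ml g.1; move: (g.1 %% mm)%Z (mm) => u m; clear; lia.
  have := m0 g.2; have := ml g.2; move: (g.2 %% mm)%Z (mm) => u m; clear; lia.
- by rewrite /= !gez0_abs ?m0 // -!divz_eq; case: (g).
Qed.

Definition slots (b : int * int) : seq Lab :=
  [seq ol k i | k <- window b RG, i <- iota 0 K] ++
  [seq hl b' g | b' <- window b RG, g <- squares b'].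

Lemma size_slots b : size (slots b) =
  (RG.*2.+1 ^ 2 * K + RG.*2.+1 ^ 2 * (RG.*2.+1 ^ 2 * (mm * mm)))%N.
Proof.
rewrite size_cat size_allpairs size_window size_iota; congr addn.
rewrite size_allpairs_dep.
rewrite (eq_map (g := fun=> (RG.*2.+1 ^ 2 * (mm * mm))%N)); last exact: size_squares.
set C := (RG.*2.+1 ^ 2 * (mm * mm))%N; rewrite -(size_window b RG); elim: (window b RG) => //= a l ->.
by rewrite mulSn.
Qed.

Lemma mem_slots b x : Xslot r K b x -> x \in slots b.
Proof.
rewrite mem_cat => -[[k [i [bk iK ->]]]|[b' [g [bb ig _ ->]]]].
  by rewrite allpairs_f // ?mem_window // mem_iota.
by apply/orP; right; apply: allpairs_f_dep; [rewrite mem_window|exact: mem_squares].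
Qed.

Lemma pr_qn_lt (mu : R) i j : 0 < mu -> isU i -> pr Q [set w | (qn mu (w i) < j)%N] = psum mu j.
Proof.
move=> m0 ui; have dq : disc setT (fun w => qn mu (w i)) by exact: disc_qn.
have := pr_disc_sum Q dq (iota_uniq 0 j).
rewrite (_ : [set w | qn mu (w i) \in iota 0 j] = [set w | (qn mu (w i) < j)%N]); last first.
  by apply/seteqP; split=> w /=; rewrite mem_iota.
move=> ->; rewrite /psum -(big_mkord xpredT (poisson_pmf mu)) /index_iota subn0.
by apply: eq_bigr => k _; exact: (pr_qn mQ).
Qed.

Lemma pr_qn_ge (mu : R) i j : 0 < mu -> isU i -> pr Q [set w | (j <= qn mu (w i))%N] = 1 - psum mu j.
Proof.
move=> m0 ui; rewrite -(pr_qn_lt (i := i)) // -prC; last first.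
  have dq : disc setT (fun w : Idx -> R => qn mu (w i)) by exact: disc_qn.
  by apply: (disc_pred dq (Q := fun c _ => (c < j)%N)) => c; exact: sig_cst.
congr (pr Q _); apply/seteqP; split=> w /=; first by move=> h1; apply/negP; rewrite -leqNgt.
by move=> /negP; rewrite -leqNgt.
Qed.

(** A bound common to the three kinds of conditions: enough helping vertices of a type in a box, a
    coordinate in an interval of length [1 / mm], an edge variable below [c0]. *)
Definition cg : R := Num.min (1 - psum (lam * h) (mm ^ 2)) (Num.min mm%:R^-1 (c0 f r)).

Lemma cg_gt0 : 0 < cg.
Proof.
rewrite /cg !lt_min; apply/and3P; split.
- have := psum_le1 lh (mm ^ 2).+1; rewrite psumS.
  have : 0 < poisson_pmf (lam * h) (mm ^ 2).
    by rewrite pmfE // mulr_gt0 ?expR_gt0 // divr_gt0 ?exprn_gt0 // ltr0n fact_gt0.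
  lra.
- by rewrite invr_gt0; exact: mm_gt0.
- by apply: fr2; have := r0; lra.
Qed.

Lemma cg_le1 : cg <= 1.
Proof.
rewrite /cg ge_min; apply/orP; right; rewrite ge_min; apply/orP; left.
by rewrite invf_le1 ?ler1n // mm_gt0.
Qed.

(* [CA + CB * K] bounds the number of single-variable conditions in a gadget. *)
Definition CA : nat := (RG.*2.+1 ^ 2 + ((RG.*2.+1 ^ 2 * (mm * mm)) * 2 +
  (RG.*2.+1 ^ 2 * (mm * mm)) * (RG.*2.+1 ^ 2 * (RG.*2.+1 ^ 2 * (mm * mm)))))%N.
Definition CB : nat := ((RG.*2.+1 ^ 2 * (mm * mm)) * (RG.*2.+1 ^ 2))%N.

(** The gadget follows from finitely many conditions on single variables, each costing at most a
    factor [cg]. *)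
Lemma pr_gadM b : cg ^+ (CA + CB * K) <= pr Q [set w | gadM w b].
Proof.
pose T := (((int * int) + ((int * int) * bool)) + ((int * int) * Lab))%type.
pose all : seq T := [seq inl (inl k) | k <- window b RG] ++
  ([seq inl (inr (g, e)) | g <- squares b, e <- [:: false; true]] ++
   [seq inr (g, x) | g <- squares b, x <- slots b]).
have sall : size all = (CA + CB * K)%N.
  have := size_squares b; have := size_slots b; rewrite /all.
  move: (squares b) (slots b) => sq sl Esl Esq.
  rewrite !size_cat size_map !size_allpairs Esq Esl size_window /CA /CB /=.
  by move: (RG.*2.+1 ^ 2)%N (mm) => u v; clear; nia.
pose ok (t : T) : bool := match t with inl (inl _) => true | inl (inr (g, _)) => inR b g
  | inr (g, x) => inR b g && (x != hl b g) end.
pose idx (t : T) : Idx := match t with inl (inl k) => cH k b | inl (inr (g, e)) => iX (hl b g) e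
  | inr (g, x) => iE (epair (hl b g) x) end.
pose B (t : T) : set R := match t with inl (inl k) => [set u | (mm ^ 2 <= qn (lam * h) u)%N]
  | inl (inr (g, e)) => [set u | ((if e then g.2 else g.1) %% mm)%Z%:~R <= mm%:R * u <= ((if e then g.2 else g.1) %% mm)%Z%:~R + 1]
  | inr (g, x) => [set u | u < c0 f r] end.
pose s := [seq t <- all | ok t].
have [c0' c1'] := (ltW cg_gt0, cg_le1).
apply: (@le_trans _ _ (cg ^+ size s)).
  by apply: ler_wiXn2l => //; rewrite -sall size_filter; exact: count_size.
have sub : [set w | forall k, k \in s -> B k (w (idx k))] `<=` [set w | gadM w b].
  move=> w H; split; last split.
  - move=> k bk; apply: (H (inl (inl k))).
    by rewrite mem_filter mem_cat; apply/orP; left; apply: map_f; rewrite mem_window.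
  - move=> g ig; have K1 e : inl (inr (g, e)) \in s.
      rewrite mem_filter /= ig /= mem_cat; apply/orP; right; rewrite mem_cat; apply/orP; left.
      by apply: (allpairs_f (fun g e => inl (inr (g, e)))); [exact: mem_squares|case: (e)].
    by split; [exact: (H _ (K1 false))|exact: (H _ (K1 true))].
  - move=> g x ig xs xh; apply: (H (inr (g, x))); rewrite mem_filter /= ig /=.
    apply/andP; split; first exact/eqP.
    rewrite mem_cat; apply/orP; right; rewrite mem_cat; apply/orP; right.
    by apply: (allpairs_f (fun g x => inr (g, x))); [exact: mem_squares|exact: mem_slots].
have mB t : measurable (B t).
  case: t => [[k|[g e]]|[g x]] /=.
  - rewrite (_ : [set _ | _] = \bigcup_(j in [set j | (mm ^ 2 <= j)%N]) [set u | qn (lam * h) u = j]).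
      by apply: bigcup_measurable => j _; exact: qn_meas.
    by apply/seteqP; split=> u /=; [move=> H; exists (qn (lam * h) u)|case=> j ? ->].
  - set z := (_ %% _)%Z.
    rewrite (_ : [set _ | _] = `[z%:~R / mm%:R, (z%:~R + 1) / mm%:R]%classic); first exact: measurable_itv.
    by apply/seteqP; split=> u /=; rewrite in_itv /= ler_pdivrMr ?ler_pdivlMr ?(mm_gt0 r) // !(mulrC u).
  - rewrite (_ : [set _ | _] = `]-oo, c0 f r[%classic); first exact: measurable_itv.
    by apply/seteqP; split=> u /=; rewrite in_itv.
have sB : sig setT [set w : Idx -> R | forall k, k \in s -> B k (w (idx k))].
  apply: sig_all => t; apply: sig_imp; first exact: sig_cst.
  exact: sig_coord.
have sG : sig setT [set w | gadM w b] by apply: (@sig_sub _ _ (JGad b) setT) => //; exact: sig_gadM.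
apply: le_trans (pr_le Q sB sG sub).
apply: pr_conds_ge => //; first by rewrite c0' c1'.
- move=> [[k|[g e]]|[g x]] [[k'|[g' e']]|[g' x']] //.
  rewrite !mem_filter => /andP[/= ig _] /andP[/= ig' _] /iX_inj [/(hl_inj (mm1 r) ig ig') [_ ->] ->] //.
- move=> [[k|[g e]]|[g x]]; rewrite mem_filter => /andP[okt _] /=.
  + by rewrite pr_qn_ge // /cg ge_min lexx.
  + set z := (_ %% _)%Z.
    have z0 : 0 <= z%:~R :> R by rewrite ler0z modz_ge0.
    have z1 : z%:~R + 1 <= mm%:R :> R.
      by rewrite -[mm%:R]/(mm%:Z%:~R) -[1]/(1%:~R) -intrD ler_int lezD1 ltz_pmod.
    have m0 := mm_gt0 r.
    apply: (@le_trans _ _ (mm%:R^-1)); first by rewrite /cg !ge_min lexx orbT.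
    rewrite (_ : mm%:R^-1 = (z%:~R + 1) / mm%:R - z%:~R / mm%:R); last by rewrite -mulrBl addrAC subrr add0r mul1r.
    rewrite -(unif_co (Q := Q) (i := iX (hl b g) e)).
    * have SC (B' : set R) : measurable B' -> sig setT [set w : Idx -> R | B' (w (iX (hl b g) e))].
        by apply: sig_coord.
      apply: pr_le.
      + rewrite (_ : [set _ | _] = [set w : Idx -> R | `[z%:~R / mm%:R, (z%:~R + 1) / mm%:R[%classic (w (iX (hl b g) e))]).
          exact: SC (measurable_itv _).
        by apply/seteqP; split=> w /=; rewrite in_itv.
      + exact: (SC _ (mB (inl (inr (g, e))))).
      + move=> w /=; rewrite ler_pdivrMr // ltr_pdivlMr // !(mulrC (w _)) => /andP[h1 h2].
        by rewrite h1 ltW.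
    * by move=> t; exact: uQ.
    * by rewrite divr_ge0 // ltW.
    * by rewrite ler_pM2r ?invr_gt0 // lerDl.
    * by rewrite ler_pdivrMr // mul1r.
  + rewrite (unif_lt (i := iE (epair (hl b g) x))); first by rewrite /cg !ge_min lexx !orbT.
      by move=> t; exact: uQ.
    by apply: f01; have := r0; lra.
Qed.
End GadgetLaw.

Lemma crt_map (A B : Type) (rA : A -> A -> Prop) (rB : B -> B -> Prop) (nu : A -> B) a b :
  (forall x y, rA x y -> rB (nu x) (nu y)) ->
  clos_refl_trans A rA a b -> clos_refl_trans B rB (nu a) (nu b).
Proof.
move=> H; elim=> [x y /H xy|x|x y z _ xy _ yz]; first exact: rt_step.
  exact: rt_refl.
exact: rt_trans xy yz.
Qed.

(** * Bonds dominate a larger intensity *)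

Section Domination.
Variables (R : realType) (f : R -> R) (r : R).
Hypothesis fdec : forall s t : R, 0 <= s -> s <= t -> f t <= f s.
Hypothesis f01 : forall s : R, 0 <= s -> 0 <= f s <= 1.
Hypothesis r0 : 0 < r.
Hypothesis fr1 : forall s : R, 0 <= s -> 0 < f s -> s <= r.
Hypothesis fr2 : forall s : R, 0 <= s -> s < r -> 0 < f s.
Variables (Q : probability (Om R Idx) R) (lam : R).
Hypothesis lam0 : 0 < lam.
Hypothesis mQ : model Q lam.
Local Notation RG := (RG r).
Local Notation mm := (mm r).
Local Notation ol := (ol RG).
Variables (p h : R).
Hypothesis p0 : 0 < p.
Hypothesis p1 : p < 1.
Hypothesis h0 : 0 < h.
Hypothesis ph : (NC RG)%:R * h <= p * (1 - p).
Variables (K : nat) (mu1 : R).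
Hypothesis mu1l : lam * p <= mu1.
(** On the left the losses in a box: overfull boxes declared empty, and the excess of intensity. On
    the right a lower bound for the gain: a gadget in a box without ordinary vertices. *)
Hypothesis dom : 1 - psum (lam * p) K.+1 + (mu1 - lam * p) <=
  cg f r lam h ^+ (CA r + CB r * K) * expR (- (lam * p)).
Let iQ : indep Q. Proof. by case: mQ. Qed.
Let lp : 0 < lam * p. Proof. exact: mulr_gt0. Qed.
Let m1 : 0 < mu1. Proof. exact: lt_le_trans mu1l. Qed.

(** An overfull box takes the top state in [S1], more than its points deserve; in [S2] it is empty
    unless a gadget is there. *)
Definition S1 (b : int * int) (w : Idx -> R) : nat := minn (qn mu1 (w (cN b))) K.+1.
Definition S2 (b : int * int) (w : Idx -> R) : nat :=
  if `[< gadM f r lam h K w b >] then K.+1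
  else if (qn (lam * p) (w (cM b (tO RG))) <= K)%N then qn (lam * p) (w (cM b (tO RG))) else 0%N.

(** When a box rises to state [K.+1], its nodes collapse onto the gadget node. No link is lost,
    since links with a gadget ask only for close boxes. *)
Lemma nreach_mono w k0 n s s' : (forall k, (s k <= s' k)%N) -> (forall k, (s' k <= K.+1)%N) ->
  nreach f r w K k0 s n -> nreach f r w K k0 s' n.
Proof.
move=> ss sK [sk [x [fx cx]]].
have top k : s k = K.+1 -> s' k = K.+1.
  by move=> E; apply/eqP; rewrite eqn_leq sK -E ss.
pose nu (x : Node) : Node := if s' x.1 == K.+1 then (x.1, None) else x.
have nu1 y : (nu y).1 = y.1 by rewrite /nu; case: ifP.
have okn y : nodeok K s y -> nodeok K s' (nu y).
  rewrite /nu /nodeok; case: eqVneq => [//|ne]; case: y ne => k [i|] /= ne.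
    move=> [_ ik]; split; last exact: leq_trans ik (ss k).
    by rewrite -ltnS ltn_neqAle ne sK.
  by move=> /top E; rewrite E eqxx in ne.
split; first exact: top.
exists (nu x); rewrite nu1; split=> //.
have -> : (k0, None) = nu (k0, None) :> Node by rewrite /nu /= (top _ sk) eqxx.
apply: crt_map cx => y z [oy oz [dyz g]]; split; [exact: okn|exact: okn|split].
  by rewrite !nu1.
rewrite /nu; case: ifP => _; case: ifP => _ //.
by case: y g {oy oz dyz} => ? [?|].
Qed.

Lemma disc_S1 b : disc [set cN b] (S1 b).
Proof. by apply: (disc_comp (D := fun w => qn mu1 (w (cN b))) (fun m => minn m K.+1)); exact: disc_qn. Qed.

Lemma disc_S2 b : disc (JBox r K b) (S2 b).
Proof.
apply: (disc_comp (D := fun w => (`[< gadM f r lam h K w b >], qn (lam * p) (w (cM b (tO RG)))))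
  (fun u : bool * nat => if u.1 then K.+1 else if (u.2 <= K)%N then u.2 else 0%N)).
apply: disc_pair; last by apply: disc_qn => //; right.
apply: disc_asbool; apply: (@sig_sub _ _ (JGad r K b)); last exact: sig_gadM.
by move=> i Ji; left.
Qed.

Lemma S2_le b w : (S2 b w <= K.+1)%N.
Proof. by rewrite /S2; case: ifP => // _; case: ifP => // /leqW. Qed.

Lemma pr_S1 b j : (j < K.+1)%N -> pr Q [set w | (j < S1 b w)%N] = 1 - psum mu1 j.+1.
Proof.
move=> jK; rewrite -(pr_qn_ge mQ (i := cN b)) //; congr (pr Q _).
by apply/seteqP; split=> w /=; rewrite /S1 leq_min jK andbT.
Qed.

Lemma pr_S2 b j : (j < K.+1)%N -> pr Q [set w | (j < S2 b w)%N] =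
  pr Q [set w | gadM f r lam h K w b] +
  (1 - pr Q [set w | gadM f r lam h K w b]) * (psum (lam * p) K.+1 - psum (lam * p) j.+1).
Proof.
move=> jK; set G := [set w | gadM f r lam h K w b]; set i := cM b (tO RG).
have sG : sig (JGad r K b) G by exact: sig_gadM.
have sGT : sig setT G by exact: (@sig_sub _ _ (JGad r K b)).
have sq (A : nat -> Prop) : sig [set i] [set w : Idx -> R | A (qn (lam * p) (w i))].
  by apply: (disc_pred (D := fun w => qn (lam * p) (w i)) (Q := fun c _ => A c)); [exact: disc_qn|move=> c; exact: sig_cst].
have sqT (A : nat -> Prop) : sig setT [set w : Idx -> R | A (qn (lam * p) (w i))].
  exact: (@sig_sub _ _ [set i]).
pose A := [set w : Idx -> R | (j < qn (lam * p) (w i) <= K)%N].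
have -> : [set w | (j < S2 b w)%N] = G `|` (~` G `&` A).
  apply/seteqP; split=> w; rewrite /setU /setI /setC /A /S2 /G /mkset -/i.
    case: asboolP => [g _|ng]; first by left.
    by case: ifP => // qK jq; right; split=> //; apply/andP.
  case: asboolP => [g _|ng]; first by [].
  by case=> // -[_ /andP[jq qK]]; rewrite qK.
have sA' : sig [set i] A by exact: (sq (fun c => (j < c <= K)%N)).
have dJ : JGad r K b `&` [set i] = set0.
  by apply/seteqP; split=> // x [H E]; rewrite E in H; case: (JGad_tO H).
rewrite prU //.
- rewrite (indep_sig iQ dJ (sigC sG) sA') prC //; congr (_ + _ * _).
  have [a1 a2] : pr Q [set w | (qn (lam * p) (w i) < K.+1)%N] = psum (lam * p) K.+1 /\
     pr Q [set w | (qn (lam * p) (w i) < j.+1)%N] = psum (lam * p) j.+1.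
    by split; apply: (pr_qn_lt mQ).
  rewrite -a1 -a2 (prD Q (sqT (fun c => (c < K.+1)%N)) (sqT (fun c => (c < j.+1)%N))).
  have -> : [set w : Idx -> R | (qn (lam * p) (w i) < K.+1)%N] `&` [set w | (qn (lam * p) (w i) < j.+1)%N] =
     [set w | (qn (lam * p) (w i) < j.+1)%N].
    by apply/seteqP; split=> w /=; [case|move=> H; split=> //; exact: leq_trans H _].
  have -> : [set w : Idx -> R | (qn (lam * p) (w i) < K.+1)%N] `&` ~` [set w | (qn (lam * p) (w i) < j.+1)%N] = A.
    apply/seteqP; split=> w; rewrite /A /=.
      by move=> [H1 /negP]; rewrite -leqNgt => H2; apply/andP.
    by move=> /andP[H1 H2]; split=> //; apply/negP; rewrite -leqNgt.
  by rewrite addrAC subrr add0r.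
- by apply: sigI; [exact: sigC|exact: (sqT (fun c => (j < c <= K)%N))].
- by apply/seteqP; split=> // w [g [ng]].
Qed.

(** With [d] the gadget probability, [x] and [y] the probabilities that the ordinary count is at
    most [j] and at most [K]: [d + (1 - d) (y - x) >= (y - x) + d x], and [x] is at least the mass
    at [0]. *)
Lemma tail_dom b j : (j < K.+1)%N -> pr Q [set w | (j < S1 b w)%N] <= pr Q [set w | (j < S2 b w)%N].
Proof.
move=> jK; rewrite pr_S1 // pr_S2 //.
set d := pr Q _; have d0 : 0 <= d := pr_ge0 _ _.
have dc : cg f r lam h ^+ (CA r + CB r * K) <= d by exact: pr_gadM.
have c0' : 0 <= cg f r lam h ^+ (CA r + CB r * K) by rewrite exprn_ge0 // ltW // cg_gt0.
have sh := psum_shift j.+1 lp mu1l.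
have x0 : expR (- (lam * p)) <= psum (lam * p) j.+1.
  by rewrite -pmf0 // -[leLHS]add0r -(psum0 (lam * p)) -psumS; exact: psum_nd.
have y1 := psum_le1 lp K.+1.
have e0 := expR_ge0 (- (lam * p)).
move: dom sh; set x := psum _ j.+1 in x0 *; set y := psum _ K.+1 in y1 *.
set z := psum mu1 _; set e := expR _ in x0 e0 *; set c := _ ^+ _ in dc c0' *.
move=> D1 sh; have : c * e <= d * x by apply: ler_pM.
have : 0 <= d * (1 - y) by rewrite mulr_ge0 // subr_ge0.
lra.
Qed.

Section Root.
Variables (k0 : int * int) (n : nat).
Let N := (n + DD r)%N.
Local Notation W := (window k0 N).
Local Notation W' := (rem k0 W).
Let t0 (k : int * int) : nat := if k == k0 then K.+1 else 0%N.
Let cap (s : int * int -> nat) := fun k => minn (s k) K.+1.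
Let F (s : int * int -> nat) : set (Idx -> R) := [set w | nreach f r w K k0 (cap s) n].

Let memW' k : (k \in W') = (k != k0) && (k \in W).
Proof. by rewrite mem_rem_uniq ?window_uniq // inE. Qed.

Let sigF s : sig (JOl r) (F s).
Proof.
apply: sig_nreach => [b|k i k' i']; first exact: disc_cst.
apply: sig_geo_gen => // [c|c|_]; [left; exists k, i, c|left; exists k', i', c|right; exists k, i, k', i'] => //.
Qed.

Lemma dom_nreach : pr Q [set w | F (on W' (S1^~ w) t0) w] <= pr Q [set w | F (on W' (S2^~ w) t0) w].
Proof.
apply: (replace_all iQ (J1 := fun b => [set cN b]) (J2 := JBox r K) (J3 := JOl r) (F := F) (M := K.+1)).
- by apply: rem_uniq; exact: window_uniq.
- by move=> k k' _ _; exact: cN_disj.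
- by move=> k k' _ _; exact: JBox_disj.
- by move=> k k' _ _; exact: JBox_cN.
- by move=> k _; exact: cN_JOl.
- by move=> k _; exact: JBox_JOl.
- by move=> k _; exact: disc_S1.
- by move=> k _; exact: disc_S2.
- exact: sigF.
- move=> s s' ss w; apply: nreach_mono => k; last exact: geq_minr.
  by rewrite /cap leq_min geq_minr andbT; apply: leq_trans (geq_minl _ _) (ss k).
- by move=> k w _; exact: geq_minr.
- by move=> k w _; exact: S2_le.
- by move=> k j _; exact: tail_dom.
Qed.

(** The state of the root is imposed in [F]. The gadget that justifies it reads none of the
    variables of the other boxes or of the ordinary vertices, so it costs just one factor. *)
Lemma bond_root : pr Q [set w | F (on W' (S2^~ w) t0) w] * pr Q [set w | gadM f r lam h K w k0] <=
  pr Q [set w | Rb f p w k0 n].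
Proof.
apply: le_trans (bond_layer fdec r0 fr1 lam0 mQ p0 p1 h0 ph K k0 n N).
have sG : sig (JGad r K k0) [set w | gadM f r lam h K w k0] by exact: sig_gadM.
pose U := \bigcup_(k in [set` W']) JBox r K k `|` JOl r.
have sF : sig U [set w | F (on W' (S2^~ w) t0) w].
  by apply: (sig_on (J := JBox r K)) => // k _; exact: disc_S2.
have dJ : U `&` JGad r K k0 = set0.
  apply/seteqP; split=> // i [[[k kW Ji]|Ji] Gi].
    have : k \in W' := kW; rewrite memW' => /andP[nk _].
    by have : (JBox r K k `&` JBox r K k0) i by [split=> //; left]; rewrite JBox_disj.
  by have : (JBox r K k0 `&` JOl r) i by [split=> //; left]; rewrite JBox_JOl.
rewrite -(indep_sig iQ dJ sF sG); apply: pr_le.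
- by apply: sigI; [exact: (sig_sub _ sF)|exact: (sig_sub _ sG)].
- pose tqq := @tq R RG p h.
  have dm : disc setT (mcounts lam tqq (window k0 (N + RG))).
    have dM : disc (JMM (Ty RG) (window k0 (N + RG))) (mcounts lam tqq (window k0 (N + RG))).
      by apply: disc_mcounts => // t; exact: tq_gt0.
    exact: disc_sub dM.
  apply: (disc_pred dm (Q := fun m w => nreach f r w K k0 (sA f r K k0 N m w) n)) => m.
  by apply: (@sig_sub _ _ JG) => //; exact: sig_nreach_sA.
move=> w [Fw Gw]; rewrite /=.
set s := sA _ _ _ _ _ _ _.
suff -> : s = cap (on W' (S2^~ w) t0) by [].
apply: funext => b; rewrite /cap /on memW' mem_window /t0.
have NW k : (bdist k0 b <= N)%N -> (bdist b k <= RG)%N -> k \in window k0 (N + RG).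
  move=> h1 h2; rewrite mem_window; apply: leq_trans (bdist_tri k0 b k) _; exact: leq_add.
have E : (bdist k0 b <= N)%N -> s b = S2 b w.
  move=> bN; rewrite /s /sA bN mget_mcounts; last by apply: NW => //; rewrite bdistxx.
  rewrite /S2 /=; suff -> : `[< gadA f r K k0 N (mcounts lam (@tq R RG p h) (window k0 (N + RG)) w) w b >] =
     `[< gadM f r lam h K w b >] by [].
  apply: asbool_equiv_eq; rewrite /gadA /gadM; split=> -[H ?]; split=> // k bk.
    by have := H k bk; rewrite mget_mcounts // NW.
  by rewrite mget_mcounts ?NW //; exact: H.
have [bk|nb] /= := eqVneq b k0.
  rewrite minnn E; last by rewrite bk bdistxx.
  by rewrite /S2 bk; case: asboolP => // H; case: H.
case: leqP => bN; first by rewrite E // (minn_idPl (S2_le _ _)).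
by rewrite /s /sA leqNgt bN.
Qed.

Let cget (c : seq nat) k := nth 0%N c (index k W).

(** With the counts frozen, the points are renamed as ordinary slots, and [nu] sends every vertex of
    a box in the top state, the root box included, to the gadget node. *)
Lemma Rc_nreach : pr Q [set w | Rc f (Y mu1 w) k0 n] <= pr Q [set w | F (on W' (S1^~ w) t0) w].
Proof.
pose D (w : Idx -> R) := [seq qn mu1 (w (cN k)) | k <- W].
pose A c := [set w : Idx -> R | reach [set a | a.1 \in W /\ (a.2 < cget c a.1)%N] (geo f w) (inbox k0) (far k0 n)].
pose B c := F (on W' (fun k => minn (cget c k) K.+1) t0).
pose J : set Idx := [set i | exists k, i = cN k].
have dD : disc J D by apply: disc_map => k _; apply: disc_qn => //; exists k.
have JJ : J `&` JG = set0 by apply/seteqP; split=> // i [[k ->]].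
have JO : J `&` JOl r = set0 by apply/seteqP; split=> // i [[k ->] [[? [? [?]]]|[? [? [? [?]]]]]].
have sA' c : sig JG (A c) by apply: sig_reach => [x|x y]; [exact: sig_cst|exact: sig_geo].
have sAT : sig setT [set w | A (D w) w].
  by apply: (disc_pred (disc_sub (@subsetT _ J) dD) (Q := A)) => c; exact: (sig_sub _ (sA' c)).
apply: (@le_trans _ _ (pr Q [set w | A (D w) w])).
  apply: (pr_as_le (O := [set w | reg w])) => //.
  - exact: sig_reg.
  - by apply: sig_sub (sig_Y m1 (sig_Rc fdec k0 n)); exact: subsetT.
  - exact: pr_reg mQ.
  move=> w [H rw].
  have H' : reach (vertw (Y mu1 w)) (geo f w) (inbox k0) (far k0 n).
    by apply: reach_sub H => // a b _ _ /geo_Y.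
  have := reach_trunc (fun a b _ _ g => geo_near r0 fr1 rw g) H'.
  apply: reach_sub => // a [/vertwE va aW].
  have aW' : a.1 \in W by rewrite mem_window.
  by split=> //; rewrite /cget /D nth_map_index // -nN_Y.
rewrite (_ : [set w | F (on W' (S1^~ w) t0) w] = [set w | B (D w) w]); last first.
  suff E w : on W' (S1^~ w) t0 = on W' (fun k => minn (cget (D w) k) K.+1) t0.
    by apply/seteqP; split=> w; rewrite /= /B E.
  apply: funext => k; rewrite /on; case: ifP => //; rewrite memW' => /andP[_ kW].
  by rewrite /cget /D nth_map_index.
apply: (cond_le iQ JJ JO dD (A := A) (B := B)); [exact: sA'|by move=> c; exact: sigF|move=> c].
pose s (a : Lab) : Lab := ol a.1 a.2.
have s_inj : injective s by move=> [k i] [k' i'] /slot_inj [/= -> _ ->].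
rewrite (relab_law mQ s_inj (sA' c)).
apply: (pr_as_le (O := [set w | reg w])).
- exact: sig_reg.
- by apply: (@sig_sub _ _ JG) => //; exact: sig_relab.
- exact: (sig_sub _ (sigF _)).
- exact: pr_reg mQ.
move=> w [H rw]; rewrite /B /F /=; set S := on W' _ t0.
have sk : cap S k0 = K.+1 by rewrite /cap /S /on memW' eqxx /= /t0 eqxx minnn.
split=> //.
case: H => a [b [ak Va fb cab]].
pose nu (x : Lab) : Node := if cap S x.1 == K.+1 then (x.1, None) else (x.1, Some x.2).
have nu1 x : (nu x).1 = x.1 by rewrite /nu; case: ifP.
exists (nu b); rewrite nu1; split=> //.
have -> : (k0, None) = nu a :> Node by rewrite /nu ak sk eqxx.
have ok x : x.1 \in W /\ (x.2 < cget c x.1)%N -> nodeok K (cap S) (nu x).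
  move=> [xW xc]; rewrite /nu /nodeok; case: eqVneq => [//|ne] /=.
  have xk : x.1 != k0 by apply: contra_neq ne => ->.
  have SE : cap S x.1 = minn (cget c x.1) K.+1.
    by rewrite /cap /S /on memW' xk xW /= -minnA minnn.
  move: ne; rewrite SE => ne.
  have lK : (minn (cget c x.1) K.+1 <= K)%N by rewrite -ltnS ltn_neqAle ne geq_minr.
  split=> //; rewrite leq_min xc /=.
  by move: lK; rewrite geq_min ltnn orbF => lK; exact: leq_trans xc (leqW lK).
apply: crt_map cab => x y [Vx [Vy g]]; split; [exact: ok|exact: ok|split].
  rewrite !nu1; exact: (geo_near r0 fr1 (reg_relab s rw) g).
rewrite /nu; case: ifP => _; case: ifP => _ //=.
by have /geo_relab := g; apply.
Qed.

Lemma main_bound : pr Q [set w | Rc f (Y mu1 w) k0 n] * cg f r lam h ^+ (CA r + CB r * K) <=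
  pr Q [set w | Rb f p w k0 n].
Proof.
apply: le_trans bond_root; apply: ler_pM; try exact: pr_ge0.
- by rewrite exprn_ge0 // ltW // cg_gt0.
- exact: le_trans Rc_nreach dom_nreach.
- exact: pr_gadM.
Qed.
End Root.

Lemma bond_of_rcm : 0 < pr Q [set w | exists k, forall n, Rc f (Y mu1 w) k n] ->
  0 < pr Q [set w | exists k, forall n, Rb f p w k n].
Proof.
have sY k n : sig setT [set w | Rc f (Y mu1 w) k n].
  by apply: sig_sub (sig_Y m1 (sig_Rc fdec k n)); exact: subsetT.
have sB k n : sig setT [set w | Rb f p w k n] by exact: sig_Rb.
move=> /(@pr_bigcup_gt0 _ _ Q _ (fun k => [set w | forall n, Rc f (Y mu1 w) k n])) [].
  by move=> k; apply: sig_all => n; exact: sY.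
move=> k ek; set e := pr Q _ in ek.
have c0' : 0 < cg f r lam h ^+ (CA r + CB r * K) by rewrite exprn_gt0 // cg_gt0.
have H : e * cg f r lam h ^+ (CA r + CB r * K) <= pr Q [set w | forall n, Rb f p w k n].
  apply: (pr_bigcap_ge (F := fun n => [set w | Rb f p w k n])) => [n|n w|n]; first exact: sB.
    exact: Rb_anti.
  apply: le_trans (main_bound k n); apply: ler_wpM2r; first exact: ltW.
  by apply: pr_le => //; [apply: sig_all => m; exact: sY|move=> w; apply].
apply: (@lt_le_trans _ _ (pr Q [set w | forall n, Rb f p w k n])).
  by apply: lt_le_trans H; exact: mulr_gt0.
apply: pr_le; [by apply: sig_all => m; exact: sB|by apply: sig_ex => m; apply: sig_all => j; exact: sB|].
by move=> w H'; exists k.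
Qed.
End Domination.

(** * Choice of the constants *)

Section Gap.
Variables (R : realType) (f : R -> R) (r : R).
Hypothesis fdec : forall s t : R, 0 <= s -> s <= t -> f t <= f s.
Hypothesis f01 : forall s : R, 0 <= s -> 0 <= f s <= 1.
Hypothesis r0 : 0 < r.
Hypothesis fr1 : forall s : R, 0 <= s -> 0 < f s -> s <= r.
Hypothesis fr2 : forall s : R, 0 <= s -> s < r -> 0 < f s.
Variables (Q : probability (Om R Idx) R) (lam : R).
Hypothesis lam0 : 0 < lam.
Hypothesis mQ : model Q lam.

Lemma bond_gap (ps : R) : 0 < ps -> ps < 1 -> exists2 eta : R, 0 < eta &
  forall p mu1, ps / 2 <= p -> p < ps -> lam * p <= mu1 -> mu1 - lam * p <= eta ->
  0 < pr Q [set w | exists k, forall n, Rc f (Y mu1 w) k n] ->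
  0 < pr Q [set w | exists k, forall n, Rb f p w k n].
Proof.
move=> ps0 ps1.
have NC0 : 0 < (NC (RG r))%:R :> R.
  by rewrite ltr0n; apply/card_gt0P; exists (ord0, ord0).
(* Then [NC * h <= p * (1 - p)] for all [p] between [ps / 2] and [ps], so that [c], [K] and [eta] do
   not depend on [p]. *)
pose h := ps / 2 * (1 - ps) / (NC (RG r))%:R.
have h0 : 0 < h by rewrite divr_gt0 // mulr_gt0 //; lra.
pose c := cg f r lam h; have c0 : 0 < c by exact: cg_gt0.
have c1 : c <= 1 by exact: cg_le1.
pose a := c ^+ CA r; pose b := c ^+ CB r.
have a0 : 0 < a by exact: exprn_gt0.
have b0 : 0 < b by exact: exprn_gt0.
have b1 : b <= 1 by apply: exprn_ile1 => //; exact: ltW.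
(* The gadget probability decays like [b ^+ K]; with this [z] the Chernoff bound is
   [b ^+ K * (E / 2 ^+ K)], smaller by a factor that [K] controls. *)
pose z := 2 / b; have z1 : 1 <= z by rewrite ler_pdivlMr //; lra.
have z0 : 0 < z by exact: lt_le_trans z1.
pose E := expR (lam * (z - 1)); have E0 : 0 < E := expR_gt0 _.
pose e := expR (- lam); have e0 : 0 < e := expR_gt0 _.
have [K HK] : exists K, E / 2 ^+ K <= a * e / 2.
  have ae : 0 < a * e by exact: mulr_gt0.
  exists (Num.truncn (2 * E / (a * e))).+1.
  have := truncnS_gt (2 * E / (a * e)); set K := (Num.truncn _).+1 => h1.
  have {}h1 : 2 * E / (a * e) < 2 ^+ K.
    apply: lt_le_trans h1 _; rewrite -natrX ler_nat; apply: ltnW; exact: ltn_expl.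
  have : 0 < 2 ^+ K :> R by exact: exprn_gt0.
  move: (2 ^+ K) h1 => T h1 T0.
  rewrite ltr_pdivrMr // in h1; rewrite ler_pdivrMr //; lra.
have cE : c ^+ (CA r + CB r * K) = a * b ^+ K by rewrite exprD exprM.
pose d := c ^+ (CA r + CB r * K); have d0 : 0 < d by exact: exprn_gt0.
(* Half of the gain [d * e] pays for the Poisson tail, the other half for the excess of
   intensity. *)
exists (d * e / 2); first by rewrite divr_gt0 // mulr_gt0.
move=> p mu1 p2 pps lmu muE.
have p0 : 0 < p by apply: lt_le_trans p2; rewrite divr_gt0.
have p1 : p < 1 by exact: lt_trans pps ps1.
have lp : 0 < lam * p by exact: mulr_gt0.
have lpl : lam * p <= lam by rewrite -[leRHS]mulr1 ler_pM2l // ltW.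
apply: (@bond_of_rcm R f r fdec f01 r0 fr1 fr2 Q lam lam0 mQ p h p0 p1 h0 _ K mu1 lmu _).
- rewrite /h mulrCA mulfV ?gt_eqF // mulr1.
  by apply: ler_pM => //; [rewrite divr_ge0 // ltW|rewrite subr_ge0 ltW|rewrite lerD2l lerN2 ltW].
- rewrite -/c -/d.
  have H1 := psum_chernoff K.+1 lp lpl z1; rewrite -/E in H1.
  have H2 : z ^- K.+1 * E <= d * e / 2.
    apply: (@le_trans _ _ (z ^- K * E)).
      rewrite ler_wpM2r ?(ltW E0) // lef_pV2 ?posrE ?exprn_gt0 //.
      by apply: ler_weXn2l.
    have -> : z ^- K * E = b ^+ K * (E / 2 ^+ K).
      by rewrite /z expr_div_n invf_div mulrAC mulrA.
    rewrite /d cE (_ : a * b ^+ K * e / 2 = b ^+ K * (a * e / 2)); last by ring.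
    by rewrite ler_wpM2l // exprn_ge0 // ltW.
  apply: (@le_trans _ _ (d * e)).
    by apply: le_trans (lerD (le_trans H1 H2) muE) _; rewrite -splitr.
  by rewrite ler_wpM2l ?(ltW d0) // ler_expR lerN2.
Qed.
End Gap.

(** * Percolation at high intensity *)

(** If the centre is good, the side cells attach to it, and each corner has two side neighbours of
    which one is good. If the centre is bad, the other eight cells are all good and form a ring. *)
Lemma grid3 (P : nat * nat -> Prop) (C : nat * nat -> nat * nat -> Prop) :
  (forall i j i' j', (i < 3)%N -> (j < 3)%N -> (i' < 3)%N -> (j' < 3)%N ->
    (i, j) <> (i', j') -> P (i, j) \/ P (i', j')) ->
  (forall a, P a -> C a a) -> (forall a b, C a b -> C b a) ->
  (forall a b c, P b -> C a b -> C b c -> C a c) ->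
  (forall i j, (i < 2)%N -> (j < 3)%N -> P (i, j) -> P (i.+1, j) -> C (i, j) (i.+1, j)) ->
  (forall i j, (i < 3)%N -> (j < 2)%N -> P (i, j) -> P (i, j.+1) -> C (i, j) (i, j.+1)) ->
  forall i j i' j', (i < 3)%N -> (j < 3)%N -> (i' < 3)%N -> (j' < 3)%N ->
    P (i, j) -> P (i', j') -> C (i, j) (i', j').
Proof.
move=> H rC sC tC hC vC.
suff [b Pb Hb] : exists2 b, P b & forall i j, (i < 3)%N -> (j < 3)%N -> P (i, j) -> C (i, j) b.
  move=> i j i' j' i3 j3 i3' j3' Pij Pij'; apply: (tC _ b) => //; first exact: Hb.
  by apply: sC; exact: Hb.
have [Pc|nPc] := pselect (P (1%N, 1%N)).
  exists (1%N, 1%N) => //.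
  have e0 : P (0, 1)%N -> C (0, 1)%N (1, 1)%N by move=> p; exact: hC.
  have e1 : P (2, 1)%N -> C (2, 1)%N (1, 1)%N by move=> p; apply: sC; exact: hC.
  have e2 : P (1, 0)%N -> C (1, 0)%N (1, 1)%N by move=> p; exact: vC.
  have e3 : P (1, 2)%N -> C (1, 2)%N (1, 1)%N by move=> p; apply: sC; exact: vC.
  move=> [|[|[|//]]] [|[|[|//]]] _ _ p //; try exact: rC.
  - have [q|q] : P (0, 1)%N \/ P (1, 0)%N by apply: H.
      by apply: (tC _ (0, 1)%N) => //; [exact: vC|exact: e0].
    by apply: (tC _ (1, 0)%N) => //; [exact: hC|exact: e2].
  - exact: e0.
  - have [q|q] : P (0, 1)%N \/ P (1, 2)%N by apply: H.
      by apply: (tC _ (0, 1)%N) => //; [apply: sC; exact: vC|exact: e0].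
    by apply: (tC _ (1, 2)%N) => //; [exact: hC|exact: e3].
  - exact: e2.
  - exact: e3.
  - have [q|q] : P (2, 1)%N \/ P (1, 0)%N by apply: H.
      by apply: (tC _ (2, 1)%N) => //; [exact: vC|exact: e1].
    by apply: (tC _ (1, 0)%N) => //; [apply: sC; exact: hC|exact: e2].
  - exact: e1.
  - have [q|q] : P (2, 1)%N \/ P (1, 2)%N by apply: H.
      by apply: (tC _ (2, 1)%N) => //; [apply: sC; exact: vC|exact: e1].
    by apply: (tC _ (1, 2)%N) => //; [apply: sC; exact: hC|exact: e3].
have A i j : (i < 3)%N -> (j < 3)%N -> (i, j) <> (1, 1)%N -> P (i, j).
  by move=> i3 j3 n; have [//|//|//|//|//|//|] := H i j 1%N 1%N.
have p00 : P (0, 0)%N by apply: A. have p10 : P (1, 0)%N by apply: A.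
have p20 : P (2, 0)%N by apply: A. have p21 : P (2, 1)%N by apply: A.
have p22 : P (2, 2)%N by apply: A. have p12 : P (1, 2)%N by apply: A.
have p02 : P (0, 2)%N by apply: A. have p01 : P (0, 1)%N by apply: A.
exists (0, 0)%N => //.
have c10 : C (1, 0)%N (0, 0)%N by apply: sC; exact: hC.
have c20 : C (2, 0)%N (0, 0)%N by apply: (tC _ (1, 0)%N) => //; apply: sC; exact: hC.
have c21 : C (2, 1)%N (0, 0)%N by apply: (tC _ (2, 0)%N) => //; apply: sC; exact: vC.
have c22 : C (2, 2)%N (0, 0)%N by apply: (tC _ (2, 1)%N) => //; apply: sC; exact: vC.
have c01 : C (0, 1)%N (0, 0)%N by apply: sC; exact: vC.
have c02 : C (0, 2)%N (0, 0)%N by apply: (tC _ (0, 1)%N) => //; apply: sC; exact: vC.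
have c12 : C (1, 2)%N (0, 0)%N by apply: (tC _ (0, 2)%N) => //; apply: sC; exact: hC.
by move=> [|[|[|//]]] [|[|[|//]]] _ _ p //; exact: rC.
Qed.

Definition sub3 (k : int * int) (c : nat * nat) : int * int :=
  (k.1 * 3 + c.1%:Z, k.2 * 3 + c.2%:Z)%R.
Definition cells : seq (nat * nat) := [seq (i, j) | i <- iota 0 3, j <- iota 0 3].
Definition nbr (x y : int * int) : Prop := y = (x.1 + 1, x.2)%R \/ y = (x.1, x.2 + 1)%R.

Lemma mem_cells c : (c \in cells) = (c.1 < 3)%N && (c.2 < 3)%N.
Proof. by case: c => [[|[|[|i]]] [|[|[|j]]]]. Qed.

Lemma sub3_inj k k' c c' : c \in cells -> c' \in cells -> sub3 k c = sub3 k' c' -> k = k' /\ c = c'.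
Proof.
rewrite !mem_cells => /andP[h1 h2] /andP[h3 h4] [E1 E2].
case: k k' c c' h1 h2 h3 h4 E1 E2 => [x y] [x' y'] [i j] [i' j'] /= h1 h2 h3 h4 E1 E2.
by have [[-> ->] [-> ->]] : (x = x' /\ y = y') /\ (i = i' /\ j = j') by lia.
Qed.

(** * Connectivity of good blocks *)

Section Hierarchy.
Variables (g rgn : int * int -> Prop).

Fixpoint good n k : Prop := if n is m.+1 then
  forall c c', c \in cells -> c' \in cells -> c <> c' -> good m (sub3 k c) \/ good m (sub3 k c')
  else g k.
(** The unit boxes reached from block [k] by descending through good blocks only; these are the
    boxes shown to be connected. *)
Fixpoint core n k x : Prop := if n is m.+1 then
  good n k /\ exists2 c, c \in cells & core m (sub3 k c) x else g k /\ x = k.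
Fixpoint blkR n k : Prop := if n is m.+1 then
  forall c, c \in cells -> blkR m (sub3 k c) else rgn k.
Definition adjS x y : Prop := [/\ g x, g y, rgn x, rgn y & nbr x y \/ nbr y x].
Local Notation path := (clos_refl_trans (int * int) adjS).

Lemma core_good n k x : core n k x -> good n k.
Proof. by case: n => [[]|n []]. Qed.

Lemma adjSC x y : adjS x y -> adjS y x.
Proof. by case=> *; split=> //; rewrite or_comm. Qed.

Lemma core_ne n k : good n k -> exists x, core n k x.
Proof.
elim: n k => [|n IH] k; first by move=> gk; exists k.
move=> H; have [/IH [x cx]|/IH [x cx]] := H (0, 0)%N (0, 1)%N isT isT ltac:(by []).
  by exists x; split=> //; exists (0, 0)%N.
by exists x; split=> //; exists (0, 1)%N.
Qed.

(** Three pairs of sub-blocks face each other across the common side. Each of the two blocks spoils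
    at most one pair, so a pair of good sub-blocks remains. *)
Lemma core_adj n k k' : blkR n k -> blkR n k' -> nbr k k' -> good n k -> good n k' ->
  exists x y, [/\ core n k x, core n k' y & adjS x y].
Proof.
elim: n k k' => [|n IH] k k' bk bk' nk gk gk'.
  by exists k, k'; split=> //; split=> //; left.
have three (A B : nat -> Prop) : (forall i j, (i < 3)%N -> (j < 3)%N -> i <> j -> A i \/ A j) ->
   (forall i j, (i < 3)%N -> (j < 3)%N -> i <> j -> B i \/ B j) ->
   exists2 i, (i < 3)%N & A i /\ B i.
  move=> HA HB.
  have [a01 a02 a12] := And3 (HA 0%N 1%N isT isT ltac:(by [])) (HA 0%N 2%N isT isT ltac:(by []))
    (HA 1%N 2%N isT isT ltac:(by [])).
  have [b01 b02 b12] := And3 (HB 0%N 1%N isT isT ltac:(by [])) (HB 0%N 2%N isT isT ltac:(by []))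
    (HB 1%N 2%N isT isT ltac:(by [])).
  suff [[]|[[]|[]]] : (A 0%N /\ B 0%N) \/ (A 1%N /\ B 1%N) \/ (A 2%N /\ B 2%N).
  - by exists 0%N.
  - by exists 1%N.
  - by exists 2%N.
  tauto.
case: nk => E.
- have [j j3 [g1 g2]] := three (fun j => good n (sub3 k (2%N, j))) (fun j => good n (sub3 k' (0%N, j)))
    (fun i j i3 j3 ij => gk (2, i)%N (2, j)%N ltac:(by rewrite mem_cells) ltac:(by rewrite mem_cells) ltac:(by case))
    (fun i j i3 j3 ij => gk' (0, i)%N (0, j)%N ltac:(by rewrite mem_cells) ltac:(by rewrite mem_cells) ltac:(by case)).
  have [|||x [y [cx cy a]]] := IH _ _ _ _ _ g1 g2.
  + by apply: bk; rewrite mem_cells.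
  + by apply: bk'; rewrite mem_cells.
  + by left; rewrite E /sub3 /=; congr pair; lia.
  exists x, y; split=> //; split=> //.
    by exists (2, j)%N => //; rewrite mem_cells.
  by exists (0, j)%N => //; rewrite mem_cells.
- have [j j3 [g1 g2]] := three (fun j => good n (sub3 k (j, 2%N))) (fun j => good n (sub3 k' (j, 0%N)))
    (fun i j i3 j3 ij => gk (i, 2)%N (j, 2)%N ltac:(by rewrite mem_cells i3) ltac:(by rewrite mem_cells j3) ltac:(by case))
    (fun i j i3 j3 ij => gk' (i, 0)%N (j, 0)%N ltac:(by rewrite mem_cells i3) ltac:(by rewrite mem_cells j3) ltac:(by case)).
  have [|||x [y [cx cy a]]] := IH _ _ _ _ _ g1 g2.
  + by apply: bk; rewrite mem_cells j3.
  + by apply: bk'; rewrite mem_cells j3.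
  + by right; rewrite E /sub3 /=; congr pair; lia.
  exists x, y; split=> //; split=> //.
    by exists (j, 2)%N => //; rewrite mem_cells j3.
  by exists (j, 0)%N => //; rewrite mem_cells j3.
Qed.

Lemma core_conn n k x y : blkR n k -> core n k x -> core n k y -> path x y.
Proof.
elim: n k x y => [|n IH] k x y bk; first by move=> [_ ->] [_ ->]; exact: rt_refl.
move=> [gk [c cc cx]] [_ [c' cc' cy]].
pose P c := good n (sub3 k c).
pose C (c c' : nat * nat) := c \in cells /\ c' \in cells /\
   forall x y, core n (sub3 k c) x -> core n (sub3 k c') y -> path x y.
suff : C c c' by case=> _ [_]; apply.
have near a b : a \in cells -> b \in cells -> nbr (sub3 k a) (sub3 k b) -> P a -> P b -> C a b.
  move=> ca cb nab Pa Pb; split=> //; split=> // u v cu cv.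
  have [s [t [cs ct st]]] := core_adj (bk a ca) (bk b cb) nab Pa Pb.
  apply: rt_trans (IH _ _ _ (bk a ca) cu cs) _.
  by apply: rt_trans (rt_step _ _ _ _ st) (IH _ _ _ (bk b cb) ct cv).
move: cc cc'; case: c cx => i j cx; case: c' cy => i' j' cy.
rewrite !mem_cells /= => /andP[i3 j3] /andP[i3' j3'].
have trans : forall a b c, P b -> C a b -> C b c -> C a c.
  move=> a b c Pb [ca [cb ab]] [_ [cc bc]]; split=> //; split=> // u v cu cv.
  have [s cs] := core_ne Pb; exact: rt_trans (ab _ _ cu cs) (bc _ _ cs cv).
have sym : forall a b, C a b -> C b a.
  move=> a b [ca [cb ab]]; split=> //; split=> // u v cu cv.
  by apply: crt_sym (ab _ _ cv cu) => ? ?; exact: adjSC.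
pose C' a b := a \in cells -> b \in cells -> C a b.
suff : C' (i, j) (i', j') by apply; rewrite mem_cells /= ?i3 ?j3 ?i3' ?j3'.
apply: (@grid3 (fun c => c \in cells /\ P c) C') => //.
- move=> a b a' b' a3 b3 a3' b3' nab.
  have ca : (a, b) \in cells by rewrite mem_cells a3.
  have ca' : (a', b') \in cells by rewrite mem_cells a3'.
  by have [?|?] := gk _ _ ca ca' nab; [left|right].
- move=> a [ca Pa] _ _; split=> //; split=> // u v cu cv; exact: IH (bk a ca) cu cv.
- by move=> a b ab ca cb; apply: sym; exact: ab.
- by move=> a b c [cb Pb] ab bc ca cc; apply: trans Pb (ab ca cb) (bc cb cc).
- move=> a b a2 b3 [ca Pa] [cb Pb] _ _; apply: near => //.
  by left; rewrite /sub3 /=; congr pair; lia.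
- move=> a b a2 b3 [ca Pa] [cb Pb] _ _; apply: near => //.
  by right; rewrite /sub3 /=; congr pair; lia.
- by split; [rewrite mem_cells i3|exact: core_good cx].
- by split; [rewrite mem_cells i3'|exact: core_good cy].
Qed.

Lemma core_range n k x : core n k x -> ((3 ^ n)%N%:Z * k.1 <= x.1)%R.
Proof.
elim: n k => [|n IH] k; first by move=> [_ ->]; rewrite expn0 mul1r.
move=> [_ [c _ /IH]]; rewrite /= expnS; move: (3 ^ n)%N => e; case: c => i j /=; nia.
Qed.

Lemma blkR_in n k : (forall x, ((3 ^ n)%N%:Z * k.1 <= x.1 < (3 ^ n)%N%:Z * (k.1 + 1))%R ->
   ((3 ^ n)%N%:Z * k.2 <= x.2 < (3 ^ n)%N%:Z * (k.2 + 1))%R -> rgn x) -> blkR n k.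
Proof.
elim: n k => [|n IH] k H.
  by apply: H; rewrite expn0 !mul1r lexx ltzD1 lexx.
move=> c; rewrite mem_cells => /andP[c1 c2]; apply: IH => x h1 h2; apply: H.
  move: h1 c1; rewrite /= expnS; move: (3 ^ n)%N => e; clear; nia.
move: h2 c2; rewrite /= expnS; move: (3 ^ n)%N => e; clear; nia.
Qed.

(** The origin is in the core of each block cornered at it. In the last column, at distance at least
    [2 * 3 ^ n], some sub-block is good, and its core is connected to the origin. *)
Lemma hier_reach n : blkR n.+1 (0, 0)%R -> (forall m, (m <= n.+1)%N -> good m (0, 0)%R) ->
  exists x, path (0, 0)%R x /\ (n <= bdist (0, 0)%R x)%N.
Proof.
move=> bR H.
have c0 m : (m <= n.+1)%N -> core m (0, 0)%R (0, 0)%R.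
  elim: m => [|m IH] mn; first by split=> //; exact: (H 0%N).
  split; first exact: H.
  by exists (0, 0)%N => //; apply: IH; exact: ltnW.
have [c [cc c2 gc]] : exists c, [/\ c \in cells, c.1 = 2%N & good n (sub3 (0, 0)%R c)].
  have [g1|g1] := H n.+1 (leqnn _) (2, 0)%N (2, 1)%N isT isT ltac:(by []); by [exists (2, 0)%N|exists (2, 1)%N].
have [x cx] := core_ne gc.
have cx' : core n.+1 (0, 0)%R x by split; [exact: H|exists c].
exists x; split; first exact: core_conn bR (c0 _ (leqnn _)) cx'.
have := core_range cx; rewrite /= c2 /bdist /= => h1.
have h2 : (n < 3 ^ n)%N by exact: ltn_expl.
move: h1 h2; move: (3 ^ n)%N (x.1) (x.2) => e u v; clear; lia.
Qed.
End Hierarchy.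

(** * The probability of bad blocks *)

Section HierarchyLaw.
Variables (R : realType) (Q : probability (Om R Idx) R).
Hypothesis iQ : indep Q.
Variables (J : int * int -> set Idx) (g : int * int -> set (Idx -> R)).
Hypothesis dJ : forall k k' i, J k i -> J k' i -> k = k'.
Hypothesis sg : forall k, sig (J k) (g k).
Hypothesis pg : forall k, pr Q (~` g k) <= 162^-1.
Local Notation gd n k w := (good (g^~ w) n k).

Fixpoint JN n k : set Idx := if n is m.+1 then
  [set i | exists2 c, c \in cells & JN m (sub3 k c) i] else J k.

Lemma JN_disj n k k' i : JN n k i -> JN n k' i -> k = k'.
Proof.
elim: n k k' => [|n IH] k k'; first exact: dJ.
by move=> [c cc h1] [c' cc' h2]; have [] := sub3_inj cc cc' (IH _ _ h1 h2).
Qed.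

Lemma sig_good n k : sig (JN n k) [set w | gd n k w].
Proof.
elim: n k => [|n IH] k; first exact: sg.
apply: sig_all => c; apply: sig_all => c'.
have [cc|nc] := boolP (c \in cells); last by apply: sig_triv => w.
have [cc'|nc] := boolP (c' \in cells); last by apply: sig_triv => w.
do 3! (apply: sig_imp; first exact: sig_cst).
by apply: sig_or; apply: (sig_sub _ (IH _)) => i Ji; [exists c|exists c'].
Qed.

Let sT n k : sig setT [set w | gd n k w]. Proof. by apply: (@sig_sub _ _ (JN n k) setT) => //; exact: sig_good. Qed.

(** A bad block has two distinct bad sub-blocks, which are independent; 81 bounds the number of
    ordered pairs. As [162 = 2 * 81], a bound [a <= 1 / 162] gives [81 * a ^+ 2 <= a / 2]. *)
Lemma pr_bad n k : pr Q [set w | ~ gd n k w] <= 2 ^- n / 162.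
Proof.
elim: n k => [|n IH] k; first by rewrite expr0 invr1 mul1r; exact: pg.
set a := 2 ^- n / 162 in IH.
have a0 : 0 <= a by rewrite divr_ge0 // invr_ge0 exprn_ge0.
pose s := [seq cc <- [seq (c, c') | c <- cells, c' <- cells] | cc.1 != cc.2].
pose F (cc : (nat * nat) * (nat * nat)) := [set w | ~ gd n (sub3 k cc.1) w] `&` [set w | ~ gd n (sub3 k cc.2) w].
have sF cc : sig setT (F cc) by apply: sigI; apply: sig_not; exact: sT.
have Fa cc : cc \in s -> pr Q (F cc) <= a ^+ 2.
  rewrite mem_filter => /andP[ne /allpairsP[[c c'] [/= c1 c2 E]]].
  rewrite (indep_sig iQ (J1 := JN n (sub3 k cc.1)) (J2 := JN n (sub3 k cc.2))).
  - by rewrite expr2; apply: ler_pM => //; exact: pr_ge0.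
  - apply/seteqP; split=> // i [h1 h2]; have := JN_disj h1 h2.
    by rewrite E /= => /(sub3_inj c1 c2) [_ ecc]; rewrite E /= ecc eqxx in ne.
  - by apply: sig_not; exact: sig_good.
  - by apply: sig_not; exact: sig_good.
apply: (@le_trans _ _ (\sum_(cc <- s) pr Q (F cc))).
  apply: le_trans (pr_bigU_le Q s sF); apply: pr_le; first exact: (sig_not (sT n.+1 k)).
    exact: sig_ex2.
  move=> w /= ng; apply: contrapT => nE; apply: ng => c c' cc cc' ne.
  apply: contrapT => /not_orP [n1 n2]; apply: nE; exists (c, c') => //.
  by rewrite mem_filter; apply/andP; split; [exact/eqP|exact: (allpairs_f pair)].
apply: (@le_trans _ _ (81 * a ^+ 2)).
  apply: (@le_trans _ _ (\sum_(cc <- s) a ^+ 2)).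
    by rewrite big_seq [leRHS]big_seq; apply: ler_sum.
  rewrite big_const_seq iter_addr_0 -[leLHS]mulr_natl; apply: ler_wpM2r; first exact: exprn_ge0.
  by rewrite ler_nat count_predT.
have a1 : a <= 1 / 162.
  rewrite /a ler_wpM2r // invf_le1 ?exprn_gt0 //; apply: exprn_ege1; by rewrite ler1n.
have aS : 2 ^- n.+1 / 162 = a / 2 :> R.
  by rewrite /a exprS invfM; move: (2 ^- n) => e; ring.
rewrite aS expr2; move: a0 a1; move: (a) => b b0 b1; nra.
Qed.

Lemma hier_prob n : 1 / 2 <= pr Q [set w | forall m, (m <= n)%N -> gd m (0, 0)%R w].
Proof.
pose F m := [set w | ~ gd m (0, 0)%R w].
have sF m : sig setT (F m) by apply: sig_not; exact: sT.
have sA : sig setT [set w | forall m, (m <= n)%N -> gd m (0, 0)%R w].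
  by apply: sig_all => m; apply: sig_imp; [exact: sig_cst|exact: sT].
have H : pr Q (~` [set w | forall m, (m <= n)%N -> gd m (0, 0)%R w]) <= 1 / 2.
  apply: (@le_trans _ _ (\sum_(m <- iota 0 n.+1) pr Q (F m))).
    apply: le_trans (pr_bigU_le Q (iota 0 n.+1) sF); apply: pr_le; first exact: sigC.
      exact: sig_ex2.
    move=> w ng; apply: contrapT => nE; apply: ng => m mn.
    by apply: contrapT => ng; apply: nE; exists m => //; rewrite mem_iota.
  apply: (@le_trans _ _ (\sum_(m <- iota 0 n.+1) 2 ^- m / 162)).
    by apply: ler_sum => m _; exact: pr_bad.
  have -> : \sum_(m <- iota 0 n.+1) 2 ^- m / 162 = (2 - 2 * 2 ^- n.+1) / 162 :> R.
    rewrite -[n.+1]subn0 -/(index_iota 0 n.+1) subn0.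
    elim: n.+1 => [|j IH]; first by rewrite big_nil expr0 invr1 mulr1 subrr mul0r.
    by rewrite big_nat_recr //= IH exprS invfM; move: (2 ^- j) => e; field.
  have : 0 <= 2 ^- n.+1 :> R by rewrite invr_ge0 exprn_ge0.
  move: (2 ^- n.+1) => e; lra.
by have := prC Q sA; move: H; lra.
Qed.
End HierarchyLaw.

(** * Swapping chosen points with fixed labels *)

Section Swap.
Variable n0 : nat.
Hypothesis n0_gt0 : (0 < n0)%N.

Definition sw (c t : nat) : nat := if t == 0%N then c else if t == c then 0%N else t.

(* Swaps the first label of each group of [n0] labels with the label chosen by
   [c]. *)
Definition sc (c : int * int -> nat -> nat) (a : Lab) : Lab :=
  if (c a.1 (a.2 %/ n0) < n0)%N then
    (a.1, (n0 * (a.2 %/ n0) + sw (c a.1 (a.2 %/ n0)) (a.2 %% n0))%N) else a.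

Lemma sw_lt c t : (c < n0)%N -> (t < n0)%N -> (sw c t < n0)%N.
Proof. by rewrite /sw; case: ifP => // _; case: ifP. Qed.

Lemma swK c : involutive (sw c).
Proof.
rewrite /sw => t; case: (eqVneq t 0%N) => [->|t0]; first by rewrite eqxx; case: (eqVneq c 0%N).
case: (eqVneq t c) => [->|tc]; first by rewrite eqxx.
by rewrite (negbTE t0) (negbTE tc).
Qed.

Lemma divn_grp q t : (t < n0)%N -> ((n0 * q + t) %/ n0 = q)%N.
Proof. by move=> tn; rewrite mulnC divnMDl // divn_small // addn0. Qed.

Lemma modn_grp q t : (t < n0)%N -> ((n0 * q + t) %% n0 = t)%N.
Proof. by move=> tn; rewrite mulnC modnMDl modn_small. Qed.

Lemma scK c : involutive (sc c).
Proof.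
move=> [k i]; case: (boolP (c k (i %/ n0) < n0)%N) => h; last first.
  have E : sc c (k, i) = (k, i) by rewrite /sc /= (negbTE h).
  by rewrite !E.
have lt : (sw (c k (i %/ n0)) (i %% n0) < n0)%N by apply: sw_lt => //; exact: ltn_pmod.
have E : sc c (k, i) = (k, (n0 * (i %/ n0) + sw (c k (i %/ n0)) (i %% n0))%N) by rewrite /sc /= h.
by rewrite E /sc /= divn_grp // modn_grp // h swK mulnC -divn_eq.
Qed.

Lemma sc_inj c : injective (sc c). Proof. exact: inv_inj (scK c). Qed.

Lemma sc_box c a : (sc c a).1 = a.1. Proof. by rewrite /sc; case: ifP. Qed.
End Swap.

Lemma relabE (R : realType) (s : Lab -> Lab) (w : Idx -> R) a b :
  relab s w (iE (epair a b)) = w (iE (epair (s a) (s b))).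
Proof.
have eE e : relab s w (iE e) = w (iE (epair (s e.1) (s e.2))) by [].
by rewrite eE; case: (epair_cases a b) => -> //=; rewrite epairC.
Qed.

(** * Dense boxes *)

Section Dense.
Variables (R : realType) (f : R -> R) (r : R).
Hypothesis fdec : forall s t : R, 0 <= s -> s <= t -> f t <= f s.
Hypothesis r0 : 0 < r.
Variables (L n0 : nat) (mu : R).
Hypothesis n0_gt0 : (0 < n0)%N.
Local Notation mm := (mm r).
Local Notation boxof := (boxof mm).
Local Notation subof := (subof mm).

Definition ngrp : nat := (mm ^ 2 * L.+1)%N.
Definition grp (g : int * int) (l : nat) : nat := (subof g * L.+1 + l)%N.
(** For each square there are [L.+1] groups of [n0] labels; a group tries to place one of its points
    in the square. Group [0] gives the root, the others the helpers, and [cl g l] is the first label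
    of a group. *)
Definition cl (g : int * int) (l : nat) : Lab := (boxof g, (n0 * grp g l)%N).

Lemma grp_lt g l : (l <= L)%N -> (grp g l < ngrp)%N.
Proof.
move=> lL; apply: (@leq_trans ((subof g).+1 * L.+1)%N).
  by rewrite /grp mulSn addnC -addSn leq_add2r ltnS.
by rewrite leq_mul2r subof_lt ?orbT.
Qed.

Lemma grp_sub g l : (l <= L)%N -> (grp g l %/ L.+1 = subof g)%N.
Proof. by move=> lL; rewrite /grp divnMDl // divn_small // addn0. Qed.

Lemma cl_inj g l g' l' : (l <= L)%N -> (l' <= L)%N -> cl g l = cl g' l' -> g = g' /\ l = l'.
Proof.
move=> lL lL' [E1 E2 /eqP]; rewrite eqn_pmul2l // => /eqP E.
have Es : subof g = subof g' by rewrite -(grp_sub g lL) -(grp_sub g' lL') E.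
split; first by apply: (boxsub_inj (mm1 r)) => //; rewrite !boxofE E1 E2.
by move: E; rewrite /grp Es => /addnI.
Qed.

Lemma subof_div g : (subof g %/ mm = absz (g.1 %% mm)%Z)%N /\ (subof g %% mm = absz (g.2 %% mm)%Z)%N.
Proof.
have h : (absz (g.2 %% mm)%Z < mm)%N.
  have := @ltz_pmod g.2 mm isT; have := @modz_ge0 g.2 mm isT.
  by move: (g.2 %% mm)%Z (mm) => u m; clear; lia.
by rewrite subofE divnMDl // divn_small // addn0 modnMDl modn_small.
Qed.

Definition hitp (a : Lab) (w : Idx -> R) : Prop :=
  let j := ((a.2 %/ n0) %/ L.+1)%N in
  ((j %/ mm)%:R <= mm%:R * w (iX a false) <= (j %/ mm)%:R + 1) /\
  ((j %% mm)%:R <= mm%:R * w (iX a true) <= (j %% mm)%:R + 1).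

(** The first member of the group that hits its square; the value is [n0] when none does. *)
Definition ch (w : Idx -> R) (k : int * int) (q : nat) : nat :=
  find (fun t => `[< hitp (k, n0 * q + t)%N w >]) (iota 0 n0).

Lemma chE w k q : ch w k q = find (fun t => `[< hitp (k, n0 * q + t)%N w >]) (iota 0 n0).
Proof. by []. Qed.

Lemma ch_hit w k q : (ch w k q < n0)%N -> hitp (k, n0 * q + ch w k q)%N w.
Proof.
move=> h; have hs : has (fun t => `[< hitp (k, n0 * q + t)%N w >]) (iota 0 n0).
  by rewrite has_find size_iota; exact: h.
by have := nth_find 0%N hs; rewrite nth_iota // => /asboolP.
Qed.

Definition Hk (w : Idx -> R) (k : int * int) : Prop :=
  (n0 * ngrp <= qn mu (w (cN k)))%N /\ forall q, (q < ngrp)%N -> (ch w k q < n0)%N.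

(* The roots [cl g 0] of neighbouring squares are joined through one of the [L]
   helpers of the first one. *)
Definition Ek (w : Idx -> R) (k : int * int) : Prop := forall g g', boxof g = k -> nbr g g' ->
  exists l, [/\ (0 < l)%N, (l <= L)%N, w (iE (epair (cl g l) (cl g 0))) < c0 f r &
     w (iE (epair (cl g l) (cl g' 0))) < c0 f r].

Variable W : seq (int * int).

(** Everything on which the renaming depends, as discrete data, so that it can be frozen while the
    edge variables remain random. *)
Definition Dd (w : Idx -> R) : seq (bool * seq nat) :=
  [seq ((n0 * ngrp <= qn mu (w (cN k)))%N, [seq ch w k q | q <- iota 0 ngrp]) | k <- W].
Definition dget (d : seq (bool * seq nat)) k := nth (false, [::]) d (index k W).
Definition cf (d : seq (bool * seq nat)) (k : int * int) (q : nat) : nat := nth n0 (dget d k).2 q.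
Definition Hd (d : seq (bool * seq nat)) (k : int * int) : Prop :=
  (dget d k).1 /\ forall q, (q < ngrp)%N -> (cf d k q < n0)%N.

Lemma dgetE w k : k \in W -> dget (Dd w) k =
  ((n0 * ngrp <= qn mu (w (cN k)))%N, [seq ch w k q | q <- iota 0 ngrp]).
Proof. by move=> kW; rewrite /dget /Dd nth_map_index. Qed.

Lemma cfE w k q : k \in W -> (q < ngrp)%N -> cf (Dd w) k q = ch w k q.
Proof. by move=> kW qG; rewrite /cf dgetE // -[LHS]/(nth n0 [seq ch w k q | q <- iota 0 ngrp] q) (nth_map 0%N) ?size_iota // nth_iota. Qed.

Lemma HdE w k : k \in W -> Hd (Dd w) k <-> Hk w k.
Proof.
by move=> kW; rewrite /Hd /Hk dgetE //; split=> -[H1 H2]; split=> // q qG; have := H2 q qG; rewrite cfE.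
Qed.

Section Config.
Variable w : Idx -> R.
Let c := cf (Dd w).
Let w' := relab (sc n0 c) w.
Local Notation chi g l := (sc n0 c (cl g l)).
Local Notation pathY := (crt (gedge (vertw (Y mu w)) (geo f w))).

Lemma chiE g l : boxof g \in W -> Hk w (boxof g) -> (l <= L)%N ->
  chi g l = (boxof g, (n0 * grp g l + ch w (boxof g) (grp g l))%N) /\
  (ch w (boxof g) (grp g l) < n0)%N.
Proof.
move=> gW [_ H] lL; have lt := H _ (grp_lt g lL); split=> //.
by rewrite /sc /= mulKn // modnMr {1}/c cfE ?grp_lt // lt /sw eqxx /c cfE // grp_lt.
Qed.

Lemma chi_vert g l : boxof g \in W -> Hk w (boxof g) -> (l <= L)%N -> vertw (Y mu w) (chi g l).
Proof.
move=> gW Hg lL; have [-> lt] := chiE gW Hg lL; apply/vertwE; rewrite nN_Y /=.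
case: Hg => H _; apply: leq_trans H; apply: (@leq_trans (n0 * (grp g l).+1)%N).
  by rewrite mulnS addnC ltn_add2r.
by rewrite leq_mul2l grp_lt ?orbT.
Qed.

Lemma chi_pos g l : boxof g \in W -> Hk w (boxof g) -> (l <= L)%N ->
  (g.1%:~R <= mm%:R * xw (chi g l) w <= g.1%:~R + 1) /\
  (g.2%:~R <= mm%:R * yw (chi g l) w <= g.2%:~R + 1).
Proof.
move=> gW Hg lL; have [E lt] := chiE gW Hg lL; rewrite E.
have := ch_hit lt; rewrite /hitp /= divn_grp // grp_sub //.
have [-> ->] := subof_div g => -[H1 H2].
have a1 : ((absz (g.1 %% mm)%Z)%:R : R) = (g.1 %% mm)%Z%:~R.
  by rewrite natr_absz ger0_norm // modz_ge0.
have a2 : ((absz (g.2 %% mm)%Z)%:R : R) = (g.2 %% mm)%Z%:~R.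
  by rewrite natr_absz ger0_norm // modz_ge0.
rewrite a1 in H1; rewrite a2 in H2.
have E1 : (g.1%:~R : R) = (g.1 %/ mm)%Z%:~R * mm%:R + (g.1 %% mm)%Z%:~R.
  by rewrite {1}(divz_eq g.1 mm) intrD intrM.
have E2 : (g.2%:~R : R) = (g.2 %/ mm)%Z%:~R * mm%:R + (g.2 %% mm)%Z%:~R.
  by rewrite {1}(divz_eq g.2 mm) intrD intrM.
rewrite /xw /yw E1 E2 /=.
move: H1 H2; move: (w _) (w _) => u v; split; lra.
Qed.

Lemma chi_geo g l g' l' : boxof g \in W -> Hk w (boxof g) -> boxof g' \in W -> Hk w (boxof g') ->
  (l <= L)%N -> (l' <= L)%N -> g = g' \/ nbr g g' -> (g, l) <> (g', l') ->
  w' (iE (epair (cl g l) (cl g' l'))) < c0 f r -> geo f w (chi g l) (chi g' l').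
Proof.
move=> gW Hg gW' Hg' lL lL' nb ne; rewrite /w' relabE => we.
split; first by move=> /(sc_inj n0_gt0) /(cl_inj lL lL') [E1 E2]; apply: ne; rewrite E1 E2.
apply: lt_le_trans we _; apply: fdec; first exact: sqrtr_ge0.
apply: dist_le; first by have := r0; lra.
have [h1 h2] := chi_pos gW Hg lL; have [h1' h2'] := chi_pos gW' Hg' lL'.
have [e1 e2] : (g'.1%:~R = g.1%:~R :> R \/ g'.1%:~R = g.1%:~R + 1 :> R) /\
    (g'.2%:~R = g.2%:~R :> R \/ g'.2%:~R = g.2%:~R + 1 :> R).
  by case: nb => [->|[->|->]] /=; rewrite ?intrD; split; by [left|right].
apply: (close_sq r0); rewrite mulrBr.
  by case: e1 => e1; rewrite e1 in h1'; lra.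
by case: e2 => e2; rewrite e2 in h2'; lra.
Qed.

Lemma chi_step g g' : boxof g \in W -> Hk w (boxof g) -> boxof g' \in W -> Hk w (boxof g') ->
  Ek w' (boxof g) -> nbr g g' -> pathY (chi g 0) (chi g' 0).
Proof.
move=> gW Hg gW' Hg' E nb; have [l [l0 lL w1 w2]] := E g g' erefl nb.
have ll : l <> 0%N by case: (l) l0.
apply: (rt_trans _ _ _ (chi g l)); apply: rt_step; do ?(split; first exact: chi_vert).
  by apply: geoC; apply: chi_geo => //; [left|case].
by apply: chi_geo => //; [right|case].
Qed.

Lemma div_in (z : int) (m i : nat) : (0 < m)%N -> (i < m)%N -> ((z * m%:Z + i%:Z)%R %/ m)%Z = z.
Proof.
move=> m0 im; rewrite divzMDl; last by case: (m) m0.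
by rewrite divz_small ?addr0 // ger0_norm //=.
Qed.

Definition corner (k : int * int) : int * int := (k.1 * mm%:Z, k.2 * mm%:Z)%R.

Lemma corner_box k : boxof (corner k) = k.
Proof.
by have := @div_in k.1 mm 0 isT isT; have := @div_in k.2 mm 0 isT isT;
  rewrite !boxofE /corner /= !addr0 => -> ->; case: (k).
Qed.

(** The roots are followed along a row or column of [mm] squares, from corner to corner. All these
    squares but the last lie in [k], so the edges of [k] alone are used. *)
Lemma box_step k k' : k \in W -> k' \in W -> Hk w k -> Hk w k' -> Ek w' k -> nbr k k' ->
  pathY (chi (corner k) 0) (chi (corner k') 0).
Proof.
move=> kW kW' Hg Hg' E nb.
pose e : int * int := if `[< k' = (k.1 + 1, k.2)%R >] then (1, 0)%R else (0, 1)%R.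
have ke : k' = (k.1 + e.1, k.2 + e.2)%R.
  rewrite /e; case: asboolP => [->|h] /=; first by rewrite addr0.
  by case: nb => // ->; rewrite addr0.
pose gi (i : nat) : int * int := ((corner k).1 + i%:Z * e.1, (corner k).2 + i%:Z * e.2)%R.
have e01 : e = (1, 0)%R \/ e = (0, 1)%R by rewrite /e; case: ifP; [left|right].
have bi i : (i < mm)%N -> boxof (gi i) = k.
  move=> im; have D1 j := @div_in k.1 mm j isT; have D2 j := @div_in k.2 mm j isT.
  rewrite /gi !boxofE /corner /=; case: e01 => -> /=; rewrite !mulr1 !mulr0 !addr0.
    by rewrite D1 // -[X in (X %/ _)%Z]addr0 (D2 0%N) //; case: (k).
  by rewrite D2 // -[X in (X %/ _)%Z]addr0 (D1 0%N) //; case: (k).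
have bm : gi mm = corner k'.
  by rewrite /gi /corner ke /=; congr pair; rewrite mulrDl (mulrC mm%:Z).
have g0 : gi 0%N = corner k by rewrite /gi !mul0r !addr0; case: (corner k).
have nbi i : nbr (gi i) (gi i.+1).
  rewrite /gi /=; case: e01 => -> /=; rewrite !mulr1 !mulr0 !addr0; [left|right];
    by congr pair; rewrite intS addrA addrAC.
rewrite -bm -g0.
suff H i : (i <= mm)%N -> pathY (chi (gi 0%N) 0) (chi (gi i) 0) by exact: H.
elim: i => [|i IH] im; first exact: rt_refl.
apply: rt_trans (IH (ltnW im)) _.
have [h1 h2] : boxof (gi i.+1) \in W /\ Hk w (boxof (gi i.+1)).
  have [lt|ge] := ltnP i.+1 mm; first by rewrite bi.
  have -> : i.+1 = mm by apply/eqP; rewrite eqn_leq im ge.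
  by rewrite bm corner_box.
by apply: chi_step => //; rewrite bi.
Qed.

Lemma dense_reach n : (0, 0)%R \in W ->
  (forall x, ((3 ^ n.+1)%N%:Z * 0 <= x.1 < (3 ^ n.+1)%N%:Z * (0 + 1))%R ->
   ((3 ^ n.+1)%N%:Z * 0 <= x.2 < (3 ^ n.+1)%N%:Z * (0 + 1))%R -> x \in W) ->
  (forall m, (m <= n.+1)%N -> good (fun k => (k \in W -> Hd (Dd w) k) /\ Ek w' k) m (0, 0)%R) ->
  Rc f (Y mu w) (0, 0)%R n.
Proof.
move=> W0 Wn H.
set g := fun k => _ in H.
have gP k : g k -> k \in W -> Hk w k by move=> [h _] kW; apply/HdE => //; exact: h.
have [x [px fx]] := @hier_reach g (fun k => k \in W) n (@blkR_in (fun k => k \in W) n.+1 (0, 0)%R Wn) H.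
exists (chi (corner (0, 0)%R) 0), (chi (corner x) 0).
have g0 : g (0, 0)%R := H 0%N isT.
have cb y : (chi (corner y) 0).1 = y by rewrite sc_box; exact: corner_box.
split.
- exact: cb.
- by apply: chi_vert; rewrite ?corner_box //; exact: gP.
- by rewrite /far /mkset cb.
have E : crt (gedge (vertw (Y mu w)) (geo f w)) (chi (corner (0, 0)%R) 0) (chi (corner x) 0).
  elim: px => [y z [gy gz yW zW nb]|y|y z t _ a _ b].
  - case: nb => nb.
      by apply: box_step => //; [exact: gP|exact: gP|case: gy].
    apply: crt_sym; first by move=> a b [? [? ?]]; split=> //; split=> //; exact: geoC.
    by apply: box_step => //; [exact: gP|exact: gP|case: gz].
  - exact: rt_refl.
  - exact: rt_trans a b.
by apply: crt_sub E => a b [? [? ?]]; split=> //; split=> //; exact/geo_Y.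
Qed.
End Config.
End Dense.

Lemma prod_le_pow (R : realType) (K : eqType) (s : seq K) (F : K -> R) (x : R) : 0 <= x ->
  (forall k, k \in s -> 0 <= F k <= x) -> \prod_(k <- s) F k <= x ^+ size s.
Proof.
move=> x0; elim: s => [|a s IH] H; first by rewrite big_nil expr0.
rewrite big_cons exprS; have /andP[a0 a1] := H a (mem_head _ _).
have Hs k : k \in s -> 0 <= F k <= x by move=> ks; apply: H; rewrite inE ks orbT.
apply: ler_pM => //; last exact: IH.
by rewrite big_seq; apply: prodr_ge0 => k /Hs /andP[].
Qed.

(** * The probability of dense boxes *)

Section DenseLaw.
Variables (R : realType) (f : R -> R) (r : R).
Hypothesis fdec : forall s t : R, 0 <= s -> s <= t -> f t <= f s.
Hypothesis f01 : forall s : R, 0 <= s -> 0 <= f s <= 1.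
Hypothesis r0 : 0 < r.
Hypothesis fr2 : forall s : R, 0 <= s -> s < r -> 0 < f s.
Variables (Q : probability (Om R Idx) R) (lam : R).
Hypothesis mQ : model Q lam.
Variables (L n0 : nat) (mu : R).
Hypothesis n0_gt0 : (0 < n0)%N.
Hypothesis mu0 : 0 < mu.
Local Notation mm := (mm r).
Local Notation boxof := (boxof mm).
Local Notation cl := (cl r L n0).
Local Notation ngrp := (ngrp r L).
Local Notation c0 := (c0 f r).
Local Notation ch := (@ch R r L n0).
Local Notation hitp := (hitp r L n0).
Local Notation Hk := (@Hk R r L n0 mu).
Local Notation Ek := (@Ek R f r L n0).
Let iQ : indep Q. Proof. by case: mQ. Qed.
Let uQ i t : isU i -> pr Q [set w | w i <= t] = Num.min (Num.max t 0) 1.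
Proof. by case: mQ => _ _; apply. Qed.

(** Exactly one end of each edge in question has [l > 0], and its square determines the box: no edge
    variable is shared between boxes. *)
Definition JK (k : int * int) : set Idx := [set i |
  [\/ i = cN k, exists a e, a.1 = k /\ i = iX a e |
      exists g l g', [/\ boxof g = k, (0 < l)%N, (l <= L)%N & i = iE (epair (cl g l) (cl g' 0))]]].

Lemma JK_disj k k' i : JK k i -> JK k' i -> k = k'.
Proof.
case=> [->|[a [e [<- ->]]]|[g [l [g1 [<- l0 lL ->]]]]];
case=> [E|[a' [e' [<- E]]]|[g' [l' [g1' [<- l0' lL' E]]]]] //.
- by case: E.
- by have [->] := iX_inj E.
have [[/(cl_inj n0_gt0 lL lL') [-> _] //]|[/(cl_inj n0_gt0 lL (leq0n _)) [_ El]]] := epair_eq (iE_inj E).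
by rewrite El in l0.
Qed.

Let sig_cell (J : set Idx) i (z : nat) : J i ->
  sig J [set w : Idx -> R | z%:R <= mm%:R * w i <= z%:R + 1].
Proof.
move=> Ji; apply: (sig_coord (B := [set u : R | z%:R <= mm%:R * u <= z%:R + 1])) => //.
rewrite (_ : [set _ | _] = `[z%:R / mm%:R, (z%:R + 1) / mm%:R]%classic); first exact: measurable_itv.
by apply/seteqP; split=> u /=; rewrite in_itv /= ler_pdivrMr ?ler_pdivlMr ?(mm_gt0 r) // !(mulrC u).
Qed.

Lemma pr_cell i (z : nat) : isU i -> (z < mm)%N ->
  mm%:R^-1 <= pr Q [set w | z%:R <= mm%:R * w i <= z%:R + 1].
Proof.
move=> ui zm; have m0 := mm_gt0 r.
have z1 : z%:R + 1 <= mm%:R :> R by rewrite natr1 ler_nat.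
rewrite (_ : mm%:R^-1 = (z%:R + 1) / mm%:R - z%:R / mm%:R); last by rewrite -mulrBl addrAC subrr add0r mul1r.
rewrite -(unif_co (Q := Q) (i := i)).
- apply: pr_le; last 2 first.
  + exact: sig_cell.
  + move=> w /=; rewrite ler_pdivrMr // ltr_pdivlMr // !(mulrC (w _)) => /andP[h1 h2].
    by rewrite h1 ltW.
  apply: (sig_coord (B := `[z%:R / mm%:R, (z%:R + 1) / mm%:R[%classic)) => //.
- by move=> t; exact: uQ.
- by rewrite divr_ge0 // ltW.
- by rewrite ler_pM2r ?invr_gt0 // lerDl.
- by rewrite ler_pdivrMr // mul1r.
Qed.

Lemma sig_hitp (J : set Idx) a : (forall e, J (iX a e)) -> sig J [set w | hitp a w].
Proof. by move=> Ja; apply: sig_and; exact: sig_cell. Qed.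

Lemma pr_hitp k q t : (q < ngrp)%N -> (t < n0)%N ->
  pr Q [set w | ~ hitp (k, n0 * q + t)%N w] <= 1 - mm%:R ^- 2.
Proof.
move=> qG tn; set a := (k, _).
have E : pr Q [set w | ~ hitp a w] = 1 - pr Q [set w | hitp a w] by rewrite -prC //; exact: sig_hitp.
rewrite E lerD2l lerN2.
have j2 : ((a.2 %/ n0) %/ L.+1 < mm ^ 2)%N.
  by rewrite /a /= divn_grp // ltn_divLR.
pose A e z := [set w : Idx -> R | z%:R <= mm%:R * w (iX a e) <= z%:R + 1].
have sA e z : sig [set iX a e] (A e z) by exact: sig_cell.
have d12 : [set iX a false] `&` [set iX a true] = set0 :> set Idx.
  by apply/seteqP; split=> // i [->].
have := indep_sig iQ d12 (sA false ((a.2 %/ n0) %/ L.+1 %/ mm)%N) (sA true ((a.2 %/ n0) %/ L.+1 %% mm)%N).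
move=> E2; rewrite [leRHS]E2 expr2 invfM; apply: ler_pM.
- by rewrite invr_ge0 ltW // mm_gt0.
- by rewrite invr_ge0 ltW // mm_gt0.
- by apply: pr_cell => //; rewrite ltn_divLR // mulnn.
- by apply: pr_cell => //; rewrite ltn_mod.
Qed.

Lemma ch_none w k q : ~ (ch w k q < n0)%N <-> forall t, t \in iota 0 n0 -> ~ hitp (k, n0 * q + t)%N w.
Proof.
rewrite chE -[X in (_ < X)%N](size_iota 0 n0) -has_find; split.
  by move=> /negP /hasPn H t /H /asboolP.
by move=> H; apply/negP/hasPn => t /H h; apply/negP => /asboolP.
Qed.

Lemma sig_ch (J : set Idx) k q : (forall a e, a.1 = k -> J (iX a e)) -> sig J [set w | ~ (ch w k q < n0)%N].
Proof.
move=> HJ; apply: (@sig_ext _ _ _ (fun w => forall t, t \in iota 0 n0 -> ~ hitp (k, n0 * q + t)%N w)).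
  by move=> w; rewrite ch_none.
apply: sig_all => t; apply: sig_imp; first exact: sig_cst.
by apply: sig_not; apply: sig_hitp => e; exact: HJ.
Qed.

Lemma pr_ch k q : (q < ngrp)%N -> pr Q [set w | ~ (ch w k q < n0)%N] <= (1 - mm%:R ^- 2) ^+ n0.
Proof.
move=> qG; rewrite (_ : [set _ | _] = [set w | forall t, t \in iota 0 n0 -> [set w | ~ hitp (k, n0 * q + t)%N w] w]); last first.
  by apply/seteqP; split=> w /ch_none.
rewrite (indep_blocks iQ (J := fun t => [set i | exists e, i = iX (k, n0 * q + t)%N e])).
- rewrite -[X in _ ^+ X](size_iota 0 n0); apply: prod_le_pow.
    by rewrite subr_ge0 -exprVn exprn_ile1 ?invr_ge0 // invf_le1 ?ler1n // mm_gt0.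
  by move=> t; rewrite mem_iota => /= tn; rewrite pr_ge0 pr_hitp.
- exact: iota_uniq.
- move=> t t' _ _ ne; apply/seteqP; split=> // i [[e ->] [e' /iX_inj [[E] _]]].
  by rewrite (addnI E) eqxx in ne.
- by move=> t _; apply: sig_not; apply: sig_hitp => e; exists e.
Qed.

Lemma sig_Hk k : sig (JK k) [set w | Hk w k].
Proof.
apply: sig_and.
  apply: (disc_pred (D := fun w => qn mu (w (cN k))) (Q := fun c _ => (n0 * ngrp <= c)%N)).
    by apply: disc_qn => //; apply: Or31.
  by move=> c; exact: sig_cst.
apply: sig_all => q; apply: sig_imp; first exact: sig_cst.
apply: (@sig_ext _ _ _ (fun w => ~ ~ (ch w k q < n0)%N)); first by move=> w; split; [exact: contrapT|move=> h; apply].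
by apply: sig_not; apply: sig_ch => a e ak; apply: Or32; exists a, e.
Qed.

Lemma pr_Hk k : pr Q [set w | ~ Hk w k] <= psum mu (n0 * ngrp) + ngrp%:R * (1 - mm%:R ^- 2) ^+ n0.
Proof.
pose A := [set w : Idx -> R | (qn mu (w (cN k)) < n0 * ngrp)%N].
pose F q := [set w | ~ (ch w k q < n0)%N].
have sF q : sig setT (F q) by exact: sig_ch.
have sA : sig setT A.
  apply: (disc_pred (D := fun w => qn mu (w (cN k))) (Q := fun c _ => (c < n0 * ngrp)%N)); first exact: disc_qn.
  by move=> c; exact: sig_cst.
have sB : sig setT [set w | exists2 q, q \in iota 0 ngrp & F q w] by exact: sig_ex2.
apply: (@le_trans _ _ (pr Q (A `|` [set w | exists2 q, q \in iota 0 ngrp & F q w]))).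
  apply: pr_le; [|exact: sigU|].
    by apply: sig_not; apply: (@sig_sub _ _ (JK k)) => //; exact: sig_Hk.
  move=> w nH; have [lt|ge] := ltnP (qn mu (w (cN k))) (n0 * ngrp)%N; first by left.
  right; apply: contrapT => nE; apply: nH; split=> // q qG.
  by apply: contrapT => nq; apply: nE; exists q => //; rewrite mem_iota.
apply: le_trans (prU_le Q sA sB) _; apply: lerD; first by rewrite (pr_qn_lt mQ).
apply: le_trans (pr_bigU_le Q (iota 0 ngrp) sF) _.
apply: (@le_trans _ _ (\sum_(q <- iota 0 ngrp) (1 - mm%:R ^- 2) ^+ n0)).
  rewrite big_seq [leRHS]big_seq; apply: ler_sum => q; rewrite mem_iota => /= qG; exact: pr_ch.
by rewrite big_const_seq iter_addr_0 count_predT size_iota mulr_natl.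
Qed.

Lemma sig_Ek_gen (J : set Idx) k : (forall g l g', boxof g = k -> (0 < l)%N -> (l <= L)%N ->
    J (iE (epair (cl g l) (cl g' 0)))) -> sig J [set w | Ek w k].
Proof.
move=> HJ; apply: sig_all => g; apply: sig_all => g'.
have [gk|ngk] := pselect (boxof g = k); last by apply: sig_triv => w.
do 2! (apply: sig_imp; first exact: sig_cst).
apply: sig_ex => l.
have [lL|nl] := boolP ((0 < l) && (l <= L))%N; last first.
  apply: (@sig_ext _ _ _ (fun=> False)); last exact: sig_cst.
  by move=> w; split=> // -[h1 h2]; rewrite h1 h2 in nl.
have /andP[l0 l1] := lL.
apply: (@sig_ext _ _ _ (fun w => w (iE (epair (cl g l) (cl g 0))) < c0 /\
     w (iE (epair (cl g l) (cl g' 0))) < c0)).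
  by move=> w; split=> [[]|[]].
by apply: sig_and; apply: sig_lt; exact: HJ.
Qed.

Lemma sig_Ek k : sig (JK k) [set w | Ek w k].
Proof. by apply: sig_Ek_gen => g l g' gk l0 lL; apply: Or33; exists g, l, g'. Qed.

Let c01 : 0 <= c0 <= 1. Proof. by apply: f01; have := r0; lra. Qed.

(** The [L] helpers give independent attempts, each of which needs two edges and succeeds with
    probability [c0 ^+ 2]. *)
Lemma pr_helper g g' : nbr g g' -> pr Q [set w | ~ exists l, [/\ (0 < l)%N, (l <= L)%N,
     w (iE (epair (cl g l) (cl g 0))) < c0 & w (iE (epair (cl g l) (cl g' 0))) < c0]]
  <= (1 - c0 ^+ 2) ^+ L.
Proof.
move=> nb.
have gg : g <> g'.
  case: nb => E H; have := congr1 fst E; have := congr1 snd E; rewrite -H /=;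
    move: (g.1) (g.2) => u v; clear; lia.
pose B l := [set w : Idx -> R | w (iE (epair (cl g l) (cl g 0))) < c0] `&`
   [set w : Idx -> R | w (iE (epair (cl g l) (cl g' 0))) < c0].
pose Jl l : set Idx := [set i | i = iE (epair (cl g l) (cl g 0)) \/ i = iE (epair (cl g l) (cl g' 0))].
have sB l : sig (Jl l) (B l) by apply: sigI; apply: sig_lt; [left|right].
rewrite (_ : [set _ | _] = [set w | forall l, l \in iota 1 L -> (~` B l) w]); last first.
  apply/seteqP; split=> w /=.
    by move=> H l; rewrite mem_iota add1n ltnS => /andP[l0 lL] [h1 h2]; apply: H; exists l.
  by move=> H [l [l0 lL h1 h2]]; apply: (H l); rewrite ?mem_iota ?l0 ?add1n.
have pair_eq l l' u v : (0 < l)%N -> (l <= L)%N -> (l' <= L)%N -> 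
    iE (epair (cl g l) (cl u 0)) = iE (epair (cl g l') (cl v 0)) -> l = l' /\ (u = v).
  move=> l0 lL lL' E.
  case: (epair_eq (iE_inj E)) => -[].
    by move=> /(cl_inj n0_gt0 lL lL') [_ ->] /(cl_inj n0_gt0 (leq0n _) (leq0n _)) [-> _].
  by move=> /(cl_inj n0_gt0 lL (leq0n _)) [_ El]; rewrite El in l0.
have inL l : l \in iota 1 L -> (0 < l)%N /\ (l <= L)%N.
  by rewrite mem_iota add1n ltnS => /andP[].
rewrite (indep_blocks iQ (J := Jl)).
- rewrite -[X in _ ^+ X](size_iota 1 L); apply: prod_le_pow.
    by rewrite subr_ge0 exprn_ile1; case/andP: c01.
  move=> l /inL [l0 lL]; rewrite pr_ge0 /= prC; last by apply: (@sig_sub _ _ (Jl l)).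
  rewrite lerD2l lerN2 /B.
  have s1 u : sig [set iE (epair (cl g l) (cl u 0))] [set w : Idx -> R | w (iE (epair (cl g l) (cl u 0))) < c0].
    exact: sig_lt.
  rewrite (indep_sig iQ _ (s1 g) (s1 g')); last first.
    apply/seteqP; split=> // i [-> E]; apply: gg.
    by have [] := pair_eq _ _ _ _ l0 lL lL E.
  have U u : pr Q [set w | w (iE (epair (cl g l) (cl u 0))) < c0] = c0.
    by apply: unif_lt => // t; exact: uQ.
  by rewrite !U expr2.
- exact: iota_uniq.
- move=> l l' /inL [l0 lL] /inL [l0' lL'] ne; apply/seteqP; split=> // i [[->|->] [E|E]];
    by have [El _] := pair_eq _ _ _ _ l0 lL lL' E; rewrite El eqxx in ne.
- by move=> l _; apply: sigC.
Qed.

Definition sqk (k : int * int) : seq (int * int) :=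
  [seq ((k.1 * mm%:Z + i%:Z)%R, (k.2 * mm%:Z + j%:Z)%R) | i <- iota 0 mm, j <- iota 0 mm].

Lemma mem_sqk g : g \in sqk (boxof g).
Proof.
apply/allpairsP; exists (absz (g.1 %% mm)%Z, absz (g.2 %% mm)%Z).
have m0 g' := @modz_ge0 g' mm isT; have ml g' := @ltz_pmod g' mm isT.
split.
- rewrite mem_iota [X in _ && X]/=; have := m0 g.1; have := ml g.1; move: (g.1 %% mm)%Z (mm) => u m; clear; lia.
- rewrite mem_iota [X in _ && X]/=; have := m0 g.2; have := ml g.2; move: (g.2 %% mm)%Z (mm) => u m; clear; lia.
- by rewrite [LHS]surjective_pairing; congr pair; rewrite [RHS]/= gez0_abs ?m0 // -divz_eq.
Qed.

Lemma pr_Ek k : pr Q [set w | ~ Ek w k] <= (mm * mm * 2)%:R * (1 - c0 ^+ 2) ^+ L.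
Proof.
pose s := [seq (g, g') | g <- sqk k, g' <- [:: (g.1 + 1, g.2)%R; (g.1, g.2 + 1)%R]].
pose F (gg : (int * int) * (int * int)) := [set w : Idx -> R | boxof gg.1 = k /\ nbr gg.1 gg.2 /\ ~ exists l, [/\ (0 < l)%N, (l <= L)%N,
     w (iE (epair (cl gg.1 l) (cl gg.1 0))) < c0 & w (iE (epair (cl gg.1 l) (cl gg.2 0))) < c0]].
have sF gg : sig setT (F gg).
  apply: sig_and; first exact: sig_cst.
  apply: sig_and; first exact: sig_cst.
  apply: sig_not; apply: sig_ex => l.
  apply: (@sig_ext _ _ _ (fun w => ((0 < l)%N /\ (l <= L)%N) /\ (w (iE (epair (cl gg.1 l) (cl gg.1 0))) < c0 /\
     w (iE (epair (cl gg.1 l) (cl gg.2 0))) < c0))); first by move=> w; split=> [[[? ?] [? ?]]|[]].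
  by apply: sig_and; [exact: sig_cst|apply: sig_and; exact: sig_lt].
apply: (@le_trans _ _ (pr Q [set w | exists2 gg, gg \in s & F gg w])).
  apply: pr_le; [|exact: sig_ex2|].
    by apply: sig_not; apply: (@sig_sub _ _ (JK k)) => //; exact: sig_Ek.
  move=> w nE; apply: contrapT => nex; apply: nE => g g' gk nb.
  apply: contrapT => nl; apply: nex; exists (g, g'); last by [].
  apply/allpairsPdep; exists g, g'; split=> //; first by rewrite -gk; exact: mem_sqk.
  by rewrite !inE; case: nb => ->; rewrite eqxx ?orbT.
apply: le_trans (pr_bigU_le Q s sF) _.
have x0 : 0 <= (1 - c0 ^+ 2) ^+ L by rewrite exprn_ge0 // subr_ge0 exprn_ile1; case/andP: c01.
apply: (@le_trans _ _ (\sum_(gg <- s) (1 - c0 ^+ 2) ^+ L)).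
  apply: ler_sum => gg _; have [nb|nnb] := pselect (nbr gg.1 gg.2).
    apply: le_trans (pr_helper nb); apply: pr_le => //; last by move=> w [_ []].
    apply: sig_not; apply: sig_ex => l.
    apply: (@sig_ext _ _ _ (fun w => ((0 < l)%N /\ (l <= L)%N) /\ (w (iE (epair (cl gg.1 l) (cl gg.1 0))) < c0 /\
     w (iE (epair (cl gg.1 l) (cl gg.2 0))) < c0))); first by move=> w; split=> [[[? ?] [? ?]]|[]].
    by apply: sig_and; [exact: sig_cst|apply: sig_and; exact: sig_lt].
  rewrite (_ : F gg = set0) ?pr0 //.
  by apply/seteqP; split=> // w [_ []].
rewrite big_const_seq iter_addr_0 count_predT.
suff -> : size s = (mm * mm * 2)%N by rewrite [leRHS]mulr_natl.
have Es : size (sqk k) = (mm * mm)%N by rewrite size_allpairs !size_iota.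
rewrite /s size_allpairs_dep -Es; elim: (sqk k) => //= a l ->; by rewrite mulSn.
Qed.

Lemma sig_good_gen (J : set Idx) (g : int * int -> (Idx -> R) -> Prop) m k :
  (forall k, sig J [set w | g k w]) -> sig J [set w | good (g^~ w) m k].
Proof.
move=> sg; elim: m k => [|m IH] k; first exact: sg.
apply: sig_all => c; apply: sig_all => c'.
do 3! (apply: sig_imp; first exact: sig_cst).
by apply: sig_or; exact: IH.
Qed.

Let JD : set Idx := [set i | (exists k, i = cN k) \/ exists a e, i = iX a e].
Let JE : set Idx := [set i | if i is inl (inl (inr e)) then (pickle e.1 < pickle e.2)%N else false].

Let JDE : JD `&` JE = set0.
Proof. by apply/seteqP; split=> // i [[[k ->]|[a [e ->]]]]. Qed.

Let sig_relabE s (A : set (Idx -> R)) : injective s -> sig JE A ->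
  sig JE [set w : Idx -> R | A (relab s w)].
Proof.
move=> si sA.
have mid (i : Idx) : measurable_fun setT ((fun _ => id) i : R -> R) by exact: measurable_id.
apply: sig_sub (@sig_transport R Idx Idx (tauR s) (fun _ => id) mid JE A sA).
move=> _ [i Ji <-]; move: i Ji => [[[[k|[a c]]|[a b]]|a]|e] // ab.
apply: (@epair_lt (s a) (s b)); apply: contraTneq ab => /si ->; by rewrite /JE /mkset ltnn.
Qed.

Let disc_Dd W : disc JD (Dd r L n0 mu W).
Proof.
apply: disc_map => k _; apply: disc_pair.
  apply: (disc_comp (D := fun w => qn mu (w (cN k))) (fun c => (n0 * ngrp <= c)%N)).
  by apply: disc_qn => //; left; exists k.
apply: disc_map => q _.
have d : disc JD (fun w => [seq `[< hitp (k, n0 * q + t)%N w >] | t <- iota 0 n0]).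
  apply: disc_map => t _; apply: disc_asbool; apply: sig_hitp => e; right.
  by exists (k, n0 * q + t)%N, e.
have := disc_comp (fun l => find id l) d.
rewrite (_ : (fun w => _) = (fun w => ch w k q)) //.
by apply: funext => w; rewrite find_map.
Qed.

(** As [486 = 3 * 162], the three ways in which a box can fail (too few points, an empty square, a
    missing helper) share the initial bound of the hierarchy. *)
Hypothesis B1 : psum mu (n0 * ngrp) <= 486^-1.
Hypothesis B2 : ngrp%:R * (1 - mm%:R ^- 2) ^+ n0 <= 486^-1 :> R.
Hypothesis B3 : (mm * mm * 2)%:R * (1 - c0 ^+ 2) ^+ L <= 486^-1.

Lemma dense_perc n : 1 / 2 <= pr Q [set w | Rc f (Y mu w) (0, 0)%R n].
Proof.
pose W := window (0, 0)%R (3 ^ n.+1)%N.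
pose gK k := [set w | (k \in W -> Hk w k) /\ Ek w k].
have sgK k : sig (JK k) (gK k).
  apply: sig_and; last exact: sig_Ek.
  by apply: sig_imp; [exact: sig_cst|exact: sig_Hk].
have pgK k : pr Q (~` gK k) <= 162^-1.
  have s1 : sig setT [set w | ~ Hk w k].
    by apply: sig_not; apply: (@sig_sub _ _ (JK k)) => //; exact: sig_Hk.
  have s2 : sig setT [set w | ~ Ek w k].
    by apply: sig_not; apply: (@sig_sub _ _ (JK k)) => //; exact: sig_Ek.
  apply: (@le_trans _ _ (pr Q ([set w | ~ Hk w k] `|` [set w | ~ Ek w k]))).
    apply: pr_le; [by apply: sigC; apply: (@sig_sub _ _ (JK k))|exact: sigU|].
    move=> w ng; apply: contrapT => /not_orP [/contrapT h1 /contrapT h2]; apply: ng; by split.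
  apply: le_trans (prU_le Q s1 s2) _.
  apply: le_trans (lerD (pr_Hk k) (pr_Ek k)) _.
  by apply: le_trans (lerD (lerD B1 B2) B3) _; lra.
pose ev d w := forall m, (m <= n.+1)%N ->
   good (fun k => (k \in W -> Hd r L n0 W d k) /\ Ek w k) m (0, 0)%R.
have sev d : sig JE [set w | ev d w].
  apply: sig_all => m; apply: sig_imp; first exact: sig_cst.
  apply: (sig_good_gen (g := fun k w => (k \in W -> Hd r L n0 W d k) /\ Ek w k)) => k.
  apply: sig_and; first exact: sig_cst.
  apply: sig_Ek_gen => g l g' gk l0 lL; apply: (@epair_lt (cl g l) (cl g' 0)).
  by apply/eqP => /(cl_inj n0_gt0 lL (leq0n _)) [_ El]; rewrite El in l0.
have := hier_prob iQ JK_disj sgK pgK n.+1.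
rewrite (_ : [set w | _] = [set w | ev (Dd r L n0 mu W w) w]); last first.
  have E w : (fun k => (k \in W -> Hd r L n0 W (Dd r L n0 mu W w) k) /\ Ek w k) = (gK^~ w).
    apply: funext => k; apply: propext; split=> -[h1 h2]; split=> // kW.
      exact: (proj1 (@HdE R r L n0 mu W w k kW) (h1 kW)).
    exact: (proj2 (@HdE R r L n0 mu W w k kW) (h1 kW)).
  by apply/seteqP; split=> w; rewrite /mkset /ev E.
move=> H; apply: le_trans H _.
pose s d := sc n0 (cf n0 W d).
have si d : injective (s d) by exact: sc_inj.
have dD := disc_Dd W.
have sr d : sig JE [set w | ev d (relab (s d) w)] by exact: (sig_relabE (si d) (sev d)).
apply: (@le_trans _ _ (pr Q [set w | ev (Dd r L n0 mu W w) (relab (s (Dd r L n0 mu W w)) w)])).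
  apply: (cond_le iQ JDE JDE dD (A := fun d => [set w | ev d w]) (B := fun d => [set w | ev d (relab (s d) w)])) => // d.
  rewrite (relab_law mQ (si d) (A := [set w | ev d w])) //.
  by apply: (@sig_sub _ _ JE) => // -[[[[?|?]|?]|?]|?].
apply: pr_le.
- apply: (disc_pred (D := Dd r L n0 mu W) (Q := fun d w => ev d (relab (s d) w))); first exact: disc_sub dD.
  by move=> d; apply: (@sig_sub _ _ JE).
- by apply: sig_sub (sig_Y mu0 (sig_Rc fdec (0, 0)%R n)); exact: subsetT.
move=> w H; apply: (dense_reach fdec r0 n0_gt0 (L := L) (W := W)) => //.
- by rewrite mem_window bdistxx.
- move=> x; rewrite mem_window /bdist /=; move: (3 ^ n.+1)%N (x.1) (x.2) => e u v; clear; lia.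
Qed.

Lemma dense_inf : 0 < pr Q [set w | exists k, forall n, Rc f (Y mu w) k n].
Proof.
have sY k n : sig setT [set w | Rc f (Y mu w) k n].
  by apply: sig_sub (sig_Y mu0 (sig_Rc fdec k n)); exact: subsetT.
have H : 1 / 2 <= pr Q [set w | forall n, Rc f (Y mu w) (0, 0)%R n].
  apply: (pr_bigcap_ge (F := fun n => [set w | Rc f (Y mu w) (0, 0)%R n])) => [n|n w|n]; first exact: sY.
    exact: Rc_anti.
  exact: dense_perc.
apply: (@lt_le_trans _ _ (1 / 2)) => //; apply: le_trans H _; apply: pr_le.
- by apply: sig_all => n; exact: sY.
- by apply: sig_ex => k; apply: sig_all => n; exact: sY.
- by move=> w H; exists (0, 0)%R.
Qed.
End DenseLaw.

Lemma small_pow (R : realType) (x C e : R) : 0 <= x < 1 -> 0 < C -> 0 < e -> exists n, C * x ^+ n.+1 <= e.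
Proof.
move=> /andP[x0 x1] C0 e0.
have ec : 0 < e / C by exact: divr_gt0.
have x1' : `|x| < 1 by rewrite ger0_norm.
have /cvgrPdist_lt /(_ _ ec) [n _ Hn] := cvg_expr x1'.
exists n; have := Hn n.+1 (leqnSn n); rewrite /= sub0r normrN ger0_norm ?exprn_ge0 //.
by rewrite ltr_pdivlMr // mulrC => /ltW.
Qed.

Lemma high_intensity (R : realType) (f : R -> R) (r : R)
  (fdec : forall s t : R, 0 <= s -> s <= t -> f t <= f s)
  (f01 : forall s : R, 0 <= s -> 0 <= f s <= 1) (r0 : 0 < r)
  (fr2 : forall s : R, 0 <= s -> s < r -> 0 < f s)
  (Q : probability (Om R Idx) R) (lam : R) (mQ : model Q lam) :
  exists2 mu, 0 < mu & 0 < pr Q [set w | exists k, forall n, Rc f (Y mu w) k n].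
Proof.
have c00 : 0 < c0 f r by apply: fr2; have := r0; lra.
have c01 : c0 f r <= 1 by have /andP[] : 0 <= f (3 / 4 * r) <= 1 by apply: f01; have := r0; lra.
have m1 : 1 <= (mm r)%:R :> R by rewrite ler1n.
have m0 := mm_gt0 r.
have e0 : 0 < 486^-1 :> R by rewrite invr_gt0 ltr0n.
(* The order matters: [L] comes first, then [n0], because the number of groups depends on [L], and
   finally [mu], large compared with the number of labels. Exponents of the form [n.+1] ensure that
   [n0] is positive. *)
have [L HL] : exists L, (mm r * mm r * 2)%:R * (1 - c0 f r ^+ 2) ^+ L.+1 <= 486^-1.
  apply: small_pow; [|by rewrite ltr0n !muln_gt0|exact: e0].
  have : 0 < c0 f r ^+ 2 by exact: exprn_gt0.
  have : c0 f r ^+ 2 <= 1 by apply: exprn_ile1 => //; exact: ltW.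
  by move: (c0 f r ^+ 2) => u; lra.
have [n0 Hn] : exists n0, (ngrp r L.+1)%:R * (1 - (mm r)%:R ^- 2) ^+ n0.+1 <= 486^-1 :> R.
  apply: small_pow; [|by rewrite ltr0n muln_gt0 expn_gt0|exact: e0].
  have : 0 < (mm r)%:R ^- 2 :> R by rewrite invr_gt0 exprn_gt0.
  have : (mm r)%:R ^- 2 <= 1 :> R by rewrite invf_le1 ?exprn_gt0 // exprn_ege1.
  by move: (_ ^- 2) => u; lra.
pose N := (n0.+1 * ngrp r L.+1)%N.
pose mu : R := 1 + 486 * (N%:R * N`!%:R).
have NN : 0 <= N%:R * N`!%:R :> R by rewrite mulr_ge0.
have mu1 : 1 <= mu by rewrite /mu lerDl; apply: mulr_ge0; [exact: ler0n|exact: NN].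
have mu0 : 0 < mu by exact: lt_le_trans mu1.
exists mu => //.
apply: (dense_inf fdec f01 r0 mQ (L := L.+1) (n0 := n0.+1)) => //.
apply: le_trans (psum_small N mu1) _; rewrite ler_pdivrMr //.
move: NN; rewrite /mu; move: (N%:R * _) => u; lra.
Qed.

(** * The strict inequality *)

Section FromModel.
Variables (R : realType) (f : R -> R).
Hypothesis fdec : forall s t : R, 0 <= s -> s <= t -> f t <= f s.
Variables (d : measure_display) (T : measurableType d) (P : probability T R).
Variable X : Idx -> {RV P >-> R}.

Lemma P_rcm : P (rcm_percolates f X) = (pr (lawX X) [set w | exists k, forall n, Rc f w k n])%:E.
Proof.
rewrite -lawXE; last by apply: sig_ex => k; apply: sig_all => n; exact: sig_Rc.
by congr (P _); apply/seteqP; split=> t H;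
  [exact: (proj1 (rcm_perc_w f (fun i => X i t)) H)|exact: (proj2 (rcm_perc_w f (fun i => X i t)) H)].
Qed.

Lemma P_site p : P (site_perc f X p) = (pr (lawX X) [set w | exists k, forall n, Rs f p w k n])%:E.
Proof.
rewrite -lawXE; last by apply: sig_ex => k; apply: sig_all => n; exact: sig_Rs.
by congr (P _); apply/seteqP; split=> t H;
  [exact: (proj1 (site_perc_w f p (fun i => X i t)) H)|exact: (proj2 (site_perc_w f p (fun i => X i t)) H)].
Qed.

Lemma P_bond p : P (bond_perc f X p) = (pr (lawX X) [set w | exists k, forall n, Rb f p w k n])%:E.
Proof.
rewrite -lawXE; last by apply: sig_ex => k; apply: sig_all => n; exact: sig_Rb.
by congr (P _); apply/seteqP; split=> t H;
  [exact: (proj1 (bond_perc_w f p (fun i => X i t)) H)|exact: (proj2 (bond_perc_w f p (fun i => X i t)) H)].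
Qed.
End FromModel.

Lemma Rb_mono (R : realType) (f : R -> R) p p' w k n : p <= p' -> Rb f p w k n -> Rb f p' w k n.
Proof.
by move=> pp; apply: reach_sub => // a b _ _ [g wp]; split=> //; exact: lt_le_trans pp.
Qed.

(** Lowering [ps] by at most [eta / 2 / lam] costs at most [eta / 2] of intensity; the other half of
    [eta] is the slack allowed to [mu1]. *)
Lemma choose_below (R : realType) (lam ps eta mu1 : R) : 0 < lam -> 0 < ps -> 0 < eta ->
  lam * ps <= mu1 -> mu1 < lam * ps + eta / 2 ->
  exists p, [/\ ps / 2 <= p, p < ps, lam * p <= mu1 & mu1 - lam * p <= eta].
Proof.
move=> lam0 ps0 eta0 h1 h2; exists (ps - Num.min (ps / 2) (eta / 2 / lam)).
have d0 : 0 < Num.min (ps / 2) (eta / 2 / lam) by rewrite lt_min !divr_gt0.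
have d1 : Num.min (ps / 2) (eta / 2 / lam) <= ps / 2 by rewrite ge_min lexx.
have d2 : lam * Num.min (ps / 2) (eta / 2 / lam) <= eta / 2.
  by rewrite mulrC -ler_pdivlMr // ge_min lexx orbT.
move: (Num.min _ _) d0 d1 d2 => u d0 d1 d2; have : 0 < lam * u by exact: mulr_gt0.
by split; rewrite ?mulrBr; lra.
Qed.

Theorem theorem2 (R : realType) (f : R -> R) (lam : R)
  (d : measure_display) (T : measurableType d) (P : probability T R)
  (X : Idx -> {RV P >-> R}) :
  (forall a, 0 <= a -> 0 <= f a <= 1) ->
  (forall a b, 0 <= a -> a <= b -> f b <= f a) ->
  has_sup [set a | 0 <= a /\ 0 < f a] ->
  0 < sup [set a | 0 <= a /\ 0 < f a] ->
  lambda_crit f < lam ->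
  rcm_model X lam ->
  pc_bond f X < pc_site f X.
Proof.
move=> f01 fdec [S0 Sub]; set r := sup _ => r0 lc mX.
have fr1 s : 0 <= s -> 0 < f s -> s <= r by move=> s0 fs; exact: ub_le_sup.
have fr2 s : 0 <= s -> s < r -> 0 < f s.
  move=> s0 /(sup_gt S0) [a [a0 fa] sa]; apply: lt_le_trans fa _.
  by apply: fdec => //; exact: ltW.
pose Q := lawX X; have mQ : model Q lam by exact: rcm_model_law.
(* The intensities that percolate, all realized on the given space. [SM] and [MS] identify [M] with
   the set whose infimum is [lambda_crit]. *)
pose M := [set mu : R | 0 < mu /\ 0 < pr Q [set w | exists k, forall n, Rc f (Y mu w) k n]].
have sRc : sig setT [set w | exists k, forall n, Rc f w k n].
  by apply: sig_ex => k; apply: sig_all => n; exact: sig_Rc.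
have SM mu : (exists (d : measure_display) (T : measurableType d) (P : probability T R)
    (X : Idx -> {RV P >-> R}), rcm_model X mu /\ (0 < P (rcm_percolates f X))%E) -> 0 < mu -> M mu.
  move=> [d' [T' [P' [X' [mX' pX']]]]] mu0; split=> //.
  rewrite P_rcm // lte_fin in pX'.
  by rewrite -(pr_Y mQ mu0 (rcm_model_law mX') sRc).
have MS mu : M mu -> exists (d : measure_display) (T : measurableType d) (P : probability T R)
    (X : Idx -> {RV P >-> R}), rcm_model X mu /\ (0 < P (rcm_percolates f X))%E.
  move=> [mu0 pm]; have [Z [mZ EZ]] := build_model mX mu0.
  exists d, T, P, Z; split=> //; rewrite P_rcm // lte_fin.
  by rewrite (pr_Y mQ mu0 (rcm_model_law mZ) sRc).
have [muH muH0 pH] := high_intensity fdec f01 r0 fr2 mQ.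
have M0 : M !=set0 by exists muH.
pose C : R := (((DD r).*2.+1) ^ 2)%:R.
have C0 : 0 < C by rewrite ltr0n expn_gt0.
(* Below [1 / 2 / C] the counting of walks in [subcritical] excludes percolation, so the infimum of
   [M] is positive. *)
have Mlb : lbound M (1 / 2 / C).
  move=> mu [mu0 pm]; rewrite leNgt; apply/negP => lt.
  move: pm; rewrite (subcritical fdec r0 fr1 mQ mu0) ?ltxx //.
  by rewrite mulrC; rewrite ltr_pdivlMr // in lt; exact: ltW.
have hM : has_lbound M by exists (1 / 2 / C).
pose ms := inf M.
have ms0 : 0 < ms.
  by apply: (@lt_le_trans _ _ (1 / 2 / C)); [rewrite !divr_gt0|exact: lb_le_inf].
have msl : ms < lam.
  have [|mu [mu0 H] ml] := inf_lt _ lc.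
    by exists muH; split=> //; exact: MS.
  by apply: le_lt_trans ml; exact: ge_inf hM _ (SM _ H mu0).
have lam0 : 0 < lam by exact: lt_trans msl.
pose ps := ms / lam.
have ps0 : 0 < ps by exact: divr_gt0.
have ps1 : ps < 1 by rewrite ltr_pdivrMr // mul1r.
have lps : lam * ps = ms by rewrite /ps mulrC divfK // gt_eqF.
(* If sites percolated at [p], the intensity [lam * p] would belong to [M] although it is below the
   infimum. *)
have site p : 0 < p -> p < ps -> P (site_perc f X p) = 0%E.
  move=> p0 pps; rewrite P_site //; congr (_%:E); apply/eqP; apply/negPn/negP => ne.
  have pos : 0 < pr Q [set w | exists k, forall n, Rs f p w k n] by rewrite lt_def ne pr_ge0.
  have lp : 0 < lam * p by exact: mulr_gt0.
  have Mp : M (lam * p) by split; [exact: lp|]; apply: (site_to_Y fdec r0 fr1 lam0 mQ p0 _ pos); exact: lt_trans ps1.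
  have : ms <= lam * p by exact: ge_inf.
  by rewrite leNgt -lps ltr_pM2l // pps.
have [eta eta0 gap] := bond_gap fdec f01 r0 fr1 fr2 lam0 mQ ps0 ps1.
have e2 : 0 < eta / 2 by rewrite divr_gt0.
(* The infimum need not belong to [M]; an element within [eta / 2] of it is taken instead. *)
have [mu1 [mu10 pm1] mu1e] := inf_adherent e2 (conj M0 hM).
have msm : ms <= mu1 by apply: ge_inf.
have [p [p2 pps lpm mle]] : exists p, [/\ ps / 2 <= p, p < ps, lam * p <= mu1 & mu1 - lam * p <= eta].
  by apply: choose_below => //; rewrite lps.
have p0 : 0 < p by apply: lt_le_trans p2; exact: divr_gt0.
have bp : 0 < pr Q [set w | exists k, forall n, Rb f p w k n] by exact: gap lpm mle pm1.
have sRb q : sig setT [set w | exists k, forall n, Rb f q w k n].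
  by apply: sig_ex => k; apply: sig_all => n; exact: sig_Rb.
have bond q : p <= q -> P (bond_perc f X q) <> 0%E.
  move=> pq; rewrite P_bond // => -[E].
  have : pr Q [set w | exists k, forall n, Rb f p w k n] <= pr Q [set w | exists k, forall n, Rb f q w k n].
    by apply: pr_le => // w [k H]; exists k => n; exact: Rb_mono pq (H n).
  by rewrite /Q E leNgt bp.
(* Bonds percolate from [p] on while sites do not below [ps], so [p] and a point strictly between
   [p] and [ps] separate the two critical values. *)
apply: (@le_lt_trans _ _ p).
  rewrite /pc_bond; set A := [set _ | _].
  have [ne|ne] := pselect (A !=set0).
    by apply: ge_sup => // q [_ Pq]; rewrite leNgt; apply/negP => pq; exact: (bond q (ltW pq)).
  (* The supremum of the empty set is [0] by convention, and [0 < p]. *)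
  have -> : A = set0 by apply/seteqP; split=> // q Aq; case: ne; exists q.
  by rewrite sup0 ltW.
have [q1 q2] := midf_lt pps; have q0 := lt_trans p0 q1.
apply: lt_le_trans q1 _; rewrite /pc_site; apply: ub_le_sup.
  by exists 1 => q [/andP[_ ?] _].
by split; [rewrite !ltW // (lt_trans q2 ps1)|exact: site].
Qed.
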